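(* Let $s\in(0,1)$, $T>0$, and let $k:\mathbb{R}\to\mathbb{R}$ be a bounded $T$-periodic function. There exists $\gamma\ge 0$ such that for each $\mu\ge\gamma$ and each $g\in L^2_T$, the problem $$L_\mu u:=(-\partial_{xx})^s u+k(x)u+\mu u=g\quad\text{in }\mathbb{R}$$ admits a unique weak ($T$-)periodic solution $u=:L_\mu^{-1}g\in H^s_T$. Moreover, the estimate $$\|u\|_{H^s_T}\le C\|g\|_{L^2_T}$$ holds with a constant $C$ independent of $g$.
   Context: All functions are real-valued; $a:=1-2s\in(-1,1)$, $d_s:=2^{2s-1}\frac{\Gamma(s)}{\Gamma(1-s)}$. $(-\partial_{xx})^s$ is the Fourier multiplier with symbol $|\xi|^{2s}$ (on $T$-periodic functions it multiplies the mode $e^{2\pi i m x/T}$ by $|2\pi m/T|^{2s}$). Spaces: $L^2_T$ is the space of $T$-periodic $u$ with $\|u\|_{L^2_T}^2:=\int_{-T/2}^{T/2}u^2dx<\infty$, with inner product $\langle u,v\rangle=\int_{-T/2}^{T/2}uv\,dx$. $H^s_T$ is the space of $T$-periodic $u$ with $$\|u\|_{H^s_T}^2:=\int_{-T/2}^{T/2}\int_{-T/2}^{T/2}\frac{|u(x)-u(\bar x)|^2}{|x-\bar x|^{1+2s}}dx\,d\bar x+\int_{-T/2}^{T/2}u^2dx<\infty.$$ $\mathcal{H}_T$ is the space of (weakly differentiable) functions $U(x,y)$ on $\mathbb{R}\times(0,\infty)$, $T$-periodic in $x$, with trace $U(x,0)$ on $y=0$ and $$\int_{-T/2}^{T/2}\int_0^\infty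 y^a|\nabla U|^2dy\,dx+\int_{-T/2}^{T/2}U^2(x,0)dx<\infty.$$ Weak solution: $u$ is a weak $T$-periodic solution of $(-\partial_{xx})^su+k u+\mu u=g$ if $u(x)=U(x,0)$ for some $U\in\mathcal{H}_T$ such that $$d_s\int_0^\infty\int_{-T/2}^{T/2}y^a\nabla U\cdot\nabla V\,dx\,dy+\int_{-T/2}^{T/2}(k(x)+\mu)U(x,0)V(x,0)dx=\int_{-T/2}^{T/2}g(x)V(x,0)dx\quad\text{for all }V\in\mathcal{H}_T.$$ This is the weak form of the degenerate problem $\mathrm{div}(y^a\nabla U)=0$ in the upper half-plane, $-d_s\lim_{y\downarrow0}y^aU_y+kU+\mu U=g$ on $y=0$. *)

(* Defs.v *)
From HB Require Import structures.
From mathcomp Require Import all_boot all_order all_algebra.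
From mathcomp Require Import all_classical all_reals all_analysis.

Set Implicit Arguments.
Unset Strict Implicit.
Unset Printing Implicit Defensive.

Import Order.TTheory GRing.Theory Num.Theory.
Import numFieldNormedType.Exports.

Local Open Scope classical_set_scope.
Local Open Scope ring_scope.

(* Elements of L^2_T, H^s_T and H_T are classes modulo equality almost
   everywhere: they are represented by Borel measurable, everywhere periodic
   functions, and equalities between them are stated almost everywhere. *)

Notation leb1 R := (@lebesgue_measure R).
Notation leb2 R := (@lebesgue_measure R \x @lebesgue_measure R)%E.

Definition Gamma (R : realType) (p : R) : R :=
  \int[(leb1 R)]_(t in `]0, +oo[) (t `^ (p - 1) * expR (- t)).

Definition ds (R : realType) (s : R) : R :=
  2 `^ (2 * s - 1) * (Gamma s / Gamma (1 - s)).

Definition period_cell (R : realType) (T : R) : set R := `[- (T / 2), T / 2].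

Definition L2T_sqnorm (R : realType) (T : R) (u : R -> R) : \bar R :=
  (\int[(leb1 R)]_(x in period_cell T) ((u x ^+ 2)%:E))%E.

Definition L2T (R : realType) (T : R) (u : R -> R) : Prop :=
  [/\ measurable_fun setT u, periodic u T & (L2T_sqnorm T u < +oo)%E].

Definition L2T_norm (R : realType) (T : R) (u : R -> R) : R :=
  Num.sqrt (fine (L2T_sqnorm T u)).

Definition HsT_sqnorm (R : realType) (s T : R) (u : R -> R) : \bar R :=
  (\int[(leb1 R)]_(x in period_cell T) \int[(leb1 R)]_(z in period_cell T)
     ((`|u x - u z| ^+ 2 / `|x - z| `^ (1 + 2 * s))%:E)
   + L2T_sqnorm T u)%E.

Definition HsT (R : realType) (s T : R) (u : R -> R) : Prop :=
  [/\ measurable_fun setT u, periodic u T & (HsT_sqnorm s T u < +oo)%E].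

Definition HsT_norm (R : realType) (s T : R) (u : R -> R) : R :=
  Num.sqrt (fine (HsT_sqnorm s T u)).

(* Functions on the open half-plane R x (0, oo) are represented by functions
   on R * R; their values at points with p.2 <= 0 are irrelevant. *)
Definition half_plane (R : realType) : set (R * R) := [set p | 0 < p.2].
Arguments half_plane : clear implicits.

Definition half_strip (R : realType) (T : R) : set (R * R) :=
  period_cell T `*` [set y | 0 < y].

Definition loc_integrable (R : realType) (U : R * R -> R) : Prop :=
  measurable_fun (half_plane R) U /\
  forall K : set (R * R), compact K -> K `<=` half_plane R ->
    (\int[(leb2 R)]_(p in K) (`|U p|%:E) < +oo)%E.

Definition e_x (R : realType) : R * R := (1, 0).
Definition e_y (R : realType) : R * R := (0, 1).

Fixpoint Cn (R : realType) (n : nat) (phi : R * R -> R) : Prop :=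
  match n with
  | 0 => continuous phi
  | m.+1 =>
    [/\ continuous phi,
        forall p, derivable phi p (e_x R) /\ derivable phi p (e_y R),
        Cn m (fun p => 'D_(e_x R) phi p) & Cn m (fun p => 'D_(e_y R) phi p)]
  end.

Definition test_function (R : realType) (phi : R * R -> R) : Prop :=
  (forall n, Cn n phi) /\
  exists K : set (R * R),
    [/\ compact K, K `<=` half_plane R & forall p, ~ K p -> phi p = 0].

Definition weak_partial (R : realType) (v : R * R) (U W : R * R -> R) : Prop :=
  loc_integrable W /\
  forall phi, test_function phi ->
    \int[(leb2 R)]_(p in half_plane R) (U p * 'D_v phi p) =
    - \int[(leb2 R)]_(p in half_plane R) (W p * phi p).

(* u is the trace of U on y = 0: U(., y) tends to u in L^2 over a period as
   y -> 0+, where y avoids a null set since U is only given almost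
   everywhere. A locally integrable U whose weak gradient has finite
   y^(1-2s)-weighted energy always has such a trace. *)
Definition is_trace (R : realType) (T : R) (U : R * R -> R) (u : R -> R)
    : Prop :=
  forall eps : R, 0 < eps -> exists2 delta : R, 0 < delta &
    {ae (leb1 R), forall y, 0 < y < delta ->
      (\int[(leb1 R)]_(x in period_cell T) (((U (x, y) - u x) ^+ 2)%:E)
         <= eps%:E)%E}.

Definition energy (R : realType) (s T : R) (W1 W2 : R * R -> R) : \bar R :=
  (\int[(leb2 R)]_(p in half_strip T)
     ((p.2 `^ (1 - 2 * s) * (W1 p ^+ 2 + W2 p ^+ 2))%:E))%E.

(* The weak partial derivatives and the trace are determined by ht_fun up to
   null sets; they are recorded as fields only to be able to name them. *)
Record HT (R : realType) (s T : R) := MkHT {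
  ht_fun : R * R -> R;
  ht_dx : R * R -> R;
  ht_dy : R * R -> R;
  ht_trace : R -> R;
  ht_loc : loc_integrable ht_fun;
  ht_per : forall x y, 0 < y -> ht_fun (x + T, y) = ht_fun (x, y);
  ht_weak_dx : weak_partial (e_x R) ht_fun ht_dx;
  ht_weak_dy : weak_partial (e_y R) ht_fun ht_dy;
  ht_trace_meas : measurable_fun setT ht_trace;
  ht_trace_per : periodic ht_trace T;
  ht_is_trace : is_trace T ht_fun ht_trace;
  ht_finite : (energy s T ht_dx ht_dy + L2T_sqnorm T ht_trace < +oo)%E
}.

Definition energy_form (R : realType) (s T : R) (U V : HT s T) : R :=
  \int[(leb2 R)]_(p in half_strip T)
    (p.2 `^ (1 - 2 * s) * (ht_dx U p * ht_dx V p + ht_dy U p * ht_dy V p)).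

Definition weak_solution (R : realType) (s T : R) (k : R -> R) (mu : R)
    (g u : R -> R) : Prop :=
  periodic u T /\
  exists U : HT s T,
    {ae (leb1 R), forall x, u x = ht_trace U x} /\
    forall V : HT s T,
      ds s * energy_form U V
      + \int[(leb1 R)]_(x in period_cell T)
          ((k x + mu) * ht_trace U x * ht_trace V x)
      = \int[(leb1 R)]_(x in period_cell T) (g x * ht_trace V x).

(* Measurability for the Lebesgue sigma-algebra, the completion of the Borel
   one on which lebesgue_measure is defined. *)
Definition leb_measurable (R : realType) (f : R -> R) : Prop :=
  exists2 f0 : R -> R, measurable_fun setT f0 &
    {ae (leb1 R), forall x, f x = f0 x}.

(* Main.v *)
Require Import Defs.
From HB Require Import structures.
From mathcomp Require Import all_boot all_order all_algebra.
From mathcomp Require Import all_classical all_reals all_analysis.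
From mathcomp Require Import measurable_realfun ring lra.

(** Put B(U,V) = d_s int y^a grad U . grad V + int (k + mu) u v, where u and v are
    the traces of U and V, and let |k| <= M. As soon as mu >= M + 1 the
    coefficient k + mu lies between 1 and M + mu, so B is equivalent to the inner
    product of H_T, whose squared norm [ht_sqnorm] is the energy of U plus the
    integral of u^2. Weak solutions are then the minimisers of
    J(U) = B(U,U) - 2 int g u, and existence is the classical argument of
    [quadratic_solution]: by the parallelogram identity a minimising sequence is
    Cauchy, its limit exists because H_T is complete ([ht_complete]), and the
    first variation of J at a minimiser is the weak formulation. Testing the
    difference of two solutions with itself makes its trace vanish
    ([bform_unique]); testing a solution with itself gives int u^2 <= int g^2 and
    2 d_s energy(U) <= int g^2. It remains to control the Gagliardo seminorm of a
    trace by the energy ([gagliardo_le]).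

    The trace inequality is proved by paths rather than by Fourier series. A
    function with an integrable weak derivative in one coordinate direction is
    absolutely continuous on almost every line in that direction
    ([weak_derivative_lines]). For almost all x and z one can therefore go from
    (x,0) vertically up to height h = |x - z|, horizontally to (z,h), and down to
    (z,0), so that |u(x) - u(z)| is at most the sum of the integrals of |grad U|
    over the three sides ([trace_difference_le]). Each side is squared with a
    Cauchy-Schwarz inequality, weighted by t^(1-s) on the vertical ones; dividing
    by h^(1+2s) and exchanging the order of integration, as in Hardy's
    inequality, leaves exactly the weight y^a = y^(1-2s)
    ([integral_vert_term], [integral_hor_term]).

    Completeness of H_T is a question of convergence in three weighted L^2 spaces:
    the gradients converge with the weight y^a, the traces on a period, and the
    functions themselves with the weight e^(-y), because the squared L^2 distance
    between the slice at height y and the trace is O(y^(2s)) times the energy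
    ([trace_slice_bound], [exp_weight_bound]). Weak gradients of periodic functions
    are periodic almost everywhere ([ae_periodic_partial]), so convergence over one
    period implies convergence against every test function ([cvg_limit_test]) and
    the limit of the gradients is the weak gradient of the limit. *)

Import Order.TTheory GRing.Theory Num.Theory.
Import numFieldNormedType.Exports.
Set Implicit Arguments.
Unset Strict Implicit.
Unset Printing Implicit Defensive.
Local Open Scope classical_set_scope.
Local Open Scope ring_scope.

Ltac nneg := rewrite -?EFinM -?EFinD ?lee_fin;
  repeat first [ assumption | exact: sqr_ge0 | exact: normr_ge0 | exact: powR_ge0
  | exact: expR_ge0 | exact: sqrtr_ge0 | exact: ler0n | exact: ler01
  | exact: exprn_ge0 | exact: ltW
  | apply: mulr_ge0 | apply: addr_ge0 | apply: exprn_ge0 | rewrite invr_ge0 ].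

(** * Integrals on the line *)

Section lebesgue_line.
Context {R : realType}.
Local Notation mu := (@lebesgue_measure R).
Implicit Types f : R -> \bar R.

(** The translate of the measure gives every half-open interval its length, which
    characterises Lebesgue measure. *)
Lemma lebesgue_measure_translate (c : R) (A : set R) : measurable A ->
  mu ((fun x => x + c) @^-1` A) = mu A.
Proof.
have mc : measurable_fun setT ((fun x => x + c) : measurableTypeR R -> measurableTypeR R).
  exact: measurable_funD.
pose mF := isMeasurableFun.Build _ _ _ _ _ mc.
pose F : {mfun measurableTypeR R >-> measurableTypeR R} :=
  HB.pack ((fun x => x + c) : measurableTypeR R -> measurableTypeR R) mF.
move=> mA; apply/esym.
apply: (@lebesgue_measure_unique _ (pushforward mu F)) => //= _ [[a b] _ <-].
rewrite /pushforward /=.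
have -> : (fun x => x + c) @^-1` `]a, b]%classic = `]a - c, b - c]%classic.
  by apply/seteqP; split => x /=; rewrite !in_itv /= => /andP[? ?]; apply/andP;
    split; lra.
rewrite !lebesgue_measure_itv /= !lte_fin ltrD2r; case: ifP => // _.
by rewrite -!EFinD; congr (_%:E); ring.
Qed.

Lemma ge0_integral_translate f (c : R) :
  measurable_fun setT f -> (forall x, 0 <= f x)%E ->
  (\int[mu]_x f ((x : R) + c)%R = \int[mu]_x f x)%E.
Proof.
move=> mf f0.
have mc : measurable_fun setT ((fun x => x + c) : measurableTypeR R -> measurableTypeR R).
  exact: measurable_funD.
pose mF := isMeasurableFun.Build _ _ _ _ _ mc.
pose F : {mfun measurableTypeR R >-> measurableTypeR R} :=
  HB.pack ((fun x => x + c) : measurableTypeR R -> measurableTypeR R) mF.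
transitivity (\int[pushforward mu F]_x f x)%E.
  by rewrite ge0_integral_pushforward//= preimage_setT.
by apply: eq_measure_integral => //= A mA _; exact: lebesgue_measure_translate.
Qed.

(** The point x cuts the line into two half-lines, on each of which the distance to
    x is a unimodular coordinate. *)
Lemma ge0_integral_dist_le f (x : R) : measurable_fun setT f ->
  (forall h, 0 <= f h)%E ->
  (\int[mu]_z f `|x - (z : R)|%R <= 2%:E * \int[mu]_(h in `]0%R, +oo[) f h)%E.
Proof.
move=> mf f0.
have mfn : measurable_fun setT (fun z : R => f `|z|).
  by apply: (measurableT_comp mf); exact: normr_measurable.
have -> : (\int[mu]_z f `|x - (z : R)|%R = \int[mu]_z f `|(z : R)|%R)%E.
  rewrite -(ge0_integral_translate (- x) mfn)//.
  by apply: eq_integral => z _; rewrite distrC.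
have mpos : measurable (`[0, +oo[%classic : set R) by exact: measurable_itv.
rewrite -[X in (\int[mu]_(z in X) _ <= _)%E](setUv (`[0, +oo[ : set R)).
rewrite ge0_integral_setU//=; last 3 first.
- exact: measurableC.
- by rewrite setUv.
- by apply/disj_setPCl.
rewrite -integral_itv_obnd_cbnd; last exact: measurable_funTS.
have -> : (2%:E * \int[mu]_(h in `]0%R, +oo[) f h =
    \int[mu]_(h in `]0%R, +oo[) f h + \int[mu]_(h in `]0%R, +oo[) f h)%E.
  by rewrite mule_natl mule2n.
apply: leeD.
  rewrite le_eqVlt; apply/orP; left; apply/eqP; apply: eq_integral => h.
  by rewrite inE /= in_itv /= andbT => h0; rewrite gtr0_norm.
rewrite [in leRHS]integral_itv_obnd_cbnd; last exact: measurable_funTS.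
rewrite (@ge0_integration_by_substitution0 _ f)//.
rewrite setCitvr.
apply: (@le_trans _ _ (\int[mu]_(z in `]-oo, 0%R[) f (- (z : R))%R)%E).
  rewrite le_eqVlt; apply/orP; left; apply/eqP; apply: eq_integral => h.
  by rewrite inE /= in_itv /= => h0; rewrite ltr0_norm.
apply: ge0_subset_integral => //=; last first.
  by move=> z /=; rewrite !in_itv /= => /ltW.
by apply: measurable_funTS; apply: measurableT_comp => //; exact: oppr_measurable.
Qed.

Lemma ge0_integral_pow_near0 (p y : R) : 0 < p -> 0 < y ->
  (\int[mu]_(t in `]0%R, y]) (t `^ (p - 1))%:E <= (y `^ p / p)%:E)%E.
Proof.
move=> p0 y0.
have mpow : measurable_fun setT (fun t : R => (t `^ (p - 1))%:E).
  by apply/measurable_EFinP; exact: measurable_powR.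
(* The primitive t^p / p need not be differentiable at 0: the fundamental theorem
   of calculus is used away from 0, followed by a monotone limit. *)
pose F n : set R := `[y / n.+1%:R, y]%classic.
have UF : \bigcup_n F n = `]0, y]%classic.
  apply/seteqP; split => [x [n _]|x]; rewrite /F /= !in_itv /= => /andP[x1 x2].
    by rewrite x2 andbT (lt_le_trans _ x1)// divr_gt0.
  exists (Num.bound (y / x)) => //=; rewrite in_itv /= x2 andbT.
  rewrite ler_pdivrMr// mulrC -ler_pdivrMr//.
  have := archi_boundP (divr_ge0 (ltW y0) (ltW x1)).
  by move=> /ltW /le_trans; apply; rewrite ler_nat.
have ndF : nondecreasing_seq F.
  apply/nondecreasing_seqP => n; apply/subsetPset => x; rewrite /F /= !in_itv /=.
  move=> /andP[x1 ->]; rewrite andbT (le_trans _ x1)//.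
  by rewrite ler_pM2l// lef_pV2 ?posrE// ler_nat.
have mF n : measurable (F n) by exact: measurable_itv.
have cvgF := @ge0_nondecreasing_set_cvg_integral _ (measurableTypeR R) R F
  (fun t : R => (t `^ (p - 1))%:E) lebesgue_measure ndF mF
  (fun n => measurable_funTS mpow) (fun _ _ _ => powR_ge0 _ _).
rewrite UF in cvgF.
have /cvg_lim <- // := cvgF.
apply: lime_le; first by apply/cvg_ex; eexists; exact: cvgF.
apply: nearW => -[|n].
    rewrite /F divr1 set_itv1 integral_set1 lee_fin divr_ge0 ?powR_ge0// ltW//.
  have yn0 : 0 < y / n.+2%:R by rewrite divr_gt0.
  have yny : y / n.+2%:R < y by rewrite ltr_pdivrMr// ltr_pMr// ltr1n.
  pose G (x : R) := x `^ p / p.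
  have dG (x : R) : 0 < x -> is_derive x 1 G (x `^ (p - 1)).
    move=> x0; have -> : x `^ (p - 1) = p^-1 *: (p * x `^ (p - 1)).
      by rewrite /GRing.scale /= mulrA mulVf ?mul1r// gt_eqF.
    have -> : G = p^-1 *: (fun z : R => z `^ p) by apply/funext => z; rewrite /G mulrC.
    by apply: is_deriveZ; exact: is_derive1_powR.
  have cG (x : R) : 0 < x -> {for x, continuous G}.
    move=> x0; apply: differentiable_continuous; apply/derivable1_diffP.
    by have := dG x x0; case.
  rewrite (@continuous_FTC2 _ _ G)//.
  + by rewrite -EFinB lee_fin lerBlDr lerDl divr_ge0 ?powR_ge0 ?ltW.
  + apply: continuous_in_subspaceT => x; rewrite inE /= in_itv /= => /andP[x1 _].
    have x0 : 0 < x by exact: lt_le_trans x1.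
    apply: differentiable_continuous; apply/derivable1_diffP.
    by have := is_derive1_powR (p - 1) x0; case.
  + split.
    * move=> x; rewrite in_itv /= => /andP[x1 _].
      by have := dG x (lt_trans yn0 x1); case.
    * by apply: cvg_at_right_filter; exact: cG.
    * by apply: cvg_at_left_filter; exact: cG.
  + move=> x; rewrite in_itv /= => /andP[x1 _].
    by rewrite derive1E; have := dG x (lt_trans yn0 x1); case.
Qed.

Lemma ge0_integral_pow_nearoo (p t : R) : 0 < p -> 0 < t ->
  (\int[mu]_(h in `[t, +oo[) (h `^ (- p - 1))%:E = (t `^ (- p) / p)%:E)%E.
Proof.
move=> p0 t0; pose G (x : R) := - (x `^ (- p) / p).
have dG (x : R) : 0 < x -> is_derive x 1 G (x `^ (- p - 1)).
  move=> x0; have -> : x `^ (- p - 1) = (- p^-1) *: (- p * x `^ (- p - 1)).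
    by rewrite /GRing.scale /= mulrA mulrNN mulVf ?mul1r// gt_eqF.
  have -> : G = (- p^-1) *: (fun z : R => z `^ (- p)).
    by apply/funext => z; rewrite /G scalrfctE /GRing.scale /= mulNr mulrC.
  by apply: is_deriveZ; exact: is_derive1_powR.
rewrite (@ge0_continuous_FTC2y _ _ G _ 0)//.
- by rewrite /G EFinN oppeK add0e.
- by move=> x _; exact: powR_ge0.
- apply: continuous_in_subspaceT => x; rewrite inE /= in_itv /= andbT => x1.
  have x0 : 0 < x by exact: lt_le_trans x1.
  apply: differentiable_continuous; apply/derivable1_diffP.
  by have := is_derive1_powR (- p - 1) x0; case.
- rewrite /G -oppr0 -(mul0r (p^-1)); apply: cvgN; apply: cvgMl.
  under eq_fun do rewrite powRN.
  apply/cvgrPdist_lt => e e0; near=> x.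
  rewrite sub0r normrN ger0_norm ?invr_ge0 ?powR_ge0//.
  have x0 : 0 < x by near: x; exact: nbhs_pinfty_gt.
  rewrite -[e]invrK ltf_pV2 ?posrE ?powR_gt0 ?invr_gt0//.
  rewrite -[e^-1]powRr1 ?invr_ge0 ?ltW// -(mulVf (lt0r_neq0 p0)) powRrM.
  rewrite gt0_ltr_powR ?nnegrE ?powR_ge0 ?ltW//.
- by move=> x x1; have := dG x (lt_trans t0 x1); case.
- apply: cvg_at_right_filter.
  apply: differentiable_continuous; apply/derivable1_diffP.
  by have := dG t t0; case.
- move=> x; rewrite in_itv /= andbT => x1.
  by rewrite derive1E; have := dG x (lt_trans t0 x1); case.
Unshelve. all: by end_near. Qed.

End lebesgue_line.

(** * Null sets and iterated integrals in the plane *)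

Lemma ae_impl d (T : measurableType d) (R : realType) (mu : {measure set T -> \bar R})
  (P Q : T -> Prop) : {ae mu, forall x, P x} -> (forall x, P x -> Q x) ->
  {ae mu, forall x, Q x}.
Proof. by move=> [N [mN N0 PN]] PQ; exists N; split=> // x nQ; apply: PN => /= /PQ. Qed.

Lemma ae_conj d (T : measurableType d) (R : realType) (mu : {measure set T -> \bar R})
  (P Q : T -> Prop) : {ae mu, forall x, P x} -> {ae mu, forall x, Q x} ->
  {ae mu, forall x, P x /\ Q x}.
Proof.
move=> aP aQ; have := negligibleU aP aQ; apply: negligibleS => x /= /not_andP[nP|nQ].
  by left.
by right.
Qed.

Lemma ae_forall_count d (T : measurableType d) (R : realType)
  (mu : {measure set T -> \bar R}) (I : countType) (P : I -> T -> Prop) :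
  (forall i, {ae mu, forall x, P i x}) -> {ae mu, forall x, forall i, P i x}.
Proof.
move=> aP; pose Q n x := if unpickle n is Some i then P i x else True.
have aQ : {ae mu, forall x, forall n, Q n x}.
  apply: ae_foralln => n; rewrite /Q; case: (unpickle n) => [i|]; first exact: aP.
  exact: aeW.
by apply: (ae_impl aQ) => x Qx i; have := Qx (pickle i); rewrite /Q pickleK.
Qed.

Lemma ae0_of_integral_sq d (T : measurableType d) (R : realType)
  (mu : {measure set T -> \bar R}) (D : set T) (f : T -> R) : measurable D ->
  measurable_fun D f -> (\int[mu]_(x in D) (f x ^+ 2)%:E <= 0)%E ->
  {ae mu, forall x, D x -> f x = 0}.
Proof.
move=> mD mf hf.
have mf2 : measurable_fun D (fun x => (f x ^+ 2)%:E).
  by apply/measurable_EFinP; exact: measurable_funX.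
have i0 : (\int[mu]_(x in D) `|(f x ^+ 2)%:E| = 0)%E.
  apply/eqP; rewrite eq_le integral_ge0// andbT; apply: le_trans hf.
  by under eq_integral do rewrite gee0_abs ?lee_fin ?sqr_ge0//.
apply: (ae_impl ((ae_eq_integral_abs mu mD mf2).1 i0)) => x + Dx => /(_ Dx) /eqP.
by rewrite eqe sqrf_eq0 => /eqP.
Qed.

Section planar_null_sets.
Context {R : realType}.
Local Notation mu := (@lebesgue_measure R).
Local Notation mu2 := (mu \x mu)%E.

(** Tonelli on rectangles is Tonelli on the plane once the two successive
    restrictions are seen as a single one. *)
Lemma rect_patch (A B : set R) (f : R * R -> \bar R) x y :
  (f \_ (A `*` B)) (x, y) = ((fun x => (((fun y => f (x, y)) \_ B) y)) \_ A) x.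
Proof.
rewrite /patch; case: ifPn.
  by rewrite inE => -[/= Ax By]; rewrite !mem_set.
rewrite notin_setE /= => /not_andP nAB; case: ifPn => //; rewrite inE => Ax.
by case: ifPn => //; rewrite inE => By; case: nAB.
Qed.

Lemma tonelli_rect1 (A B : set R) (f : R * R -> \bar R) :
  measurable A -> measurable B -> measurable_fun setT f ->
  (forall p, 0 <= f p)%E ->
  (\int[mu2]_(p in A `*` B) f p =
   \int[mu]_(x in A) \int[mu]_(y in B) f (x, y))%E.
Proof.
move=> mA mB mf f0; rewrite integral_mkcond fubini_tonelli1; last 2 first.
- by apply/(measurable_restrictT _ _).1; [exact: measurableX|exact: measurable_funTS].
- by move=> p; rewrite erestrict_ge0.
rewrite [RHS]integral_mkcond; apply: eq_integral => x _.
rewrite /fubini_F; under eq_integral do rewrite rect_patch.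
rewrite [RHS]patchE; case: ifPn => Ax; last first.
  by rewrite integral0_eq// => y _; rewrite patchE (negbTE Ax).
by rewrite [RHS]integral_mkcond; apply: eq_integral => y _; rewrite patchE Ax.
Qed.

Lemma tonelli_rect2 (A B : set R) (f : R * R -> \bar R) :
  measurable A -> measurable B -> measurable_fun setT f ->
  (forall p, 0 <= f p)%E ->
  (\int[mu2]_(p in A `*` B) f p =
   \int[mu]_(y in B) \int[mu]_(x in A) f (x, y))%E.
Proof.
move=> mA mB mf f0; rewrite integral_mkcond fubini_tonelli2; last 2 first.
- by apply/(measurable_restrictT _ _).1; [exact: measurableX|exact: measurable_funTS].
- by move=> p; rewrite erestrict_ge0.
rewrite [RHS]integral_mkcond; apply: eq_integral => y _.
rewrite /fubini_G; under eq_integral do rewrite rect_patch.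
rewrite [RHS]patchE; case: ifPn => By; last first.
  rewrite integral0_eq// => x _; rewrite patchE; case: ifPn => // _.
  by rewrite patchE (negbTE By).
rewrite [RHS]integral_mkcond; apply: eq_integral => x _; rewrite !patchE.
by case: ifPn => // _; rewrite By.
Qed.

Lemma measurable_slice_y (A : set R) (f : R * R -> \bar R) : measurable A ->
  measurable_fun setT f -> (forall p, 0 <= f p)%E ->
  measurable_fun setT (fun y => \int[mu]_(x in A) f (x, y))%E.
Proof.
move=> mA mf f0; pose g := f \_ (A `*` [set: R]).
have mg : measurable_fun setT g.
  by apply/(measurable_restrictT _ _).1; [exact: measurableX|exact: measurable_funTS].
have g0 p : (0 <= g p)%E by rewrite /g erestrict_ge0.
have := measurable_fun_fubini_tonelli_G (m1 := mu) g mg g0.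
apply: eq_measurable_fun => y _; rewrite /fubini_G [RHS]integral_mkcond.
apply: eq_integral => x _; rewrite /g rect_patch.
by rewrite patchE [RHS]patchE; case: ifP => // _; rewrite patchE in_setT.
Qed.

Lemma measurable_slice_x (A : set R) (f : R * R -> \bar R) : measurable A ->
  measurable_fun setT f -> (forall p, 0 <= f p)%E ->
  measurable_fun setT (fun x => \int[mu]_(y in A) f (x, y))%E.
Proof.
move=> mA mf f0; apply: (@measurable_slice_y A (fun p => f (p.2, p.1))) => //.
by apply: (measurableT_comp mf); exact: measurable_fun_pair.
Qed.

Lemma mu2_ysection (N : set (R * R)) : measurable N ->
  mu2 N = (\int[mu]_y mu (ysection N y))%E.
Proof.
move=> mN; rewrite -[in LHS](setIT N) -integral_indic// fubini_tonelli2; last 2 first.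
- by apply/measurable_EFinP; exact: measurable_indic.
- by move=> p; rewrite lee_fin indicE.
by apply: eq_integral => y _; exact: (congr1 (@^~ y) (indic_fubini_tonelli_GE mu mN)).
Qed.

Lemma ae_slice2 (P : R * R -> Prop) : {ae mu2, forall p, P p} ->
  {ae mu, forall y, {ae mu, forall x, P (x, y)}}.
Proof.
move=> [N [mN N0 PN]].
have mF := measurable_fun_ysection mu mN.
have : (\int[mu]_y `|mu (ysection N y)| = 0)%E.
  rewrite -[RHS]N0 (mu2_ysection mN).
  by apply: eq_integral => x _; rewrite gee0_abs.
move=> /(ae_eq_integral_abs _ measurableT mF); apply: filterS => y /(_ I) /= Ny0.
exists (ysection N y); split => //; first exact: measurable_ysection.
by move=> x nP; rewrite /= ysectionE; exact: PN.
Qed.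

(** By Tonelli, a measurable set whose horizontal slices are almost all null is null. *)
Lemma ae_of_slice2 (P : R * R -> Prop) : measurable [set p | ~ P p] ->
  {ae mu, forall y, {ae mu, forall x, P (x, y)}} -> {ae mu2, forall p, P p}.
Proof.
move=> mN aeP; exists [set p | ~ P p]; split => //.
rewrite mu2_ysection// (_ : (0 = \int[mu]_y (cst 0 y))%E); last by rewrite integral0.
apply: ge0_ae_eq_integral => //; first exact: measurable_fun_ysection.
case: aeP => K [mK K0 PK]; exists K; split => // y /= nP; apply: PK => /= -[M [mM M0 PM]].
apply: nP => _; apply: (subset_measure0 (mu := mu) (B := M)) => //; first exact: measurable_ysection.
by move=> x; rewrite /= ysectionE /= => nP; exact: PM.
Qed.

Lemma ae_exists_itv (P : R -> Prop) (a b : R) : a < b ->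
  {ae mu, forall x, P x} -> exists2 x, a < x < b & P x.
Proof.
move=> ab [N [mN N0 PN]]; apply: contrapT => nex.
have : (mu `]a, b[ <= mu N)%E.
  apply: le_measure; rewrite ?inE//= => x; rewrite /= in_itv /= => xab.
  by apply: PN => /= Px; apply: nex; exists x.
by rewrite N0 lebesgue_measure_itv /= lte_fin ab -EFinD lee_fin subr_le0 leNgt ab.
Qed.

End planar_null_sets.

Section weighted_L2.
Context d (T : measurableType d) (R : realType) (mu : {measure set T -> \bar R}).
Variables (D : set T) (mD : measurable D).

Lemma sq_abs_le_weight (w g l : R) : 0 < w -> 0 < l ->
  `|g| <= l / 2 * w^-1 + (2 * l)^-1 * (w * g ^+ 2).
Proof.
move=> w0 l0.
rewrite -subr_ge0.
have -> : l / 2 * w^-1 + (2 * l)^-1 * (w * g ^+ 2) - `|g| =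
  (2 * l * w)^-1 * (w * `|g| - l) ^+ 2.
  rewrite sqrrB exprMn real_normK ?num_real//; field.
  by rewrite !gt_eqF.
by rewrite mulr_ge0 ?sqr_ge0// invr_ge0 !mulr_ge0// ltW.
Qed.

(** Cauchy-Schwarz for |g| = w^(-1/2) (w^(1/2) |g|). Integrating the pointwise bound
    [sq_abs_le_weight] gives I <= l A / 2 + B / (2 l) for the integrals I of |g| and
    B of w g^2 and every l > 0, and l = I / A turns this into I^2 <= A B. The case of
    infinite integrals is part of the statement. *)
Lemma weighted_cauchy_schwarz (A : R) (w g : T -> R) :
  measurable_fun D w -> measurable_fun D g -> (forall x, D x -> 0 < w x) ->
  0 < A -> (\int[mu]_(x in D) ((w x)^-1)%:E <= A%:E)%E ->
  ((\int[mu]_(x in D) `|g x|%:E) * (\int[mu]_(x in D) `|g x|%:E) <= A%:E * \int[mu]_(x in D) (w x * g x ^+ 2)%:E)%E.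
Proof.
move=> mw mg w0 A0 hA; set I := (\int[mu]_(x in D) `|g x|%:E)%E.
have mwV : measurable_fun D (fun x => (w x)^-1).
  apply: (@eq_measurable_fun _ _ _ _ _ (fun x => w x `^ (-1))).
    by move=> x; rewrite inE => /w0 /ltW wx; rewrite powR_inv1.
  exact: (measurableT_comp (measurable_powR (-1)) mw).
have mwg : measurable_fun D (fun x => w x * g x ^+ 2).
  by apply: measurable_funM => //; exact: measurable_funX.
set B := (\int[mu]_(x in D) (w x * g x ^+ 2)%:E)%E.
have B0 : (0 <= B)%E.
  by apply: integral_ge0 => x Dx; rewrite lee_fin mulr_ge0 ?sqr_ge0// ltW// w0.
have I0 : (0 <= I)%E by apply: integral_ge0 => x Dx; rewrite lee_fin.
have Il l : 0 < l -> (I <= (l / 2 * A)%:E + (2 * l)^-1%:E * B)%E.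
  move=> l0; apply: (@le_trans _ _ (\int[mu]_(x in D)
    ((l / 2)%:E * ((w x)^-1)%:E + (2 * l)^-1%:E * (w x * g x ^+ 2)%:E))%E).
    apply: ge0_le_integral => //.
    - by apply/measurable_EFinP; exact: measurableT_comp.
    - apply: emeasurable_funD; apply: emeasurable_funM => //; exact/measurable_EFinP.
    - by move=> x Dx; rewrite -!EFinM -EFinD lee_fin sq_abs_le_weight// w0.
  rewrite ge0_integralD//; last 4 first.
  - move=> x /w0/ltW wx; have ? := ltW l0.
    by nneg.
  - by apply: emeasurable_funM => //; exact/measurable_EFinP.
  - move=> x /w0/ltW wx; have ? := ltW l0.
    by nneg.
  - by apply: emeasurable_funM => //; exact/measurable_EFinP.
  rewrite !ge0_integralZl//; last 6 first.
  - exact/measurable_EFinP.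
  - by move=> x Dx; rewrite lee_fin mulr_ge0 ?sqr_ge0// ltW// w0.
  - by rewrite lee_fin invr_ge0 mulr_ge0// ltW.
  - exact/measurable_EFinP.
  - by move=> x Dx; rewrite lee_fin invr_ge0 ltW// w0.
  - by rewrite lee_fin divr_ge0// ltW.
  by apply: leeD => //; rewrite (EFinM (l / 2) A); apply: lee_wpmul2l => //; nneg.
have [->|] := eqVneq B +oo%E; first by rewrite gt0_muley ?leey// lte_fin.
move=> Boo; have Bfin : B \is a fin_num by rewrite ge0_fin_numE// ltey.
have Ifin : I \is a fin_num.
  rewrite ge0_fin_numE// (le_lt_trans (Il 1 ltr01))// -(fineK Bfin) -EFinM -EFinD.
  by rewrite ltry.
move: Il; rewrite -(fineK Bfin) -(fineK Ifin) => Il.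
rewrite -!EFinM lee_fin.
have b0 : 0 <= fine B by rewrite fine_ge0.
have : 0 <= fine I by rewrite fine_ge0.
rewrite le_eqVlt => /predU1P[<-|i0]; first by rewrite mul0r mulr_ge0// ltW.
have := Il (fine I / A) (divr_gt0 i0 A0); rewrite -EFinM -EFinD lee_fin.
set i := fine I; set b := fine B => h.
have e : i / A / 2 * A + (2 * (i / A))^-1 * b = i / 2 + (A * b) / (2 * i).
  by field; rewrite !gt_eqF.
rewrite e -lerBlDl ler_pdivlMr ?mulr_gt0// in h.
by apply: le_trans h; rewrite le_eqVlt; apply/orP; left; apply/eqP; field.
Qed.

End weighted_L2.

(** * Completeness of weighted L2 spaces *)

Lemma measurable_limn_einf d (T : measurableType d) (R : realType) (D : set T)
  (f : nat -> T -> \bar R) : (forall n, measurable_fun D (f n)) ->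
  measurable_fun D (fun x => limn_einf (fun n => f n x)).
Proof.
move=> mf; have -> : (fun x => limn_einf (fun n => f n x)) =
    (fun x => - limn_esup (fun n => - f n x))%E.
  apply/funext => x; rewrite -limn_einfN; congr limn_einf.
  by apply/funext => n /=; rewrite oppeK.
apply: (measurableT_comp (@oppe_measurable _ _)).
by apply: measurable_fun_limn_esup => n; apply: (measurableT_comp (@oppe_measurable _ _)).
Qed.

(** Fatou's lemma, in the form in which bounds on the members of a sequence pass to
    its pointwise limit. *)
Lemma ge0_integral_limit_le d (X : measurableType d) (R : realType)
  (m : {measure set X -> \bar R}) (D : set X) (f : nat -> X -> R) (g : X -> R)
  (c : \bar R) (N : nat) : measurable D ->
  (forall n, measurable_fun D (f n)) -> measurable_fun D g ->
  (forall n x, D x -> 0 <= f n x) -> (forall x, D x -> 0 <= g x) ->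
  {ae m, forall x, D x -> f n x @[n --> \oo] --> g x} ->
  (forall n, (N <= n)%N -> (\int[m]_(x in D) (f n x)%:E <= c)%E) ->
  (\int[m]_(x in D) (g x)%:E <= c)%E.
Proof.
move=> mD mf mg f0 g0 hlim hc; pose F n x := (f n x)%:E.
have F0 n x : D x -> (0 <= F n x)%E by move=> Dx; rewrite lee_fin f0.
have mF n : measurable_fun D (F n) by exact/measurable_EFinP.
apply: (@le_trans _ _ (\int[m]_(x in D) limn_einf (fun n => F n x))%E).
  apply: ae_ge0_le_integral => //.
  - exact/measurable_EFinP.
  - move=> x Dx; rewrite limn_einf_lim; apply: lime_ge; first exact: is_cvg_einfs.
    by apply: nearW => k; apply: le_ereal_inf_tmp => _ [n /= _ <-]; exact: F0.
  - exact: measurable_limn_einf.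
  apply: (ae_impl hlim) => x hx Dx.
  have h : F n x @[n --> \oo] --> (g x)%:E.
    by apply: cvg_EFin; [exact: nearW|exact: hx].
  by rewrite (cvg_limn_einf_sup h).1.
apply: le_trans (fatou m mD mF F0) _.
rewrite limn_einf_lim; apply: lime_le; first exact: is_cvg_einfs.
apply: nearW => n; apply: le_trans (hc (maxn n N) (leq_maxr _ _)).
by apply: ereal_inf_lbound; exists (maxn n N) => //=; exact: leq_maxl.
Qed.

Section weighted_riesz_fischer.
Context d (T : measurableType d) (R : realType) (mu : {measure set T -> \bar R}).
Variables (D : set T) (mD : measurable D) (w : T -> R).
Hypotheses (mw : measurable_fun D w) (w0 : forall x, D x -> 0 < w x).

(** Being given by a formula at every point, and not only almost everywhere, the
    upper limit inherits each symmetry of the sequence exactly: limits of periodic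
    functions are periodic everywhere. *)
Definition seq_limit (f : nat -> T -> R) (x : T) : R :=
  fine (limn_esup (fun n => (f n x)%:E)).

Variables (f : nat -> T -> R) (K : R).
Hypothesis mf : forall n, measurable_fun D (f n).

Lemma measurable_seq_limit : measurable_fun D (seq_limit f).
Proof.
apply: (measurableT_comp (fine_measurable measurableT)).
by apply: measurable_fun_limn_esup => n; exact/measurable_EFinP.
Qed.

Lemma seq_limit_cvg x (l : R) : f n x @[n --> \oo] --> l -> seq_limit f x = l.
Proof.
move=> fl; have h : (f n x)%:E @[n --> \oo] --> l%:E by apply: cvg_EFin => //; exact: nearW.
by rewrite /seq_limit (cvg_limn_einf_sup h).2.
Qed.

Hypothesis f_cauchy : forall n m, (n <= m)%N ->
  (\int[mu]_(x in D) (w x * (f m x - f n x) ^+ 2)%:E <= (K * 8 ^- n)%:E)%E.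

Let K0 : 0 <= K.
Proof.
have := f_cauchy (leqnn 0); rewrite expr0 invr1 mulr1 -lee_fin; apply: le_trans.
by apply: integral_ge0 => x Dx; rewrite lee_fin mulr_ge0 ?sqr_ge0// ltW// w0.
Qed.

Let mterm n m : measurable_fun D (fun x => w x * (f m x - f n x) ^+ 2).
Proof.
by apply: measurable_funM => //; apply: measurable_funX; exact: measurable_funB.
Qed.

(** The rate 8^-n leaves room for the factor 4^n; finiteness of this sum at x bounds
    |f n.+1 x - f n x| by a multiple of 2^-n. *)
Let S x := (\sum_(n <oo) (4 ^+ n * (w x * (f n.+1 x - f n x) ^+ 2))%:E)%E.

Let t0 n x : D x -> (0 <= (4 ^+ n * (w x * (f n.+1 x - f n x) ^+ 2))%:E)%E.
Proof.
move=> Dx; rewrite lee_fin; apply: mulr_ge0; first exact: exprn_ge0.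
by apply: mulr_ge0; [exact/ltW/w0|exact: sqr_ge0].
Qed.

Let mt n : measurable_fun D (fun x => (4 ^+ n * (w x * (f n.+1 x - f n x) ^+ 2))%:E).
Proof. by apply/measurable_EFinP; apply: measurable_funM. Qed.

(** The terms integrate to at most K (4/8)^n, a geometric series of sum 2 K. *)
Let S_int : (\int[mu]_(x in D) S x < +oo)%E.
Proof.
rewrite (integral_nneseries mu mD mt (fun n x Dx => t0 n Dx)).
apply: (@le_lt_trans _ _ (K *+ 2)%:E); last exact: ltry.
have K2 : 0 <= K *+ 2 by rewrite mulrn_wge0.
apply: le_trans (epsilon_trick0 xpredT K2).
apply: lee_nneseries => [n _ _|n _]; first by apply: integral_ge0 => x; exact: t0.
under eq_integral do rewrite EFinM.
rewrite ge0_integralZl//.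
all: swap 1 2.
  exact/measurable_EFinP.
all: swap 1 2.
  by move=> x /w0/ltW wx; rewrite lee_fin mulr_ge0 ?sqr_ge0.
apply: le_trans (lee_wpmul2l _ (f_cauchy (leqnSn n))) _.
  by rewrite lee_fin exprn_ge0.
rewrite -EFinM lee_fin le_eqVlt; apply/orP; left; apply/eqP.
have -> : (8 : R) = 4 * 2 by ring.
rewrite exprMn natrX exprS -mulr_natr.
by field; rewrite !expf_neq0.
Qed.

Lemma ae_cauchy_cvg : {ae mu, forall x, D x -> cvgn (fun n => f n x)}.
Proof.
have Sint : mu.-integrable D S.
  apply/integrableP; split.
    by apply: ge0_emeasurable_sum => // n x Dx _; exact: t0.
  rewrite (eq_integral S) => [|x /set_mem Dx]; first exact: S_int.
  by rewrite gee0_abs//; apply: nneseries_ge0 => n _ _; exact: t0.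
have := integrable_ae mD Sint; apply: filterS => x Sfin Dx.
have {Sfin} Sfin := Sfin Dx.
pose C := Num.sqrt (fine (S x) / w x).
have dn n : `|f n.+1 x - f n x| <= C * 2^-1 ^+ n.
  have Sn : ((4 ^+ n * (w x * (f n.+1 x - f n x) ^+ 2))%:E <= S x)%E.
    apply: le_trans (@nneseries_lim_ge _ _ _ _ n.+1 (fun n _ _ => t0 n Dx)).
    by rewrite big_nat_recr//= leeDr// sume_ge0// => i _; exact: t0.
  have {}Sn : (f n.+1 x - f n x) ^+ 2 <= fine (S x) / w x * (2^-1 ^+ n) ^+ 2.
    rewrite -(fineK Sfin) lee_fin in Sn.
    rewrite -exprM mulnC exprM (_ : 2^-1 ^+ 2 = 4^-1 :> R); last by field.
    rewrite exprVn mulrAC ler_pdivlMr ?w0// ler_pdivlMr ?exprn_gt0//.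
    by rewrite (le_trans _ Sn)// le_eqVlt; apply/orP; left; apply/eqP; ring.
  rewrite -(@ler_pXn2r _ 2)// ?nnegrE//; last first.
    by rewrite mulr_ge0 ?sqrtr_ge0// exprn_ge0.
  rewrite real_normK ?num_real// exprMn sqr_sqrtr// divr_ge0//.
    by rewrite fine_ge0//; apply: nneseries_ge0 => i _ _; exact: t0.
  by rewrite ltW// w0.
have cvgd : cvgn (series (telescope (fun n => f n x))).
  apply: normed_cvg; apply: (series_le_cvg _ _ dn) => //.
  - by move=> n; rewrite mulr_ge0 ?sqrtr_ge0// exprn_ge0.
  - by apply: is_cvg_geometric_series; rewrite ger0_norm ?invr_ge0// invf_lt1 ?ltr1n.
have -> : (fun n => f n x) = (fun n => f 0%N x + series (telescope (fun n => f n x)) n).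
  by apply/funext => n; exact: eq_sum_telescope.
by apply: is_cvgD => //; exact: is_cvg_cst.
Qed.

Lemma ae_cvg_seq_limit :
  {ae mu, forall x, D x -> f n x @[n --> \oo] --> seq_limit f x}.
Proof.
have := ae_cauchy_cvg; apply: filterS => x + Dx => /(_ Dx) /cvg_ex[l fl].
by rewrite (seq_limit_cvg fl).
Qed.

(** Fatou's lemma as m tends to infinity in the Cauchy estimate between f m and
    f n. *)
Lemma seq_limit_dist n :
  (\int[mu]_(x in D) (w x * (seq_limit f x - f n x) ^+ 2)%:E <= (K * 8 ^- n)%:E)%E.
Proof.
have p0 (h : T -> R) x : D x -> 0 <= w x * h x ^+ 2.
  by move=> Dx; rewrite mulr_ge0 ?sqr_ge0// ltW// w0.
apply: (@ge0_integral_limit_le _ _ _ mu D (fun m x => w x * (f m x - f n x) ^+ 2) _ _ n) => //.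
- apply: measurable_funM => //.
  by apply: measurable_funX; apply: measurable_funB => //; exact: measurable_seq_limit.
- by move=> m x; exact: (p0 (fun x => f m x - f n x)).
- by move=> x; exact: (p0 (fun x => seq_limit f x - f n x)).
- apply: (ae_impl ae_cvg_seq_limit) => x + Dx => /(_ Dx) fl.
  have fln : f m x - f n x @[m --> \oo] --> seq_limit f x - f n x.
    by apply: cvgB => //; exact: cvg_cst.
  by under eq_fun do rewrite expr2; rewrite expr2; apply: cvgMr; exact: cvgM.
- by move=> m; exact: f_cauchy.
Qed.

End weighted_riesz_fischer.

Section weighted_L1.
Context d (T : measurableType d) (R : realType) (mu : {measure set T -> \bar R}).
Variables (D : set T) (mD : measurable D).

(** Integrability of 1/w is what makes the weighted L^2 space embed into L^1. *)
Lemma integrable_of_weight (w g : T -> R) :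
  measurable_fun D w -> measurable_fun D g -> (forall x, D x -> 0 < w x) ->
  (\int[mu]_(x in D) ((w x)^-1)%:E < +oo)%E ->
  (\int[mu]_(x in D) (w x * g x ^+ 2)%:E < +oo)%E ->
  mu.-integrable D (EFin \o g).
Proof.
move=> mw mg w0 hw hg; apply/integrableP; split; first exact/measurable_EFinP.
have mwV : measurable_fun D (fun x => (w x)^-1).
  apply: (@eq_measurable_fun _ _ _ _ _ (fun x => w x `^ (-1))).
    by move=> x; rewrite inE => /w0 /ltW wx; rewrite powR_inv1.
  exact: (measurableT_comp (measurable_powR (-1)) mw).
have mwg : measurable_fun D (fun x => w x * g x ^+ 2).
  by apply: measurable_funM => //; exact: measurable_funX.
apply: (@le_lt_trans _ _ (\int[mu]_(x in D) (((w x)^-1)%:E + (w x * g x ^+ 2)%:E))%E).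
  apply: ge0_le_integral => //.
  - by apply: measurableT_comp => //; exact/measurable_EFinP.
  - by apply: emeasurable_funD; exact/measurable_EFinP.
  - move=> x Dx; rewrite -EFinD lee_fin; have wx := w0 _ Dx.
    have := sq_abs_le_weight (g x) wx (ltr01 : 0 < (1 : R)); move/le_trans; apply.
    have h1 : 0 <= (w x)^-1 by rewrite invr_ge0 ltW.
    have h2 : 0 <= w x * g x ^+ 2 by rewrite mulr_ge0 ?sqr_ge0// ltW.
    rewrite mulr1; lra.
rewrite ge0_integralD//; first exact: lte_add_pinfty.
- by move=> x /w0 wx; rewrite lee_fin invr_ge0 ltW.
- exact/measurable_EFinP.
- by move=> x /w0/ltW wx; nneg.
- exact/measurable_EFinP.
Qed.

End weighted_L1.

(** * Positivity of the constant d_s *)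

Section gamma_integral.
Context {R : realType}.
Local Notation mu := (@lebesgue_measure R).

(** The inequality 1 + x <= e^x at x = t / q, raised to the power q. *)
Lemma powR_le_expR (q t : R) : 0 < q -> 0 <= t -> t `^ q <= q `^ q * expR t.
Proof.
move=> q0 t0; have -> : t = t / q * q by rewrite divfK// gt_eqF.
have tq : 0 <= t / q by nneg.
have q0' := ltW q0; rewrite powRM// [_ * q `^ q]mulrC; apply: ler_wpM2l; first exact: powR_ge0.
rewrite expRM; apply: ge0_ler_powR; rewrite ?nnegrE ?expR_ge0//.
by apply: le_trans (expR_ge1Dx _); rewrite lerDr.
Qed.

Lemma measurable_gamma_density (p : R) :
  measurable_fun setT (fun t : R => (t `^ (p - 1) * expR (- t))%:E).
Proof.
apply/measurable_EFinP; apply: measurable_funM; first exact: measurable_powR.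
by apply: measurableT_comp => //; exact: measurable_expR.
Qed.

(** On (0,1] the power is integrable because p > 0; on the rest
    t^(p+1) <= C e^t bounds the integrand by C t^-2. *)
Lemma gamma_integral_lty (p : R) : 0 < p ->
  (\int[mu]_(t in `]0%R, +oo[) (t `^ (p - 1) * expR (- t))%:E < +oo)%E.
Proof.
move=> p0; have md := measurable_gamma_density p.
have -> : `]0%R, +oo[%classic = (`]0%R, 1%R] `|` `]1%R, +oo[ : set R).
  apply/seteqP; split => x /=; rewrite !in_itv /= !andbT.
    by move=> x0; have [x1|x1] := leP x 1; [left; rewrite x0|right].
  by case=> [/andP[]//|]; exact: lt_trans.
rewrite ge0_integral_setU//=; last 3 first.
- exact: measurable_funTS.
- by move=> t _; nneg.
- apply/disj_setPS => t /=; rewrite !in_itv /= andbT => -[/andP[_ t1]].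
  by rewrite ltNge t1.
rewrite [X in (_ + X)%E]integral_itv_obnd_cbnd; last exact: measurable_funTS.
apply: lte_add_pinfty.
  apply: le_lt_trans (ltry (1 `^ p / p)).
  apply: le_trans (ge0_integral_pow_near0 p0 ltr01).
  apply: ge0_le_integral => //.
  - by move=> t _; nneg.
  - exact: measurable_funTS.
  - by apply: measurable_funTS; apply/measurable_EFinP; exact: measurable_powR.
  - move=> t /=; rewrite in_itv /= => /andP[t0 _]; rewrite lee_fin ler_piMr ?powR_ge0//.
    by rewrite -expR0 ler_expR oppr_le0 ltW.
pose q := p + 1; have q0 : 0 < q by rewrite /q addr_gt0.
apply: (@le_lt_trans _ _ (\int[mu]_(t in `[1%R, +oo[)
    ((q `^ q)%:E * (t `^ (- 1 - 1))%:E))%E).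
  apply: ge0_le_integral => //.
  - by move=> t _; nneg.
  - exact: measurable_funTS.
  - apply: measurable_funTS; apply: emeasurable_funM => //.
    by apply/measurable_EFinP; exact: measurable_powR.
  - move=> t /=; rewrite in_itv /= andbT => t1; rewrite -EFinM lee_fin.
    have t0 : 0 < t by exact: lt_le_trans t1.
    have -> : p - 1 = q + (-1 - 1) by rewrite /q; ring.
    rewrite powRD; last by apply/implyP => _; rewrite gt_eqF.
    rewrite expRN mulrAC; apply: ler_wpM2r; first exact: powR_ge0.
    by rewrite ler_pdivrMr ?expR_gt0// powR_le_expR// ltW.
rewrite ge0_integralZl//; try first [ by move=> *; nneg | by apply: measurable_funTS;
  apply/measurable_EFinP; exact: measurable_powR ].
by rewrite ge0_integral_pow_nearoo// -EFinM ltry.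
Qed.

(** The real-valued integral is 0 by convention when it diverges, so positivity needs
    convergence as well as a lower bound, which is taken on [1,2]. *)
Lemma Gamma_gt0 (p : R) : 0 < p -> 0 < Gamma p.
Proof.
move=> p0; have md := measurable_gamma_density p.
rewrite /Gamma /Rintegral fine_gt0// gamma_integral_lty// andbT.
have c0 : 0 < expR (- 2) / 2 :> R by rewrite divr_gt0// expR_gt0.
apply: (@lt_le_trans _ _ (\int[mu]_(t in `[1%R, 2%R]) (expR (- 2) / 2)%:E)%E).
  rewrite integral_cst//= lebesgue_measure_itv /= lte_fin ltr1n -EFinD -EFinM.
  by rewrite lte_fin mulr_gt0// subr_gt0 ltr1n.
apply: (@le_trans _ _ (\int[mu]_(t in `[1%R, 2%R]) (t `^ (p - 1) * expR (- t))%:E)%E).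
  apply: ge0_le_integral => //.
  - exact: measurable_funTS.
  - move=> t /=; rewrite in_itv /= => /andP[t1 t2]; rewrite lee_fin mulrC.
    have t0 : 0 < t by exact: lt_le_trans t1.
    apply: ler_pM; rewrite ?invr_ge0 ?expR_ge0// ?ler_expR ?lerN2//.
    apply: (@le_trans _ _ (t `^ (-1))); last by rewrite ler_powR// lerBrDr addrC subrr ltW.
    by rewrite (powR_inv1 (ltW t0)) lef_pV2 ?posrE.
apply: ge0_subset_integral => //; first exact: measurable_funTS.
  by move=> t _; nneg.
by move=> t /=; rewrite !in_itv /= andbT => /andP[t1 _]; exact: lt_le_trans t1.
Qed.

Lemma ds_gt0 (s : R) : 0 < s < 1 -> 0 < ds s.
Proof.
move=> /andP[s0 s1]; rewrite /ds mulr_gt0 ?powR_gt0// divr_gt0 ?Gamma_gt0//.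
by rewrite subr_gt0.
Qed.

End gamma_integral.

(** * Smooth bump functions *)

Section smooth_functions.
Context {R : realType}.
Implicit Types f g : R -> R.

Fixpoint smooth_upto (n : nat) f : Prop :=
  if n is m.+1 then (forall x, derivable f x 1) /\ smooth_upto m (derive1 f) else True.

Definition smooth f := forall n, smooth_upto n f.

Lemma smooth_derivable f : smooth f -> forall x, derivable f x 1.
Proof. by move=> /(_ 1%N) []. Qed.

Lemma smooth_derive1 f : smooth f -> smooth (derive1 f).
Proof. by move=> sf n; have [] := sf n.+1. Qed.

Lemma smooth_continuous f : smooth f -> continuous f.
Proof.
move=> sf x; apply: differentiable_continuous; apply/derivable1_diffP.
exact: smooth_derivable.
Qed.

Lemma smooth_primitive f g : (forall x : R, is_derive x 1 f (g x)) -> smooth g -> smooth f.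
Proof.
move=> fg sg [//|n] /=; split; first by move=> x; have [] := fg x.
suff -> : derive1 f = g by exact: sg.
by apply/funext => x; rewrite derive1E; have [] := fg x.
Qed.

Lemma smooth_is_derive f : smooth f -> forall x : R, is_derive x 1 f (derive1 f x).
Proof. by move=> sf x; rewrite derive1E; apply: DeriveDef => //; exact: smooth_derivable. Qed.

Lemma smooth_uptoS n f : smooth_upto n.+1 f -> smooth_upto n f.
Proof. by elim: n f => [//|n IH] f [df sf]; split=> //; exact: IH. Qed.

Lemma smooth_uptoD n f g : smooth_upto n f -> smooth_upto n g ->
  smooth_upto n (fun x => f x + g x).
Proof.
elim: n f g => [//|n IH] f g [df sf] [dg sg]; split=> [x|]; first exact: derivableD.
have -> : derive1 (fun x => f x + g x) = (fun x => derive1 f x + derive1 g x).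
  by apply/funext => x; rewrite !derive1E deriveD.
exact: IH.
Qed.

Lemma smooth_uptoM n f g : smooth_upto n f -> smooth_upto n g ->
  smooth_upto n (fun x => f x * g x).
Proof.
elim: n f g => [//|n IH] f g sf sg; have [df sf'] := sf; have [dg sg'] := sg.
split=> [x|]; first exact: derivableM.
have -> : derive1 (fun x => f x * g x) = (fun x => f x * derive1 g x + g x * derive1 f x).
  by apply/funext => x; rewrite !derive1E deriveM.
by apply: smooth_uptoD; apply: IH => //; exact: smooth_uptoS.
Qed.

Lemma smooth_cst (c : R) : smooth (fun=> c).
Proof.
suff h n (d : R) : smooth_upto n (fun=> d) by move=> n; exact: h.
elim: n d => [//|n IH] d; split=> [x|]; first exact: derivable_cst.
have -> : derive1 (fun=> d) = (fun=> 0 : R); last exact: IH.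
by apply/funext => x; rewrite derive1E derive_cst.
Qed.

Lemma smoothD f g : smooth f -> smooth g -> smooth (fun x => f x + g x).
Proof. by move=> sf sg n; exact: smooth_uptoD. Qed.

Lemma smoothM f g : smooth f -> smooth g -> smooth (fun x => f x * g x).
Proof. by move=> sf sg n; exact: smooth_uptoM. Qed.

Lemma is_derive_affine f (a b x df : R) : is_derive (a * x + b) 1 f df ->
  is_derive x 1 (fun x => f (a * x + b)) (a * df).
Proof.
move=> fdf.
have ab : is_derive x 1 (fun x : R => a * x + b) a.
  have h : is_derive x 1 ((a \*: id) + cst b) (a *: 1 + 0) by apply: is_deriveD.
  by rewrite /GRing.scale /= mulr1 addr0 in h.
by have := @is_derive1_comp _ f (fun x => a * x + b) _ _ _ fdf ab; rewrite mulrC.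
Qed.

Lemma smooth_affine f (a b : R) : smooth f -> smooth (fun x => f (a * x + b)).
Proof.
move=> sf n; elim: n f sf => [//|n IH] f sf /=; split => [x|].
  by have [] := is_derive_affine (smooth_is_derive sf (a * x + b)).
have -> : derive1 (fun x => f (a * x + b)) = (fun x => a * derive1 f (a * x + b)).
  apply/funext => x; rewrite derive1E.
  by have [] := is_derive_affine (smooth_is_derive sf (a * x + b)).
apply: smooth_uptoM; first exact: smooth_cst.
by apply: IH; exact: smooth_derive1.
Qed.

(** A class of functions closed under differentiation that contains e^(-1/t):
    the polynomial absorbs the powers of 1/t that differentiation produces, so that
    smoothness of e^(-1/t) at 0 becomes an induction. *)
Definition flat_poly (p : {poly R}) (t : R) : R :=
  if 0 < t then p.[t^-1] * expR (- t^-1) else 0.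

Lemma horner_le_expR (p : {poly R}) :
  exists2 C : R, 0 <= C & forall x, 0 <= x -> `|p.[x]| <= C * expR x.
Proof.
exists (\sum_(i < size p) `|p`_i| * i`!%:R); first by apply: sumr_ge0 => i _; nneg.
move=> x x0; rewrite horner_coef (le_trans (ler_norm_sum _ _ _))//.
rewrite mulr_suml; apply: ler_sum => i _; rewrite normrM -mulrA.
apply: ler_wpM2l => //; rewrite ger0_norm ?exprn_ge0//.
case: (nat_of_ord i) => [|n].
  by rewrite expr0 fact0 mul1r -(@expR0 R) ler_expR.
rewrite mulrC -ler_pdivrMr ?ltr0n ?fact_gt0//.
by rewrite (le_trans _ (expR_ge1Dxn n x0))// lerDr.
Qed.

(** The bound C e^x for the polynomial x p(x) at x = 1/t; it shows that flat
    functions vanish at 0 at least linearly. *)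
Lemma flat_poly_le (p : {poly R}) :
  exists2 C : R, 0 <= C & forall t, 0 <= t -> `|flat_poly p t| <= C * t.
Proof.
have [C C0 hC] := horner_le_expR ('X * p); exists C => // t t0.
rewrite /flat_poly; case: ifPn => [{}t0|_]; last by rewrite normr0; nneg.
have tV0 : 0 <= t^-1 by nneg.
have := hC _ tV0; rewrite hornerM hornerX normrM (ger0_norm tV0) => h.
rewrite normrM (ger0_norm (expR_ge0 _)) expRN ler_pdivrMr ?expR_gt0//.
by rewrite mulrAC -ler_pdivrMr// mulrC.
Qed.

(** Away from 0 this is the product rule. At 0 the difference quotient of
    p(1/t) e^(-1/t) is the flat function of x p(x), which tends to 0 by
    [flat_poly_le]. *)
Lemma is_derive_flat_poly (p : {poly R}) (t : R) :
  is_derive t 1 (flat_poly p) (flat_poly ('X ^+ 2 * (p - p^`())) t).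
Proof.
have [t0|t0|->] := ltgtP t 0.
- rewrite {2}/flat_poly ltNge (ltW t0) /=.
  have d0 : is_derive t 1 (cst 0 : R -> R) 0 by exact: is_derive_cst.
  apply: near_eq_is_derive d0.
  near=> z; rewrite /flat_poly ifF//; apply/negbTE; rewrite -leNgt.
  by apply: ltW; near: z; exact: lt_nbhsl.
- rewrite {2}/flat_poly t0.
  have dinv : is_derive t 1 (fun z : R => z^-1) (- t ^- 2).
    apply: is_derive_eq; first by apply: is_deriveV => //; rewrite gt_eqF.
    by rewrite /GRing.scale /= mulr1.
  have dp : is_derive t 1 (fun z : R => p.[z^-1]) (p^`().[t^-1] * - t ^- 2).
    exact: (@is_derive1_comp _ (horner p) (fun z => z^-1)).
  have de : is_derive t 1 (fun z : R => expR (- z^-1)) (expR (- t^-1) * (t ^- 2)).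
    apply: (@is_derive1_comp _ expR (fun z => - z^-1)).
    by apply: is_derive_eq; rewrite opprK.
  have dpe : is_derive t 1 (fun z : R => p.[z^-1] * expR (- z^-1))
      (('X ^+ 2 * (p - p^`())).[t^-1] * expR (- t^-1)).
    apply: is_derive_eq.
    rewrite /GRing.scale /= !hornerE /= exprVn; ring.
  apply: near_eq_is_derive dpe.
  by near=> z; rewrite /flat_poly ifT//; near: z; exact: lt_nbhsr.
- rewrite {2}/flat_poly ltxx.
  have [C C0 hC] := flat_poly_le ('X * p).
  suff h : h^-1 *: (flat_poly p (h + 0) - flat_poly p 0) @[h --> 0^'] --> (0 : R).
    apply: DeriveDef.
      by apply/cvg_ex; exists 0; under eq_fun do rewrite /= [_ *: 1]mulr1.
    by apply/cvg_lim => //; under eq_fun do rewrite /= [_ *: 1]mulr1.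
  apply/cvgrPdist_lt => e e0; near=> h.
  rewrite addr0 {2}/flat_poly ltxx subr0 sub0r normrN /GRing.scale /=.
  have hne : h != 0 by near: h; exact: nbhs_dnbhs_neq.
  have hlt : `|h| < e / (C + 1).
    by near: h; apply: dnbhs0_lt; rewrite divr_gt0// ltr_wpDl.
  have [h0|h0] := leP h 0.
    have -> : flat_poly p h = 0 by rewrite /flat_poly ltNge h0.
    by rewrite mulr0 normr0.
  have -> : h^-1 * flat_poly p h = flat_poly ('X * p) h.
    by rewrite /flat_poly h0 hornerM hornerX mulrA.
  apply: le_lt_trans (hC _ (ltW h0)) _; rewrite gtr0_norm// in hlt.
  rewrite ltr_pdivlMr ?ltr_wpDl// in hlt; apply: le_lt_trans hlt.
  by rewrite mulrC ler_wpM2l ?(ltW h0)// lerDl.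
Unshelve. all: by end_near. Qed.

Lemma smooth_flat_poly p : smooth (flat_poly p).
Proof.
move=> n; elim: n p => [//|n IH] p; split=> [t|]; first by have [] := is_derive_flat_poly p t.
have -> : derive1 (flat_poly p) = flat_poly ('X ^+ 2 * (p - p^`())); last exact: IH.
by apply/funext => t; rewrite derive1E; have [] := is_derive_flat_poly p t.
Qed.

(** The factor n + 1 steepens the flanks, so that the bumps converge boundedly to the
    indicator function of the open interval ([bump_cvg]). *)
Definition bumpf (p q : R) (n : nat) (x : R) : R :=
  flat_poly 1 (n.+1%:R * x + - n.+1%:R * p) * flat_poly 1 (- n.+1%:R * x + n.+1%:R * q).

Lemma smooth_bump p q n : smooth (bumpf p q n).
Proof. by apply: smoothM; apply: smooth_affine; exact: smooth_flat_poly. Qed.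

Lemma flat_poly1_bnd t : 0 <= flat_poly 1 t <= 1.
Proof.
rewrite /flat_poly; case: ifPn => [t0|_]; last by rewrite lexx ler01.
by rewrite hornerC mul1r expR_ge0 expR_le1 oppr_le0 invr_ge0 ltW.
Qed.

Lemma bump_bnd p q n x : 0 <= bumpf p q n x <= 1.
Proof.
have /andP[a0 a1] := flat_poly1_bnd (n.+1%:R * x + - n.+1%:R * p).
have /andP[b0 b1] := flat_poly1_bnd (- n.+1%:R * x + n.+1%:R * q).
by rewrite /bumpf mulr_ge0//= mulr_ile1.
Qed.

Lemma bump_gt0 p q n x : p < x < q -> 0 < bumpf p q n x.
Proof.
move=> /andP[px xq]; rewrite /bumpf /flat_poly !hornerC !mul1r.
have -> : n.+1%:R * x + - n.+1%:R * p = n.+1%:R * (x - p) by ring.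
have -> : - n.+1%:R * x + n.+1%:R * q = n.+1%:R * (q - x) by ring.
have h1 : 0 < n.+1%:R * (x - p) by rewrite mulr_gt0// subr_gt0.
have h2 : 0 < n.+1%:R * (q - x) by rewrite mulr_gt0// subr_gt0.
by rewrite h1 h2 mulr_gt0// expR_gt0.
Qed.

Lemma bump_out p q n x : ~~ (p < x < q) -> bumpf p q n x = 0.
Proof.
rewrite /bumpf /flat_poly negb_and -!leNgt.
have -> : n.+1%:R * x + - n.+1%:R * p = n.+1%:R * (x - p) by ring.
have -> : - n.+1%:R * x + n.+1%:R * q = n.+1%:R * (q - x) by ring.
rewrite !pmulr_rgt0 ?subr_gt0// => /orP[h|h].
  by rewrite ltNge h mul0r.
by rewrite [_ < q]ltNge h mulr0.
Qed.

Lemma bump_cvg p q x : bumpf p q n x @[n --> \oo] --> (\1_(`]p, q[%classic) x : R).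
Proof.
have [/andP[px xq]|xpq] := boolP (p < x < q); last first.
  rewrite indicE memNset; last by rewrite /= in_itv /=; exact/negP.
  by under eq_fun do rewrite bump_out//; exact: cvg_cst.
rewrite indicE mem_set; last by rewrite /= in_itv /= px xq.
have key (d : R) : 0 < d -> expR (- (n.+1%:R * d)^-1) @[n --> \oo] --> (1 : R).
  move=> d0.
  have h : (n.+1%:R * d)^-1 @[n --> \oo] --> (0 : R).
    have -> : (fun n : nat => (n.+1%:R * d)^-1) = (fun n => harmonic n * d^-1).
      by apply/funext => n; rewrite invfM.
    have h0 : harmonic n / d @[n --> \oo] --> (0 / d : R).
        by apply: cvgMl; exact: cvg_harmonic.
      by rewrite mul0r in h0.
  have : expR (- (n.+1%:R * d)^-1) @[n --> \oo] --> expR (- 0 : R).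
    by apply: continuous_cvg; [exact: continuous_expR|exact: cvgN].
  by rewrite oppr0 expR0.
rewrite /bumpf /flat_poly -(mulr1 (1 : R)).
under eq_fun => n.
  rewrite !hornerC !mul1r.
  have -> : n.+1%:R * x + - n.+1%:R * p = n.+1%:R * (x - p) by ring.
  have -> : - n.+1%:R * x + n.+1%:R * q = n.+1%:R * (q - x) by ring.
  rewrite !pmulr_rgt0 ?subr_gt0// px xq.
  over.
by apply: cvgM; apply: key; rewrite subr_gt0.
Qed.

End smooth_functions.

(** * Integrals against bumps *)

Section integrable_products.
Context d (T : measurableType d) (R : realType) (mu : {measure set T -> \bar R}).
Variables (D : set T) (mD : measurable D).

Lemma integrable_bddM (f h : T -> R) (C : R) :
  mu.-integrable D (EFin \o f) -> measurable_fun D h ->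
  (forall x, D x -> `|h x| <= C) -> mu.-integrable D (EFin \o (fun x => f x * h x)).
Proof.
move=> fi mh hC.
have -> : EFin \o (fun x => f x * h x) = ((EFin \o f) \* (EFin \o h))%E.
  by apply/funext => x /=; rewrite EFinM.
apply: integrableMl => //; exists C; split; first exact: num_real.
by move=> M CM x Dx /=; apply: le_trans (hC _ Dx) _; exact: ltW.
Qed.

Lemma integrable_RD (f g : T -> R) :
  mu.-integrable D (EFin \o f) -> mu.-integrable D (EFin \o g) ->
  mu.-integrable D (EFin \o (fun x => f x + g x)).
Proof. by move=> fi gi; have := integrableD mD fi gi. Qed.

Lemma integrable_RZ (k : R) (f : T -> R) :
  mu.-integrable D (EFin \o f) -> mu.-integrable D (EFin \o (fun x => k * f x)).
Proof. by move=> fi; have := integrableZl mD k fi. Qed.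

Lemma integrable_RB (f g : T -> R) :
  mu.-integrable D (EFin \o f) -> mu.-integrable D (EFin \o g) ->
  mu.-integrable D (EFin \o (fun x => f x - g x)).
Proof. by move=> fi gi; have := integrableB mD fi gi. Qed.

Lemma Rintegral_eq0 (f : T -> R) : (forall x, D x -> f x = 0) ->
  \int[mu]_(x in D) f x = 0.
Proof. by move=> f0; rewrite /Rintegral integral0_eq// => x Dx; rewrite f0. Qed.

Lemma cvg_Rintegral_dominated (f : nat -> T -> R) (g b : T -> R) :
  (forall n, measurable_fun D (f n)) -> measurable_fun D g ->
  (forall x, D x -> f n x @[n --> \oo] --> g x) ->
  mu.-integrable D (EFin \o b) -> (forall n x, D x -> `|f n x| <= b x) ->
  \int[mu]_(x in D) f n x @[n --> \oo] --> \int[mu]_(x in D) g x.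
Proof.
move=> mf mg fg ib fb.
have [] := @dominated_convergence _ _ _ mu D mD (fun n => EFin \o f n) (EFin \o g)
  (EFin \o b).
- by move=> n; exact/measurable_EFinP.
- exact/measurable_EFinP.
- by apply: aeW => x Dx; apply: cvg_EFin; [exact: nearW|exact: fg].
- by [].
- by apply: aeW => x n Dx; rewrite lee_fin fb.
move=> ig _ cvg_int; rewrite /Rintegral.
by apply: fine_cvg; rewrite fineK//; exact: integrable_fin_num.
Qed.

End integrable_products.

Section null_by_testing.
Context {R : realType}.
Local Notation mu := (@lebesgue_measure R).

Lemma measurable_bump (p q : R) n (D : set R) : measurable_fun D (bumpf p q n).
Proof.
by apply: measurable_funTS; apply: continuous_measurable_fun; apply/smooth_continuous/smooth_bump.
Qed.

Lemma bump_le1 (p q : R) n x : `|bumpf p q n x| <= 1.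
Proof. by have /andP[b0 b1] := bump_bnd p q n x; rewrite ger0_norm. Qed.

Lemma int_itv_eq0_of_bump (a b p q : R) (f : R -> R) : a < p -> p < q -> q < b ->
  mu.-integrable `]a, b[ (EFin \o f) ->
  (forall n, \int[mu]_(x in `]a, b[) (f x * bumpf p q n x) = 0) ->
  \int[mu]_(x in `]p, q[) f x = 0.
Proof.
move=> ap pq qb fi f0.
have mf : measurable_fun `]a, b[ f by move/measurable_int : fi => /measurable_EFinP.
have : \int[mu]_(x in `]a, b[) (f x * bumpf p q n x) @[n --> \oo] -->
    \int[mu]_(x in `]a, b[) (f x * \1_(`]p, q[%classic) x).
  apply: (@cvg_Rintegral_dominated _ _ _ mu `]a, b[%classic (measurable_itv _) _ _
    (fun x => `|f x|)).
  - by move=> n; apply: measurable_funM => //; exact: measurable_bump.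
  - by apply: measurable_funM => //; exact: measurable_indic.
  - by move=> x _; apply: cvgMr; exact: bump_cvg.
  - exact: integrable_norm.
  - by move=> n x _; rewrite normrM ler_piMr// bump_le1.
under eq_fun do rewrite f0.
move=> /(cvg_unique _ (cvg_cst 0)) -/(_ (@Rhausdorff R)) h.
have e : `]p, q[%classic = `]a, b[%classic `&` `]p, q[%classic.
  apply/seteqP; split=> x /=; rewrite !in_itv /=; last by case.
  by move=> /andP[px xq]; rewrite px xq (lt_trans ap px) (lt_trans xq qb).
rewrite [in LHS]e Rintegral_mkcondr [RHS]h; apply: eq_Rintegral => x _.
by rewrite patchE indicE; case: ifPn; rewrite ?mulr1 ?mulr0.
Qed.

(** The primitive of f takes the same value at all rationals of the interval; at a
    point where it is differentiable with derivative f, difference quotients along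
    rationals show that this derivative is 0. *)
Lemma ae0_of_int_rat (a b : R) (f : R -> R) :
  mu.-integrable `]a, b[ (EFin \o f) ->
  (forall p q : rat, a < ratr p -> ratr p < ratr q :> R -> ratr q < b ->
    \int[mu]_(x in `]ratr p, ratr q[) f x = 0) ->
  {ae mu, forall x, a < x < b -> f x = 0}.
Proof.
move=> fi f0; pose g := f \_ `]a, b[.
have gi : mu.-integrable setT (EFin \o g).
  rewrite /g -restrict_EFin.
  have h := (@integrable_mkcond _ _ _ mu `]a, b[%classic (EFin \o f) (measurable_itv _)).1 fi.
  exact: h.
pose F x := \int[mu]_(t in `]-oo, x]) g t.
have giS (A : set R) : measurable A -> mu.-integrable A (EFin \o g).
  by move=> mA; apply: integrableS gi.
have FB p q : p < q -> F q - F p = \int[mu]_(t in `]p, q]) g t.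
  by move=> pq; rewrite /F Rintegral_itvB//; [exact: giS| rewrite bnd_simp ltW].
have Frat (p q : rat) : a < ratr p -> ratr p < ratr q :> R -> ratr q < b ->
    F (ratr p) = F (ratr q).
  move=> ap pq qb; apply/esym/eqP; rewrite -subr_eq0 FB//.
  rewrite -Rintegral_itv_bndo_bndc; last exact: giS.
  rewrite -(f0 p q)//; apply/eqP; apply: eq_Rintegral => x.
  rewrite inE /= in_itv /= => /andP[px xq]; rewrite /g patchE mem_set//=.
  by rewrite in_itv /= (lt_trans ap px) (lt_trans xq qb).
have := FTC1Ny (fun y => giS _ (measurable_itv _)) (integrable_locally (measurable_itv _) fi).
apply: filterS; first exact: (ae_filter_ringOfSetsType mu).
move=> x [dF F'x] /andP[ax xb].
have gx : g x = f x by rewrite /g patchE mem_set//= in_itv /= ax xb.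
have cF : {for x, continuous F}.
  by apply: differentiable_continuous; apply/derivable1_diffP.
have Fx (q : rat) : x < ratr q -> ratr q < b -> F (ratr q) = F x.
  move=> xq qb; apply/eqP; rewrite -subr_eq0 -normr_eq0; apply/eqP.
  apply/le_anti/andP; split => //; apply/ler_addgt0Pl => e e0; rewrite addr0.
  have /cvgrPdist_lt /(_ e e0) := cF.
  move=> /nbhs_ballP[d /= d0 hd].
  have m0 : x < Num.min (x + d) (ratr q) by rewrite lt_min xq ltrDl d0.
  have [r] := rat_in_itvoo m0; rewrite in_itv /= => /andP[xr].
  rewrite lt_min => /andP[rd rq].
  rewrite -(Frat r q)//; last exact: lt_trans xr.
  rewrite distrC; apply/ltW/hd; rewrite /ball /= ltr_distlC; apply/andP; split.
    by rewrite ltrBlDr (lt_trans xr)// ltrDl.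
  by [].
rewrite -gx -F'x derive1E.
have : derivable F x 1 by [].
move=> /cvg_ex[l hl]; rewrite /derive (cvg_lim _ hl)//.
apply/eqP; rewrite -normr_eq0; apply/eqP/le_anti/andP; split => //.
apply/ler_addgt0Pl => e e0; rewrite addr0.
have /cvgrPdist_lt /(_ e e0) := hl.
move=> /nbhs_ballP[d /= d0 hd].
have m0 : x < Num.min (x + d) b by rewrite lt_min xb ltrDl d0.
have [r] := rat_in_itvoo m0; rewrite in_itv /= => /andP[xr].
rewrite lt_min => /andP[rd rq].
have := hd (ratr r - x) _ _.
rewrite [_ *: 1]mulr1 subrK Fx// subrr scaler0 subr0 => h; apply/ltW/h.
  by rewrite /ball /= sub0r normrN gtr0_norm ?subr_gt0// ltrBlDl.
by rewrite gt_eqF// subr_gt0.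
Qed.

Lemma ae0_of_bump (a b : R) (f : R -> R) :
  mu.-integrable `]a, b[ (EFin \o f) ->
  (forall (p q : rat) n, a < ratr p -> ratr p < ratr q :> R -> ratr q < b ->
    \int[mu]_(x in `]a, b[) (f x * bumpf (ratr p) (ratr q) n x) = 0) ->
  {ae mu, forall x, a < x < b -> f x = 0}.
Proof.
move=> fi f0; apply: ae0_of_int_rat => // p q ap pq qb.
by apply: (int_itv_eq0_of_bump ap pq qb) => // n; exact: f0.
Qed.

End null_by_testing.

(** * The lemma of du Bois-Reymond *)

Section real_fubini.
Context {R : realType}.
Local Notation mu := (@lebesgue_measure R).
Local Notation mu2 := (mu \x mu)%E.

Lemma abse_fine_le (x : \bar R) : (`|(fine x)%:E| <= `|x|)%E.
Proof. by case: x => [r| |] //=; rewrite normr0 leey. Qed.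

Variable g : R * R -> R.
Hypothesis gi : mu2.-integrable setT (EFin \o g).

Lemma integrable_Rfubini_y :
  mu.-integrable setT (EFin \o (fun y => \int[mu]_x g (x, y))).
Proof.
have iG : mu.-integrable setT (fubini_G mu (EFin \o g)).
  apply/integrableP; split; first exact: (measurable_fubini_G gi).
  have := (@integrable21ltyP _ _ _ _ R mu mu _ (measurable_int _ gi)).1 gi.
  apply: le_lt_trans; apply: ge0_le_integral => //.
  - by apply: measurableT_comp => //; exact: (measurable_fubini_G gi).
  - have mabs : measurable_fun setT (abse \o (EFin \o g)).
      by apply: measurableT_comp => //; exact: measurable_int gi.
    exact: (measurable_fun_fubini_tonelli_G (m1 := mu) _ mabs (fun=> abse_ge0 _)).
  - move=> y _; apply: le_abse_integral => //.
    exact: (measurable_fun_pair1 y (measurable_int _ gi)).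
apply: le_integrable iG => //.
  apply/measurable_EFinP; apply: (measurableT_comp (fine_measurable measurableT)).
  exact: (measurable_fubini_G gi).
by move=> y _; exact: abse_fine_le.
Qed.

Lemma Rfubini_y : \int[mu2]_p g p = \int[mu]_y \int[mu]_x g (x, y).
Proof.
rewrite /Rintegral -(integral21_prod_meas1 gi); congr fine.
apply: ae_eq_integral => //.
- exact: (measurable_fubini_G gi).
- exact: measurable_int integrable_Rfubini_y.
have := ae_integrable2 gi; apply: filterS => y iy _.
by rewrite fineK//; exact: integrable_fin_num.
Qed.

Lemma ae_integrable_y : {ae mu, forall y, mu.-integrable setT (EFin \o (fun x => g (x, y)))}.
Proof. exact: ae_integrable2 gi. Qed.

Lemma ae_integrable_x : {ae mu, forall x, mu.-integrable setT (EFin \o (fun y => g (x, y)))}.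
Proof. exact: ae_integrable1 gi. Qed.

Lemma integrable_Rfubini_x :
  mu.-integrable setT (EFin \o (fun x => \int[mu]_y g (x, y))).
Proof.
apply: le_integrable (integrable_fubini_F gi) => //.
  apply/measurable_EFinP; apply: (measurableT_comp (fine_measurable measurableT)).
  exact: (measurable_fubini_F gi).
by move=> y _; exact: abse_fine_le.
Qed.

Lemma Rfubini_x : \int[mu2]_p g p = \int[mu]_x \int[mu]_y g (x, y).
Proof.
rewrite /Rintegral -(integral12_prod_meas1 gi); congr fine.
apply: ae_eq_integral => //.
- exact: (measurable_fubini_F gi).
- exact: measurable_int integrable_Rfubini_x.
have := ae_integrable1 gi; apply: filterS => y iy _.
by rewrite fineK//; exact: integrable_fin_num.
Qed.

End real_fubini.

Section du_bois_reymond.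
Context {R : realType}.
Local Notation mu := (@lebesgue_measure R).
Local Notation mu2 := (mu \x mu)%E.

Definition test1 (a b : R) (f : R -> R) : Prop :=
  smooth f /\ exists p q, [/\ a < p, p < q, q < b & forall x, ~~ (p < x < q) -> f x = 0].

Lemma test1_bump a b p q n : a < p -> p < q -> q < b -> test1 a b (bumpf p q n).
Proof.
move=> ap pq qb; split; first exact: smooth_bump.
by exists p, q; split => // x; exact: bump_out.
Qed.

Lemma measurable_smooth (D : set R) (f : R -> R) : smooth f -> measurable_fun D f.
Proof.
by move=> sf; apply: measurable_funTS; apply: continuous_measurable_fun; exact: smooth_continuous.
Qed.

Lemma test1_bnd a b (f : R -> R) : test1 a b f -> exists C : R, forall x, `|f x| <= C.
Proof.
move=> [sf [p [q [ap pq qb f0]]]].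
have cf : {within `[p, q], continuous (fun x => `|f x|)}.
  apply: continuous_subspaceT => x; apply: cvg_norm; exact: smooth_continuous.
have [c _ hc] := EVT_max (ltW pq) cf.
exists `|f c| => x; have [xpq|xpq] := boolP (p < x < q).
  by apply: hc; rewrite in_itv /=; case/andP: xpq => /ltW -> /ltW ->.
by rewrite f0// normr0.
Qed.

Lemma test1_deriv a b (f : R -> R) : test1 a b f -> test1 a b (derive1 f).
Proof.
move=> [sf [p [q [ap pq qb f0]]]]; split; first exact: smooth_derive1.
exists ((a + p) / 2), ((q + b) / 2); split; try lra.
move=> x xpq; rewrite derive1E.
have h : x < p \/ q < x by rewrite negb_and -!leNgt in xpq; case/orP: xpq => ?; [left|right]; lra.
have d0 : is_derive x 1 (cst 0 : R -> R) 0 by exact: is_derive_cst.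
suff : is_derive x 1 f 0 by case.
apply: near_eq_is_derive d0; case: h => h; near=> z; rewrite /= f0// negb_and -!leNgt.
  by apply/orP; left; apply: ltW; near: z; exact: lt_nbhsl.
by apply/orP; right; apply: ltW; near: z; exact: lt_nbhsr.
Unshelve. all: by end_near. Qed.

Lemma test1_outside a b (f : R -> R) : test1 a b f -> forall x, ~~ (a < x < b) -> f x = 0.
Proof.
move=> [_ [p [q [ap pq qb f0]]]] x xab; apply: f0; apply: contra xab => /andP[px xq].
by rewrite (lt_trans ap px) (lt_trans xq qb).
Qed.

Lemma integrable_test1 a b (f : R -> R) (D : set R) : test1 a b f -> measurable D ->
  mu.-integrable D (EFin \o f).
Proof.
move=> tf mD; apply: (integrableS measurableT) => //.
have [C hC] := test1_bnd tf; have mf : measurable_fun setT f by apply: measurable_smooth; case: tf.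
have -> : EFin \o f = (EFin \o f) \_ `]a, b[.
  apply/funext => x; rewrite patchE; case: ifPn => //.
  by rewrite notin_setE /= in_itv /= => /negP xab; rewrite (test1_outside tf).
apply/(integrable_mkcond _ _).1 => //.
apply: measurable_bounded_integrable => //.
- suff: (mu `]a, b[ < +oo)%E by [].
  by rewrite lebesgue_measure_itv /=; case: ifP => // _; rewrite -EFinD ltry.
- exact: measurable_funTS.
- by exists C; split => [|M CM x _ /=]; [exact: num_real|rewrite (le_trans (hC _))// ltW].
Qed.

(** The primitive vanishes to the left of the support of f, and to the right of it
    because the total integral of f is 0. *)
Lemma test1_primitive a b (f : R -> R) : test1 a b f -> \int[mu]_x f x = 0 ->
  test1 a b (fun y => \int[mu]_(t in `]-oo, y]) f t) /\
  derive1 (fun y => \int[mu]_(t in `]-oo, y]) f t) = f.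
Proof.
move=> tf f0; pose F y := \int[mu]_(t in `]-oo, y]) f t; rewrite -/F.
have fi (D : set R) : measurable D -> mu.-integrable D (EFin \o f).
  exact: integrable_test1 tf.
have dF (x : R) : is_derive x 1 F (f x).
  have := @continuous_FTC1 _ f -oo%O x (x + 1).
  have Ny : (-oo%O < BRight x)%E by rewrite ltNyr.
  rewrite ltrDl ltr01 => /(_ isT (fi _ (measurable_itv _)) Ny).
  have cf : {for x, continuous f} by apply: smooth_continuous; case: tf.
  move=> /(_ cf)[dF F'x]; apply: DeriveDef; first exact: dF.
  by rewrite -derive1E; exact: F'x.
split; last by apply/funext => x; rewrite derive1E; have [] := dF x.
case: (tf) => sf [p [q [ap pq qb fout]]].
split; first exact: smooth_primitive dF sf.
exists p, q; split => // x; rewrite negb_and -!leNgt => /orP[xp|qx].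
  apply: Rintegral_eq0 => t; rewrite /= in_itv /= => tx; rewrite fout// negb_and -!leNgt.
  by rewrite (le_trans tx xp).
rewrite -f0 [RHS](_ : _ = \int[mu]_(t in `]-oo, x] `|` `]x, +oo[) f t); last first.
  congr (Rintegral _ _ _); apply/esym/seteqP; split => // t _ /=; rewrite !in_itv /= andbT.
  by case: leP => _; [left|right].
rewrite Rintegral_setU//=; last 2 first.
- by rewrite -/(is_true _); apply: fi; exact: measurableU.
- by apply/disj_setPS => t /=; rewrite !in_itv /= andbT => -[tx]; rewrite ltNge tx.
rewrite [X in _ + X]Rintegral_eq0 ?addr0// => t.
rewrite /= in_itv /= andbT => xt; rewrite fout// negb_and -!leNgt.
by rewrite (le_trans qx (ltW xt)) orbT.
Qed.


Lemma test1_comb a b (f g : R -> R) (k : R) : test1 a b f -> test1 a b g ->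
  test1 a b (fun x => f x + k * g x).
Proof.
move=> [sf [p [q [ap pq qb f0]]]] [sg [p' [q' [ap' pq' qb' g0]]]]; split.
  by apply: smoothD => //; apply: smoothM => //; exact: smooth_cst.
exists (Num.min p p'), (Num.max q q'); split.
- by rewrite lt_min ap.
- by rewrite gt_min !lt_max pq.
- by rewrite gt_max qb.
move=> x xpq; rewrite f0 ?g0 ?mulr0 ?addr0//; apply: contra xpq => /andP[px xq].
  by rewrite gt_min lt_max px xq !orbT.
by rewrite gt_min lt_max px xq.
Qed.

(** Once the moving bound is written as an indicator, this is an integral with
    parameters over a fixed line, to whose positive and negative parts Tonelli applies. *)
Lemma measurable_running_integral (a : R) (w : R * R -> R) : measurable_fun setT w ->
  measurable_fun setT (fun p : R * R => \int[mu]_(t in `]a, p.2[) w (p.1, t)).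
Proof.
move=> mw.
pose h (z : (R * R) * R) : \bar R := (if (a < z.2) && (z.2 < z.1.2) then w (z.1.1, z.2) else 0)%:E.
have mh : measurable_fun setT h.
  apply/measurable_EFinP; apply: measurable_fun_ifT => //.
    apply: measurable_and; apply: measurable_fun_ltr => //.
    by apply: measurableT_comp => //; exact: measurable_fst.
  apply: (measurableT_comp mw); apply: measurable_fun_pair => //.
  by apply: measurableT_comp => //; exact: measurable_fst.
have -> : (fun p : R * R => \int[mu]_(t in `]a, p.2[) w (p.1, t)) =
    (fun p => fine (\int[mu]_t (h^\+)%E (p, t) - \int[mu]_t (h^\-)%E (p, t))%E).
  apply/funext => p; rewrite /Rintegral integral_mkcond integralE.
  have e t : (((fun t => (w (p.1, t))%:E) \_ `]a, p.2[) t = h (p, t))%E.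
    rewrite /h patchE; case: ifPn; first by rewrite inE /= in_itv /= => ->.
    by rewrite notin_setE /= in_itv /= => /negP/negbTE ->.
  by congr (fine (_ - _)%E); apply: eq_integral => t _; rewrite ?funeposE ?funenegE e.
apply: (measurableT_comp (fine_measurable measurableT)); apply: emeasurable_funB.
  apply: (measurable_fun_fubini_tonelli_F (m2 := mu) (h^\+)%E) => //.
  exact: measurable_funepos.
apply: (measurable_fun_fubini_tonelli_F (m2 := mu) (h^\-)%E) => //.
exact: measurable_funeneg.
Qed.

Lemma integrable_tensor (f g : R -> R) : mu.-integrable setT (EFin \o f) ->
  mu.-integrable setT (EFin \o g) ->
  mu2.-integrable setT (EFin \o (fun p : R * R => f p.1 * g p.2)).
Proof.
move=> fi gi.
have mf : measurable_fun setT f by move/measurable_int : fi => /measurable_EFinP.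
have mg : measurable_fun setT g by move/measurable_int : gi => /measurable_EFinP.
have mfg : measurable_fun setT (EFin \o (fun p : R * R => f p.1 * g p.2)).
  apply/measurable_EFinP; apply: measurable_funM.
    by apply: measurableT_comp => //; exact: measurable_fst.
  by apply: measurableT_comp => //; exact: measurable_snd.
apply/(@integrable12ltyP _ _ _ _ R mu mu _ mfg).
have nf := integrable_fin_num measurableT (integrable_abse fi).
have ng := integrable_fin_num measurableT (integrable_abse gi).
rewrite (_ : (\int[mu]_x \int[mu]_y _ = (\int[mu]_x (abse \o (EFin \o f)) x) *
  \int[mu]_y (abse \o (EFin \o g)) y)%E).
  by rewrite -(fineK nf) -(fineK ng) -EFinM ltry.
have mag : measurable_fun setT (abse \o (EFin \o g)).
  by apply: measurableT_comp => //; exact/measurable_EFinP.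
have maf : measurable_fun setT (abse \o (EFin \o f)).
  by apply: measurableT_comp => //; exact/measurable_EFinP.
have g0 : (0 <= \int[mu]_y (abse \o (EFin \o g)) y)%E by apply: integral_ge0 => y _; exact: abse_ge0.
rewrite -ge0_integralZr//; try by move=> *; exact: abse_ge0.
apply: eq_integral => x _ /=; rewrite -ge0_integralZl//; try by move=> *; exact: abse_ge0.
by apply: eq_integral => y _; rewrite /= -EFinM normrM.
Qed.

Lemma Rintegral_test1_deriv a b (f : R -> R) (t : R) : test1 a b f ->
  \int[mu]_(y in `]t, +oo[) derive1 f y = - f t.
Proof.
move=> tf; have sf := tf.1; have td := test1_deriv tf.
have fi (D : set R) : measurable D -> mu.-integrable D (EFin \o (derive1 f)).
  exact: integrable_test1 td.
pose M := Num.max b t + 1.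
have tM : t < M by rewrite /M ltr_pwDr// le_max lexx orbT.
have bM x : M <= x -> ~~ (a < x < b).
  move=> Mx; rewrite negb_and -!leNgt; apply/orP; right; apply: le_trans Mx.
  by rewrite /M ler_wpDr// le_max lexx.
have fM : f M = 0 by apply: (test1_outside tf); exact: bM.
have -> : `]t, +oo[%classic = `]t, M] `|` `]M, +oo[ :> set R.
  apply/seteqP; split => x /=; rewrite !in_itv /= !andbT.
    by move=> tx; case: (leP x M) => _; [left; rewrite tx|right].
  by case=> [/andP[]//|]; exact: lt_trans.
rewrite Rintegral_setU//=; last 2 first.
- by apply: fi; exact: measurableU.
- by apply/disj_setPS => x /=; rewrite !in_itv /= andbT => -[/andP[_ xM]]; rewrite ltNge xM.
rewrite [X in _ + X]Rintegral_eq0 ?addr0; last first.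
  by move=> x; rewrite /= in_itv /= andbT => Mx; apply: (test1_outside td); apply: bM; exact: ltW.
rewrite Rintegral_itv_obnd_cbnd; last by apply: fi.
rewrite /Rintegral (@continuous_FTC2 _ _ f)//.
- by rewrite -EFinB fM /= sub0r.
- by apply: continuous_subspaceT; apply: smooth_continuous; exact: smooth_derive1.
- split.
  + by move=> x _; exact: smooth_derivable.
  + by apply: cvg_at_right_filter; exact: smooth_continuous.
  + by apply: cvg_at_left_filter; exact: smooth_continuous.
Qed.

Lemma Rintegral_bump_gt0 p q n : p < q -> 0 < \int[mu]_x bumpf p q n x.
Proof.
move=> pq; have b0 x : 0 <= bumpf p q n x by have /andP[] := bump_bnd p q n x.
rewrite lt_neqAle Rintegral_ge0// andbT eq_sym; apply/negP => /eqP i0.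
have tb : test1 (p - 1) (q + 1) (bumpf p q n) by apply: test1_bump => //; lra.
have bi := integrable_test1 tb measurableT.
have : (\int[mu]_x `|(bumpf p q n x)%:E| = 0)%E.
  transitivity (\int[mu]_x (bumpf p q n x)%:E)%E.
    by apply: eq_integral => x _ /=; rewrite ger0_norm.
  by rewrite -(fineK (integrable_fin_num measurableT bi)) -[fine _]/(\int[mu]_x bumpf p q n x) i0.
move=> /(ae_eq_integral_abs _ measurableT (measurable_int _ bi)) h.
have [x xpq /= ] := ae_exists_itv pq h; move=> /(_ I)[] /eqP.
by rewrite gt_eqF// bump_gt0.
Qed.

Lemma Rintegral_outside (a b : R) (f : R -> R) : (forall x, ~~ (a < x < b) -> f x = 0) ->
  \int[mu]_(x in `]a, b[) f x = \int[mu]_x f x.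
Proof.
move=> f0; rewrite Rintegral_mkcond; apply: eq_Rintegral => x _; rewrite patchE.
by case: ifPn => //; rewrite notin_setE /= in_itv /= => /negP/f0.
Qed.

(** The lemma of du Bois-Reymond: subtracting an indefinite integral of w reduces to
    w = 0, and a function orthogonal to all derivatives of test functions is
    constant since the test functions of zero mean are exactly these derivatives. *)
Lemma du_bois_reymond (a b : R) (F w : R -> R) : a < b ->
  mu.-integrable setT (EFin \o F) -> mu.-integrable setT (EFin \o w) ->
  (forall f, test1 a b f ->
     \int[mu]_x (F x * derive1 f x) = - \int[mu]_x (w x * f x)) ->
  exists c : R, {ae mu, forall y, a < y < b -> F y = c + \int[mu]_(t in `]a, y[) w t}.
Proof.
move=> ab Fi wi Fw; pose G y := \int[mu]_(t in `]a, y[) w t.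
have mw : measurable_fun setT w by move/measurable_int : wi => /measurable_EFinP.
have mF : measurable_fun setT F by move/measurable_int : Fi => /measurable_EFinP.
have mG : measurable_fun setT G.
  have mw2 : measurable_fun setT (fun p : R * R => w p.2).
    by apply: measurableT_comp => //; exact: measurable_snd.
  apply: (measurableT_comp (g := fun y : R => (0 : R, y)) (measurable_running_integral a mw2)).
  exact: pair1_measurable.
have wiS (D : set R) : measurable D -> mu.-integrable D (EFin \o w).
  by move=> mD; exact: integrableS wi.
pose CG := \int[mu]_x `|w x|.
have GC y : `|G y| <= CG.
  apply: le_trans (le_normr_Rintegral _ _) _ => //; first exact: wiS.
  rewrite /CG Rintegral_mkcond; apply: le_Rintegral => //.
  - rewrite -restrict_EFin.
    have h := (@integrable_mkcond _ _ _ mu `]a, y[%classic (EFin \o (fun x => `|w x|))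
      (measurable_itv _)).1; apply: h.
    by apply: integrable_norm; exact: wiS.
  - exact: integrable_norm.
  - by move=> x _; rewrite patchE; case: ifP => _ //; exact: normr_ge0.
have Gdf f : test1 a b f -> \int[mu]_y (G y * derive1 f y) = - \int[mu]_x (w x * f x).
  move=> tf; have td := test1_deriv tf; have di := integrable_test1 td measurableT.
  (* The double integral of w(t) f'(y) over a < t < y, computed in both orders. *)
  pose k (p : R * R) := (w p.1 * derive1 f p.2) * (if a < p.1 < p.2 then 1 else 0).
  have ki : mu2.-integrable setT (EFin \o k).
    apply: (@integrable_bddM _ _ _ _ _ measurableT _ _ 1) => //; first exact: integrable_tensor.
      apply: measurable_fun_ifT => //.
      by apply: measurable_and; apply: measurable_fun_ltr.
    by move=> p _; case: ifP => _; rewrite ?normr1 ?normr0.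
  transitivity (\int[mu2]_p k p).
    rewrite (Rfubini_y ki); apply: eq_Rintegral => y _.
    rewrite -RintegralZr//; last exact: wiS.
    rewrite Rintegral_mkcond; apply: eq_Rintegral => t _; rewrite patchE /k /=.
    case: ifPn; first by rewrite inE /= in_itv /= => ->; rewrite mulr1.
    by rewrite notin_setE /= in_itv /= => /negP/negbTE ->; rewrite mulr0.
  rewrite (Rfubini_x ki).
  transitivity (\int[mu]_x (- 1 * (w x * f x))); last first.
    rewrite RintegralZl// ?mulN1r//.
    have [C hC] := test1_bnd tf.
    by apply: (@integrable_bddM _ _ _ _ _ measurableT _ _ C) => //; exact: measurable_smooth tf.1.
  apply: eq_Rintegral => t _; rewrite /k /=.
  have [at_|ta] := ltP a t; last first.
    rewrite (test1_outside tf); last by rewrite negb_and -leNgt ta.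
    by rewrite !mulr0; apply: Rintegral_eq0 => y _; rewrite mulr0.
  transitivity (w t * \int[mu]_(y in `]t, +oo[) derive1 f y).
    rewrite -RintegralZl//; last exact: integrable_test1 td _.
    rewrite [RHS]Rintegral_mkcond; apply: eq_Rintegral => y _; rewrite patchE /=.
    case: ifPn; first by move=> ty; rewrite mem_set ?mulr1//= in_itv /= ty.
    by move=> ty; rewrite memNset ?mulr0//= in_itv /= andbT; exact/negP.
  by rewrite (Rintegral_test1_deriv _ tf) mulrN mulN1r.
(* From here on H = F - G is orthogonal to all derivatives of test functions; a
   fixed bump r0 normalises any bump psi to one of zero mean. *)
pose H x := F x - G x.
have mH : measurable_fun setT H by exact: measurable_funB.
have Hf_int f : test1 a b f -> mu.-integrable setT (EFin \o (fun x => H x * f x)).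
  move=> tf; have [C hC] := test1_bnd tf.
  rewrite (_ : (fun x => H x * f x) = (fun x => F x * f x - f x * G x)); last first.
    by apply/funext => x; rewrite /H; ring.
  apply: integrable_RB => //.
    by apply: (@integrable_bddM _ _ _ _ _ measurableT _ _ C) => //; exact: measurable_smooth tf.1.
  by apply: (@integrable_bddM _ _ _ _ _ measurableT _ _ CG) => //; exact: integrable_test1 tf _.
have H0 f : test1 a b f -> \int[mu]_x (H x * derive1 f x) = 0.
  move=> tf; have td := test1_deriv tf; have [C hC] := test1_bnd td.
  transitivity (\int[mu]_x (F x * derive1 f x) - \int[mu]_x (G x * derive1 f x)).
    rewrite -RintegralB//.
    - by apply: eq_Rintegral => x _; rewrite /H mulrBl.
    - by apply: (@integrable_bddM _ _ _ _ _ measurableT _ _ C) => //; exact: measurable_smooth td.1.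
    - rewrite (_ : (fun y => G y * _ y) = (fun x => derive1 f x * G x)); last first.
        by apply/funext => x; rewrite mulrC.
      by apply: (@integrable_bddM _ _ _ _ _ measurableT _ _ CG) => //; exact: integrable_test1 td _.
  by rewrite Fw// Gdf// subrr.
pose r0 := bumpf (a + (b - a) / 3) (b - (b - a) / 3) 0.
have tr0 : test1 a b r0 by apply: test1_bump; lra.
have I0 : 0 < \int[mu]_x r0 x by apply: Rintegral_bump_gt0; lra.
pose c := (\int[mu]_x (H x * r0 x)) / \int[mu]_x r0 x.
exists c.
have Hab : mu.-integrable `]a, b[ (EFin \o (fun x => H x - c)).
  rewrite (_ : (fun x => H x - c) = (fun x => F x - (G x + c))); last first.
    by apply/funext => x; rewrite /H; ring.
  apply: integrable_RB => //; first exact: integrableS Fi.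
  apply: measurable_bounded_integrable => //.
  - suff: (mu `]a, b[ < +oo)%E by [].
    by rewrite lebesgue_measure_itv /=; case: ifP => // _; rewrite -EFinD ltry.
  - by apply: measurable_funTS; exact: measurable_funD.
  - exists (CG + `|c|); split => [|M CM x _ /=]; first exact: num_real.
    by rewrite (le_trans (ler_normD _ _))// (le_trans (lerD (GC _) (lexx _)))// ltW.
have := ae0_of_bump Hab; move=> h.
have {h} : {ae mu, forall x, a < x < b -> H x - c = 0}.
  apply: h => p q n ap pq qb; have tb := test1_bump n ap pq qb.
  rewrite Rintegral_outside; last by move=> x xab; rewrite (test1_outside tb)// mulr0.
  set psi := bumpf _ _ n; pose k := - ((\int[mu]_x psi x) / \int[mu]_x r0 x).
  have tz := test1_comb k tb tr0.
  have z0 : \int[mu]_x (psi x + k * r0 x) = 0.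
    rewrite RintegralD//; [|exact: integrable_test1 tb _|]; last first.
      by apply: integrable_RZ => //; exact: integrable_test1 tr0 _.
    rewrite RintegralZl//; last exact: integrable_test1 tr0 _.
    by rewrite /k mulNr divfK ?subrr// gt_eqF.
  have [tP dP] := test1_primitive tz z0.
  have := H0 _ tP; rewrite dP => hz.
  transitivity (\int[mu]_x (H x * (psi x + k * r0 x)) +
    \int[mu]_x (- k * (H x * r0 x) + (- c * psi x))).
    rewrite -RintegralD//; first by apply: eq_Rintegral => x _; ring.
    - exact: Hf_int.
    - apply: integrable_RD => //; apply: integrable_RZ => //; first exact: Hf_int.
      exact: integrable_test1 tb _.
  rewrite hz add0r RintegralD//; last 2 first.
  - by apply: integrable_RZ => //; exact: Hf_int.
  - by apply: integrable_RZ => //; exact: integrable_test1 tb _.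
  rewrite !RintegralZl//; [|exact: integrable_test1 tb _|exact: Hf_int].
  by rewrite /k /c opprK mulNr mulrAC [X in _ - X]mulrAC [X in X / _ - _]mulrC subrr.
move=> h; apply: (ae_impl h) => y + yab => /(_ yab) /eqP; rewrite subr_eq0 => /eqP Hy.
by rewrite -Hy /H subrK.
Qed.

End du_bois_reymond.

(** * Absolute continuity on lines *)

Section lines.
Context {R : realType}.
Local Notation mu := (@lebesgue_measure R).
Local Notation mu2 := (mu \x mu)%E.

Lemma measurable_integrable_plane (f : R * R -> R) :
  mu2.-integrable setT (EFin \o f) -> measurable_fun setT f.
Proof. by move=> /measurable_int /measurable_EFinP. Qed.

Lemma measurable_fst_comp (f : R -> R) : measurable_fun setT f ->
  measurable_fun setT (fun p : R * R => f p.1).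
Proof. by move=> mf; apply: (measurableT_comp mf); exact: measurable_fst. Qed.

Lemma measurable_snd_comp (f : R -> R) : measurable_fun setT f ->
  measurable_fun setT (fun p : R * R => f p.2).
Proof. by move=> mf; apply: (measurableT_comp mf); exact: measurable_snd. Qed.

Lemma integrable_Mfst (f : R * R -> R) (h : R -> R) (C : R) :
  mu2.-integrable setT (EFin \o f) -> measurable_fun setT h ->
  (forall x, `|h x| <= C) -> mu2.-integrable setT (EFin \o (fun p => f p * h p.1)).
Proof.
move=> fi mh hC; apply: (@integrable_bddM _ _ _ _ _ measurableT _ _ C) => //.
exact: measurable_fst_comp.
Qed.

Lemma integrable_Msnd (f : R * R -> R) (h : R -> R) (C : R) :
  mu2.-integrable setT (EFin \o f) -> measurable_fun setT h ->
  (forall x, `|h x| <= C) -> mu2.-integrable setT (EFin \o (fun p => f p * h p.2)).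
Proof.
move=> fi mh hC; apply: (@integrable_bddM _ _ _ _ _ measurableT _ _ C) => //.
exact: measurable_snd_comp.
Qed.

Variables p0 q0 r0 r1 : R.

(** Countably many bumps suffice to test an integrable function, so that the null
    sets excluded for each of them can be united. *)
Definition rat_bump (i : rat * rat * nat) := bumpf (ratr i.1.1 : R) (ratr i.1.2) i.2.

Definition rat_bump_in (a b : R) (i : rat * rat * nat) :=
  [/\ a < ratr i.1.1, ratr i.1.1 < ratr i.1.2 :> R & ratr i.1.2 < b].

Lemma test1_rat_bump a b i : rat_bump_in a b i -> test1 a b (rat_bump i).
Proof. by move=> [ap pq qb]; exact: test1_bump. Qed.

Lemma measurable_test1 a b (f : R -> R) : test1 a b f -> measurable_fun setT f.
Proof. by move=> [sf _]; exact: measurable_smooth. Qed.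

Lemma ae0_of_rat_bump (a b : R) (f : R -> R) : mu.-integrable setT (EFin \o f) ->
  (forall i, rat_bump_in a b i -> \int[mu]_x (f x * rat_bump i x) = 0) ->
  {ae mu, forall x, a < x < b -> f x = 0}.
Proof.
move=> fi f0; apply: ae0_of_bump; first exact: integrableS fi.
move=> p q n ap pq qb; have := f0 (p, q, n) (And3 ap pq qb).
rewrite Rintegral_outside// => x xab.
by rewrite (test1_outside (test1_bump n ap pq qb))// mulr0.
Qed.

Lemma ae_eq_Rintegral (f g : R -> R) : mu.-integrable setT (EFin \o f) ->
  mu.-integrable setT (EFin \o g) -> {ae mu, forall x, f x = g x} ->
  \int[mu]_x f x = \int[mu]_x g x.
Proof.
move=> fi gi fg; rewrite /Rintegral; congr fine.
apply: ae_eq_integral => //; [exact: measurable_int fi|exact: measurable_int gi|].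
by apply: (ae_impl fg) => x -> _.
Qed.

Lemma Rfubini_y_tensor (f : R * R -> R) (g h : R -> R) :
  mu2.-integrable setT (EFin \o f) -> test1 p0 q0 g -> test1 r0 r1 h ->
  \int[mu2]_p (f p * (g p.1 * h p.2)) = \int[mu]_y ((\int[mu]_x (f (x, y) * g x)) * h y).
Proof.
move=> fi tg th; have [Cg hg] := test1_bnd tg; have [Ch hh] := test1_bnd th.
have fgi := integrable_Mfst fi (measurable_test1 tg) hg.
have fghi := integrable_Msnd fgi (measurable_test1 th) hh.
under eq_Rintegral do rewrite mulrA.
rewrite (Rfubini_y fghi); apply: ae_eq_Rintegral.
- exact: integrable_Rfubini_y fghi.
- apply: (@integrable_bddM _ _ _ _ _ measurableT _ _ Ch) => //.
    exact: integrable_Rfubini_y fgi.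
  exact: measurable_test1 th.
- by apply: (ae_impl (ae_integrable_y fgi)) => y iy; rewrite -RintegralZr.
Qed.

Lemma integrable_test1M (f : R -> R) a b (g : R -> R) : mu.-integrable setT (EFin \o f) ->
  test1 a b g -> mu.-integrable setT (EFin \o (fun x => f x * g x)).
Proof.
move=> fi tg; have [Cg hg] := test1_bnd tg.
by apply: (@integrable_bddM _ _ _ _ _ measurableT _ _ Cg) => //; exact: measurable_test1 tg.
Qed.

Lemma ae_of_slices (f c : R * R -> R) : measurable_fun setT f -> measurable_fun setT c ->
  {ae mu, forall y, r0 < y < r1 -> {ae mu, forall x, p0 < x < q0 -> f (x, y) = c (x, y)}} ->
  {ae mu2, forall p, p0 < p.1 < q0 -> r0 < p.2 < r1 -> f p = c p}.
Proof.
move=> mf mc h; apply: ae_of_slice2; last first.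
  apply: (ae_impl h) => y + ; have [yr|yr] := boolP (r0 < y < r1); last first.
    by move=> _; apply: aeW => x /= _.
  by move=> /(_ isT) hy; apply: (ae_impl hy) => x + /= xp _; exact.
have -> : [set p : R * R | ~ (p0 < p.1 < q0 -> r0 < p.2 < r1 -> f p = c p)] =
    (`]p0, q0[ `*` `]r0, r1[) `&` [set p | f p == c p = false].
  apply/seteqP; split => p /=; rewrite !in_itv /=.
    move=> h0; have [pp [pr /eqP/negbTE]] : p0 < p.1 < q0 /\ (r0 < p.2 < r1 /\ f p <> c p).
      split; first by apply: contrapT => n; apply: h0 => /n.
      split; first by apply: contrapT => n; apply: h0 => _ /n.
      by move=> e; apply: h0.
    by split.
  by move=> [[pp pr] /eqP] + h0; rewrite h0.
apply: measurableI; first by apply: measurableX; exact: measurable_itv.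
rewrite -[X in measurable X]setTI.
have meq := measurable_fun_eqr mf mc.
have := meq measurableT [set false].
by apply.
Qed.

(** For a fixed rational bump in x, testing in y shows that the integral of f(.,y)
    against it is 0 for almost all y; outside one null set of heights y this holds for
    all rational bumps at once, whence f(.,y) = 0 almost everywhere. *)
Lemma ae0_of_tensor (f : R * R -> R) : mu2.-integrable setT (EFin \o f) ->
  (forall g h, test1 p0 q0 g -> test1 r0 r1 h -> \int[mu2]_p (f p * (g p.1 * h p.2)) = 0) ->
  {ae mu2, forall p, p0 < p.1 < q0 -> r0 < p.2 < r1 -> f p = 0}.
Proof.
move=> fi f0; have mf := measurable_integrable_plane fi.
have ae1 : {ae mu, forall y, forall i, rat_bump_in p0 q0 i -> r0 < y < r1 ->
    \int[mu]_x (f (x, y) * rat_bump i x) = 0}.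
  apply: ae_forall_count => i.
  have [ti|nti] := pselect (rat_bump_in p0 q0 i); last exact: aeW.
  have fbi := integrable_Mfst fi (measurable_test1 (test1_rat_bump ti)) (bump_le1 _ _ _).
  have h := @ae0_of_rat_bump r0 r1 _ (integrable_Rfubini_y fbi).
  apply: (ae_impl (h _)) => [j tj|y hy _ yr]; last exact: hy.
  have := f0 _ _ (test1_rat_bump ti) (test1_rat_bump tj).
  by rewrite (Rfubini_y_tensor fi (test1_rat_bump ti) (test1_rat_bump tj)).
apply: (@ae_of_slices f (fun=> 0)) => //.
apply: (ae_impl (ae_conj ae1 (ae_integrable_y fi))) => y [hy iy] yr.
by apply: (ae0_of_rat_bump iy) => i ti; exact: hy.
Qed.

(** For each rational bump b in x, the lemma of du Bois-Reymond applies to the function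
    y |-> int f(x,y) b(x) dx and gives int (f - G)(x,y) b(x) dx = c_b for almost all y,
    where G is the running integral of w. Outside a null set of heights this holds
    for all b; comparing with one good height y1 shows that f - G agrees at almost
    all heights with its slice at y1, which is therefore the function c. *)
Lemma weak_derivative_lines (f w : R * R -> R) : r0 < r1 ->
  mu2.-integrable setT (EFin \o f) -> mu2.-integrable setT (EFin \o w) ->
  (forall g h, test1 p0 q0 g -> test1 r0 r1 h ->
    \int[mu2]_p (f p * (g p.1 * derive1 h p.2)) = - \int[mu2]_p (w p * (g p.1 * h p.2))) ->
  exists2 c : R -> R, measurable_fun setT c &
    {ae mu2, forall p, p0 < p.1 < q0 -> r0 < p.2 < r1 ->
      f p = c p.1 + \int[mu]_(t in `]r0, p.2[) w (p.1, t)}.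
Proof.
move=> r01 fi wi fw.
have mf := measurable_integrable_plane fi; have mw := measurable_integrable_plane wi.
pose G (p : R * R) := \int[mu]_(t in `]r0, p.2[) w (p.1, t).
have mG : measurable_fun setT G by exact: measurable_running_integral.
pose chi (y t : R) : R := if r0 < t < y then 1 else 0.
have mchi y : measurable_fun setT (chi y).
  by apply: measurable_fun_ifT => //; apply: measurable_and; exact: measurable_fun_ltr.
have chi1 y t : `|chi y t| <= 1 by rewrite /chi; case: ifP; rewrite ?normr1 ?normr0.
have chiE (u : R -> R) y : \int[mu]_(t in `]r0, y[) u t = \int[mu]_t (u t * chi y t).
  rewrite Rintegral_mkcond; apply: eq_Rintegral => t _; rewrite patchE /chi.
  case: ifPn; first by rewrite inE /= in_itv /= => ->; rewrite mulr1.
  by rewrite notin_setE /= in_itv /= => /negP/negbTE ->; rewrite mulr0.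
have wchi y : mu2.-integrable setT (EFin \o (fun p => w p * chi y p.2)).
  exact: integrable_Msnd wi (mchi y) (chi1 y).
have Gi y : mu.-integrable setT (EFin \o (fun x => G (x, y))).
  rewrite (_ : (fun x => G (x, y)) = (fun x => \int[mu]_t (w (x, t) * chi y t))).
    exact: integrable_Rfubini_x (wchi y).
  by apply/funext => x; rewrite /G chiE.
have exc i : rat_bump_in p0 q0 i -> exists c : R, {ae mu, forall y, r0 < y < r1 ->
    \int[mu]_x (f (x, y) * rat_bump i x) = c + \int[mu]_x (G (x, y) * rat_bump i x)}.
  move=> ti; have tb := test1_rat_bump ti; have mb := measurable_test1 tb.
  have fbi := integrable_Mfst fi mb (bump_le1 _ _ _).
  have wbi := integrable_Mfst wi mb (bump_le1 _ _ _).
  have := @du_bois_reymond _ r0 r1 _ _ r01 (integrable_Rfubini_y fbi) (integrable_Rfubini_y wbi).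
  case=> [h th|c hc].
    have := fw _ _ tb th; rewrite (Rfubini_y_tensor fi tb (test1_deriv th)).
    by rewrite (Rfubini_y_tensor wi tb th).
  exists c; apply: (ae_impl hc) => y + yr => /(_ yr) ->; congr (_ + _).
  have wbci := integrable_Msnd wbi (mchi y) (chi1 y).
  transitivity (\int[mu2]_p (w p * rat_bump i p.1 * chi y p.2)).
    rewrite chiE (Rfubini_y wbci); apply: ae_eq_Rintegral.
    - apply: (@integrable_bddM _ _ _ _ _ measurableT _ _ 1) => //.
        exact: integrable_Rfubini_y wbi.
      exact: mchi.
    - exact: integrable_Rfubini_y wbci.
    - by apply: (ae_impl (ae_integrable_y wbi)) => t it; rewrite -RintegralZr.
  rewrite (Rfubini_x wbci); apply: ae_eq_Rintegral.
  - exact: integrable_Rfubini_x wbci.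
  - by apply: integrable_test1M tb; exact: Gi.
  - apply: (ae_impl (ae_integrable_x (wchi y))) => x ix; rewrite /G chiE -RintegralZr//.
    by apply: eq_Rintegral => t _ /=; ring.
have [cc hcc] : exists cc : rat * rat * nat -> R, forall i, rat_bump_in p0 q0 i ->
    {ae mu, forall y, r0 < y < r1 ->
    \int[mu]_x (f (x, y) * rat_bump i x) = cc i + \int[mu]_x (G (x, y) * rat_bump i x)}.
  pose P (i : rat * rat * nat) (c : R) := rat_bump_in p0 q0 i ->
    {ae mu, forall y, r0 < y < r1 ->
    \int[mu]_x (f (x, y) * rat_bump i x) = c + \int[mu]_x (G (x, y) * rat_bump i x)}.
  suff /choice[cc hcc] : forall i, exists c, P i c by exists cc.
  rewrite /P => i; have [ti|nti] := pselect (rat_bump_in p0 q0 i); last by exists 0.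
  by have [c hc] := exc i ti; exists c.
have ae1 : {ae mu, forall y, forall i, rat_bump_in p0 q0 i -> r0 < y < r1 ->
    \int[mu]_x (f (x, y) * rat_bump i x) = cc i + \int[mu]_x (G (x, y) * rat_bump i x)}.
  apply: ae_forall_count => i.
  have [ti|nti] := pselect (rat_bump_in p0 q0 i); last exact: aeW.
  by apply: (ae_impl (hcc i ti)) => y hy _ yr; exact: hy.
have ae2 := ae_conj ae1 (ae_integrable_y fi).
have [y1 y1r [hy1 iy1]] := ae_exists_itv r01 ae2.
pose c x := f (x, y1) - G (x, y1).
have mc : measurable_fun setT c.
  apply: measurable_funB.
    by apply: (measurableT_comp mf); exact: pair2_measurable.
  by apply: (measurableT_comp mG); exact: pair2_measurable.
exists c => //; apply: (@ae_of_slices f (fun p => c p.1 + G p)) => //.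
  by apply: measurable_funD => //; exact: measurable_fst_comp.
apply: (ae_impl ae2) => y [hy iy] yr.
have Di : mu.-integrable setT (EFin \o (fun x => f (x, y) - G (x, y) - c x)).
  by apply: integrable_RB => //; apply: integrable_RB.
have := @ae0_of_rat_bump p0 q0 _ Di => h.
apply: (ae_impl (h _)) => [i ti|x hx xp]; last first.
  by have /eqP := hx xp; rewrite subr_eq0 => /eqP <-; rewrite subrK.
have tb := test1_rat_bump ti.
transitivity ((\int[mu]_x (f (x, y) * rat_bump i x) - \int[mu]_x (G (x, y) * rat_bump i x))
  - (\int[mu]_x (f (x, y1) * rat_bump i x) - \int[mu]_x (G (x, y1) * rat_bump i x))).
  have i1 := integrable_test1M iy tb; have i2 := integrable_test1M (Gi y) tb.
  have i3 := integrable_test1M iy1 tb; have i4 := integrable_test1M (Gi y1) tb.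
  rewrite -!RintegralB//; [|exact: integrable_RB|exact: integrable_RB].
  by apply: eq_Rintegral => x _ /=; rewrite /c; ring.
have sub4 (A B C D k : R) : A = k + B -> C = k + D -> A - B - (C - D) = 0.
  by move=> -> ->; rewrite !addrK subrr.
exact: (sub4 _ _ _ _ (cc i) (hy i ti yr) (hy1 i ti y1r)).
Qed.

Lemma ae_fst (P : R -> Prop) : {ae mu, forall x, P x} -> {ae mu2, forall p : R * R, P p.1}.
Proof.
move=> [N [mN N0 PN]]; exists (N `*` setT); split.
- exact: measurableX.
- have -> : (mu2 (N `*` setT) = mu N * mu setT)%E by exact: product_measure1E.
  by rewrite N0 mul0e.
- by move=> p /= nP; split => //; exact: PN.
Qed.

Lemma ae_snd (P : R -> Prop) : {ae mu, forall x, P x} -> {ae mu2, forall p : R * R, P p.2}.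
Proof.
move=> [N [mN N0 PN]]; exists (setT `*` N); split.
- exact: measurableX.
- have -> : (mu2 (setT `*` N) = mu setT * mu N)%E by exact: product_measure1E.
  by rewrite N0 mule0.
- by move=> p /= nP; split => //; exact: PN.
Qed.

Lemma ae_neq (a : R) : {ae mu, forall x, x != a}.
Proof.
exists [set a]; split; [exact: measurable_set1|exact: lebesgue_measure_set1|].
by move=> x /= /negP; rewrite negbK => /eqP.
Qed.

Lemma abs_Rintegral_le (D : set R) (f : R -> R) : measurable D -> measurable_fun D f ->
  (`|\int[mu]_(t in D) f t|%:E <= \int[mu]_(t in D) `|f t|%:E)%E.
Proof.
move=> mD mf; apply: (le_trans (abse_fine_le _)).
by apply: le_abse_integral => //; exact/measurable_EFinP.
Qed.

Lemma cvg_small_Rintegral (w : R -> R) (y : nat -> R) : mu.-integrable setT (EFin \o w) ->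
  (forall k, y k <= k.+1%:R^-1) -> \int[mu]_(t in `]0, y k[) w t @[k --> \oo] --> (0 : R).
Proof.
move=> wi yk; have mw : measurable_fun setT w by move/measurable_int : wi => /measurable_EFinP.
pose f k t : R := w t * (if 0 < t < y k then 1 else 0).
have fE k : \int[mu]_(t in `]0, y k[) w t = \int[mu]_t f k t.
  rewrite Rintegral_mkcond; apply: eq_Rintegral => t _; rewrite patchE /f.
  case: ifPn; first by rewrite inE /= in_itv /= => ->; rewrite mulr1.
  by rewrite notin_setE /= in_itv /= => /negP/negbTE ->; rewrite mulr0.
under eq_fun do rewrite fE.
have -> : (0 : R) = \int[mu]_t (cst 0 t) by rewrite Rintegral_eq0.
apply: (@cvg_Rintegral_dominated _ _ _ mu setT measurableT f _ (fun t => `|w t|)) => //.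
- move=> k; apply: measurable_funM => //; apply: measurable_fun_ifT => //.
  by apply: measurable_and; exact: measurable_fun_ltr.
- move=> t _; have [t0|t0] := ltP 0 t; last first.
    by apply: cvg_near_cst; apply: nearW => k; rewrite /f ltNge t0 /= mulr0.
  apply: cvg_near_cst; near=> k; rewrite /f ifF ?mulr0//; apply/negbTE; rewrite negb_and -!leNgt; apply/orP; right.
  apply: le_trans (yk k) _; apply: ltW; near: k.
  have := @cvg_harmonic R => /cvgrPdist_lt /(_ _ t0); apply: filterS => k.
  by rewrite sub0r normrN /harmonic /= ger0_norm ?invr_ge0.
- exact: integrable_norm.
- by move=> k t _; rewrite /f normrM; case: ifP => _; rewrite ?normr1 ?normr0 ?mulr1 ?mulr0.
Unshelve. all: by end_near. Qed.

End lines.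

(** * Functions of finite energy on the half-strip *)

Section tensor_test_functions.
Context {R : realType}.
Local Notation mu := (@lebesgue_measure R).
Local Notation mu2 := (mu \x mu)%E.

Definition tensor (f g : R -> R) (p : R * R) : R := f p.1 * g p.2.

Lemma is_derive_fst_x (f : R -> R) (p : R * R) df : is_derive p.1 1 f df ->
  is_derive p (e_x R) (fun q => f q.1) df.
Proof. by move=> [d e]; apply: DeriveDef; [exact: d|exact: e]. Qed.

Lemma is_derive_snd_y (f : R -> R) (p : R * R) df : is_derive p.2 1 f df ->
  is_derive p (e_y R) (fun q => f q.2) df.
Proof. by move=> [d e]; apply: DeriveDef; [exact: d|exact: e]. Qed.

Lemma is_derive_direction_cst (f : R * R -> R) (p v : R * R) :
  (forall h : R, f (h *: v + p) = f p) -> is_derive p v f 0.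
Proof.
move=> fv.
have e : (fun h : R => h^-1 *: ((f \o shift p) (h *: v) - f p)) = (fun=> 0).
  by apply/funext => h /=; rewrite fv subrr scaler0.
apply: DeriveDef.
  by rewrite /derivable e; exact: is_cvg_cst.
by rewrite /derive e; exact: lim_cst.
Qed.

Lemma is_derive_tensor_x (f g : R -> R) (p : R * R) : smooth f ->
  is_derive p (e_x R) (tensor f g) (tensor (derive1 f) g p).
Proof.
move=> sf; have h1 := is_derive_fst_x (smooth_is_derive sf p.1).
have h2 : is_derive p (e_x R) (fun q => g q.2) 0.
  by apply: is_derive_direction_cst => h /=; rewrite scaler0 add0r.
apply: (is_derive_eq (is_deriveM h1 h2)).
by rewrite /GRing.scale /= mulr0 add0r mulrC.
Qed.

Lemma is_derive_tensor_y (f g : R -> R) (p : R * R) : smooth g ->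
  is_derive p (e_y R) (tensor f g) (tensor f (derive1 g) p).
Proof.
move=> sg; have h1 := is_derive_snd_y (smooth_is_derive sg p.2).
have h2 : is_derive p (e_y R) (fun q => f q.1) 0.
  by apply: is_derive_direction_cst => h /=; rewrite scaler0 add0r.
apply: (is_derive_eq (is_deriveM h2 h1)).
by rewrite /GRing.scale /= mulr0 addr0.
Qed.

(** The partial derivatives of a tensor product are tensor products. *)
Lemma Cn_tensor n (f g : R -> R) : smooth f -> smooth g -> Cn n (tensor f g).
Proof.
have ct (a b : R -> R) : smooth a -> smooth b -> continuous (tensor a b).
  move=> sa sb p; apply: (@cvgM _ _ (nbhs p)).
    by apply: (@cvg_comp _ _ _ fst a _ (nbhs p.1)); [exact: cvg_fst|exact: smooth_continuous].
  by apply: (@cvg_comp _ _ _ snd b _ (nbhs p.2)); [exact: cvg_snd|exact: smooth_continuous].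
elim: n f g => [|n IH] f g sf sg /=; first exact: ct.
split; first exact: ct.
- move=> p; split.
    by have [] := is_derive_tensor_x g p sf.
  by have [] := is_derive_tensor_y f p sg.
- have -> : (fun p => 'D_(e_x R) (tensor f g) p) = tensor (derive1 f) g.
    by apply/funext => p; have [] := is_derive_tensor_x g p sf.
  by apply: IH => //; exact: smooth_derive1.
- have -> : (fun p => 'D_(e_y R) (tensor f g) p) = tensor f (derive1 g).
    by apply/funext => p; have [] := is_derive_tensor_y f p sg.
  by apply: IH => //; exact: smooth_derive1.
Qed.

Lemma compact_rect (a b c d : R) : compact (`[a, b] `*` `[c, d] : set (R * R)).
Proof. by apply: compact_setX; exact: segment_compact. Qed.

Lemma test_function_tensor (a b c d : R) (f g : R -> R) : 0 <= c ->
  test1 a b f -> test1 c d g -> test_function (tensor f g).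
Proof.
move=> c0 [sf [p [q [ap pq qb f0]]]] [sg [p' [q' [cp pq' qd g0]]]].
split=> [n|]; first exact: Cn_tensor.
exists (`[p, q] `*` `[p', q']); split; first exact: compact_rect.
- move=> z [_ /=]; rewrite in_itv /= => /andP[z1 _]; rewrite /half_plane /=.
  by rewrite (lt_le_trans _ z1)// (le_lt_trans c0 cp).
- move=> z nz; rewrite /tensor.
  have [zpq|zpq] := boolP (p < z.1 < q); last by rewrite f0// mul0r.
  have [zpq'|zpq'] := boolP (p' < z.2 < q'); last by rewrite (g0 _ zpq') mulr0.
  case: nz; split; rewrite /= in_itv /=.
    by case/andP: zpq => /ltW -> /ltW ->.
  by case/andP: zpq' => /ltW -> /ltW ->.
Qed.

Lemma measurable_half_plane : measurable (half_plane R).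
Proof.
have -> : half_plane R = setT `*` `]0, +oo[.
  by apply/seteqP; split => p /=; rewrite in_itv /= andbT /half_plane //= => -[].
by apply: measurableX => //; exact: measurable_itv.
Qed.

(** Functions on the half-plane are only measurable there, whereas the Tonelli and
    Fubini theorems concern the whole plane. *)
Definition extend0 (f : R * R -> R) (p : R * R) : R := if 0 < p.2 then f p else 0.

Lemma measurable_extend0 f : measurable_fun (half_plane R) f ->
  measurable_fun setT (extend0 f).
Proof.
move=> mf; have -> : extend0 f = f \_ (half_plane R).
  apply/funext => p; rewrite /extend0 patchE; case: ifPn => p0.
    by rewrite mem_set.
  by rewrite memNset//; apply/negP.
by apply/(measurable_restrictT _ _).1 => //; exact: measurable_half_plane.
Qed.

Lemma measurable_slice_half_plane (f : R * R -> R) (y : R) : measurable_fun (half_plane R) f -> 0 < y ->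
  measurable_fun setT (fun x => f (x, y)).
Proof.
move=> mf y0; have : measurable_fun setT (fun x => extend0 f (x, y)).
  by apply: (measurableT_comp (measurable_extend0 mf)); exact: pair2_measurable.
by rewrite /extend0 /= y0.
Qed.

End tensor_test_functions.

Section extension_lines.
Context {R : realType} (s T : R) (hs : 0 < s < 1) (hT : 0 < T).
Local Notation mu := (@lebesgue_measure R).
Local Notation mu2 := (mu \x mu)%E.
Local Notation cell := (period_cell T).

Let s0 : 0 < s. Proof. by case/andP: hs. Qed.
Let s1 : s < 1. Proof. by case/andP: hs. Qed.

Definition strip (r : R) : set (R * R) := cell `*` `]0, r].

Lemma measurable_cell : measurable cell. Proof. exact: measurable_itv. Qed.

Lemma measurable_strip r : measurable (strip r).
Proof. by apply: measurableX; [exact: measurable_cell|exact: measurable_itv]. Qed.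

Lemma half_stripE : half_strip T = cell `*` `]0, +oo[.
Proof. by apply/seteqP; split=> p [p1 p2]; split => //; move: p2; rewrite /= in_itv /= andbT. Qed.

Lemma measurable_half_strip : measurable (half_strip T).
Proof. by rewrite half_stripE; apply: measurableX; [exact: measurable_cell|exact: measurable_itv]. Qed.

Lemma strip_half_plane r : strip r `<=` half_plane R.
Proof. by move=> p [_ /=]; rewrite in_itv /= => /andP[]. Qed.

Lemma strip_half_strip r : strip r `<=` half_strip T.
Proof. by move=> p [pc /=]; rewrite in_itv /= => /andP[]. Qed.

Lemma half_strip_half_plane : half_strip T `<=` half_plane R.
Proof. by move=> p [_ /=]. Qed.

Lemma mu_cell : (mu cell = T%:E)%E.
Proof.
rewrite /period_cell lebesgue_measure_itv /= lte_fin.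
have h : - (T / 2) < T / 2 by rewrite gtrN// divr_gt0.
by rewrite h -EFinD opprK -splitr.
Qed.

Lemma integral_cst_cell (c : R) : (\int[mu]_(x in cell) c%:E = (c * T)%:E)%E.
Proof.
have h := @integral_cst _ _ _ mu cell measurable_cell c%:E.
by rewrite EFinM -mu_cell -h.
Qed.

(** The weight y^a with a = 1 - 2 s. *)
Definition wt (p : R * R) : R := p.2 `^ (1 - 2 * s).

Lemma measurable_wt (D : set (R * R)) : measurable_fun D wt.
Proof. by apply: measurable_funTS; exact: (measurable_snd_comp (measurable_powR _)). Qed.

Lemma wt_gt0 p : 0 < p.2 -> 0 < wt p. Proof. by move=> p0; exact: powR_gt0. Qed.

(** The reciprocal weight y^(2s-1) is integrable at 0 because s > 0. *)
Lemma integral_wtV r : 0 < r -> (\int[mu2]_(p in strip r) ((wt p)^-1)%:E < +oo)%E.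
Proof.
move=> r0.
have -> : (fun p => ((wt p)^-1)%:E) = (fun p : R * R => (p.2 `^ (2 * s - 1))%:E).
  by apply/funext => p; rewrite /wt -powRN opprB.
rewrite tonelli_rect2//; last 3 first.
- exact: measurable_cell.
- by apply/measurable_EFinP; exact: (measurable_snd_comp (measurable_powR _)).
- by move=> p; nneg.
have -> : (\int[mu]_(y in `]0%R, r]) \int[mu]_(x in cell) ((x, y).2 `^ (2 * s - 1))%:E =
    \int[mu]_(y in `]0%R, r]) ((y `^ (2 * s - 1))%:E * T%:E))%E.
  by apply: eq_integral => y _ /=; rewrite integral_cst_cell EFinM.
rewrite ge0_integralZr//; try first [by move=> *; nneg
  | by apply: measurable_funTS; apply/measurable_EFinP; exact: measurable_powR].
have h := @ge0_integral_pow_near0 R (2 * s) r _ r0; have s20 : 0 < 2 * s by rewrite mulr_gt0.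
apply: le_lt_trans (lee_wpmul2r _ (h s20)) _; first by rewrite lee_fin ltW.
by rewrite -EFinM ltry.
Qed.

(** A gradient of finite energy is integrable up to the boundary y = 0, by
    [integral_wtV]; this is what lets the integrals on vertical lines start at 0. *)
Lemma integrable_strip (W : R * R -> R) r : 0 < r -> measurable_fun (half_plane R) W ->
  (\int[mu2]_(p in half_strip T) (wt p * W p ^+ 2)%:E < +oo)%E ->
  mu2.-integrable (strip r) (EFin \o W).
Proof.
move=> r0 mW hW; have mWr : measurable_fun (strip r) W.
  by apply: measurable_funS mW; [exact: measurable_half_plane|exact: strip_half_plane].
apply: (@integrable_of_weight _ _ _ mu2 _ (measurable_strip r) wt) => //.
- exact: measurable_wt.
- by move=> p /strip_half_plane; exact: wt_gt0.
- exact: integral_wtV.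
- apply: le_lt_trans hW; apply: ge0_subset_integral => //.
  + exact: measurable_strip.
  + exact: measurable_half_strip.
  + apply/measurable_EFinP; apply: measurable_funM; first exact: measurable_wt.
    apply: measurable_funX; apply: measurable_funS mW; first exact: measurable_half_plane.
    exact: half_strip_half_plane.
  + by move=> p _; nneg.
  + exact: strip_half_strip.
Qed.

Lemma integrable_patch (D : set (R * R)) (f : R * R -> R) : measurable D ->
  mu2.-integrable D (EFin \o f) -> mu2.-integrable setT (EFin \o (f \_ D)).
Proof.
by move=> mD fi; rewrite -restrict_EFin; have := (@integrable_mkcond _ _ _ mu2 D (EFin \o f) mD).1 fi.
Qed.

Section one_extension.
Variable U : HT s T.
Local Notation W1 := (ht_dx U).
Local Notation W2 := (ht_dy U).
Local Notation u := (ht_trace U).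

Definition energy1 (W : R * R -> R) : \bar R :=
  (\int[mu2]_(p in half_strip T) (wt p * W p ^+ 2)%:E)%E.

Lemma energy1_ge0 W : (0 <= energy1 W)%E.
Proof. by apply: integral_ge0 => p _; nneg. Qed.

Lemma energyE (V1 V2 : R * R -> R) : measurable_fun (half_plane R) V1 ->
  measurable_fun (half_plane R) V2 -> energy s T V1 V2 = (energy1 V1 + energy1 V2)%E.
Proof.
move=> m1 m2; rewrite /energy /energy1 -ge0_integralD//=.
- by apply: eq_integral => p _; rewrite -EFinD -mulrDr.
- exact: measurable_half_strip.
- by move=> p _; nneg.
- apply/measurable_EFinP; apply: measurable_funM; first exact: measurable_wt.
  apply: measurable_funX; apply: measurable_funS m1; first exact: measurable_half_plane.
  exact: half_strip_half_plane.
- by move=> p _; nneg.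
- apply/measurable_EFinP; apply: measurable_funM; first exact: measurable_wt.
  apply: measurable_funX; apply: measurable_funS m2; first exact: measurable_half_plane.
  exact: half_strip_half_plane.
Qed.

Lemma measurable_ht_fun : measurable_fun (half_plane R) (ht_fun U).
Proof. by have [] := ht_loc U. Qed.

Lemma measurable_ht_dx : measurable_fun (half_plane R) W1.
Proof. by have [[]] := ht_weak_dx U. Qed.

Lemma measurable_ht_dy : measurable_fun (half_plane R) W2.
Proof. by have [[]] := ht_weak_dy U. Qed.

Lemma L2T_sqnorm_ge0 (v : R -> R) : (0 <= L2T_sqnorm T v)%E.
Proof. by apply: integral_ge0 => x _; nneg. Qed.

Lemma energy_ge0 (V1 V2 : R * R -> R) : (0 <= energy s T V1 V2)%E.
Proof. by apply: integral_ge0 => p _; nneg. Qed.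

Lemma energy_lty : (energy s T W1 W2 < +oo)%E.
Proof.
by apply: le_lt_trans (ht_finite U); rewrite leeDl// L2T_sqnorm_ge0.
Qed.

Lemma trace_lty : (L2T_sqnorm T u < +oo)%E.
Proof. by apply: le_lt_trans (ht_finite U); rewrite leeDr// energy_ge0. Qed.

Lemma energy1_dx_le : (energy1 W1 <= energy s T W1 W2)%E.
Proof.
by rewrite (energyE measurable_ht_dx measurable_ht_dy) leeDl// energy1_ge0.
Qed.

Lemma energy1_dy_le : (energy1 W2 <= energy s T W1 W2)%E.
Proof.
by rewrite (energyE measurable_ht_dx measurable_ht_dy) leeDr// energy1_ge0.
Qed.

Lemma integrable_dx r : 0 < r -> mu2.-integrable (strip r) (EFin \o W1).
Proof.
move=> r0; apply: integrable_strip => //; first exact: measurable_ht_dx.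
exact: le_lt_trans energy1_dx_le energy_lty.
Qed.

Lemma integrable_dy r : 0 < r -> mu2.-integrable (strip r) (EFin \o W2).
Proof.
move=> r0; apply: integrable_strip => //; first exact: measurable_ht_dy.
exact: le_lt_trans energy1_dy_le energy_lty.
Qed.


Lemma measurable_trace : measurable_fun setT u. Proof. exact: ht_trace_meas. Qed.

(** Away from the boundary this is local integrability. Near the boundary the slices
    U(.,y) stay at bounded distance of the trace in L^2, by the definition of the
    trace, and |v| <= 1 + v^2. *)
Lemma integrable_fun r : 0 < r -> mu2.-integrable (strip r) (EFin \o ht_fun U).
Proof.
move=> r0.
have [d d0 hd] := ht_is_trace U (@ltr01 R).
pose e := Num.min d r / 2.
have m0 : 0 < Num.min d r by rewrite lt_min d0 r0.
have e0 : 0 < e by rewrite /e divr_gt0.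
have ed : e < d by rewrite /e ltr_pdivrMr// mulr_natr mulr2n ltr_pwDl// ge_min lexx.
have er : e < r by rewrite /e ltr_pdivrMr// mulr_natr mulr2n ltr_pwDl// ge_min lexx orbT.
have mU : measurable_fun (strip r) (ht_fun U).
  by apply: measurable_funS measurable_ht_fun; [exact: measurable_half_plane|exact: strip_half_plane].
apply/integrableP; split; first exact/measurable_EFinP.
have stripE : strip r = cell `*` `]0, e[ `|` cell `*` `[e, r].
  apply/seteqP; split => p.
    move=> [pc /=]; rewrite in_itv /= => /andP[p0 pr].
    by have [pe|pe] := ltP p.2 e; [left|right]; split => //; rewrite /= in_itv /= ?p0 ?pe.
  case=> -[pc /=]; rewrite in_itv /= => /andP[p1 p2]; split => //; rewrite /= in_itv /=.
    by rewrite p1 (ltW (lt_trans p2 er)).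
  by rewrite (lt_le_trans e0 p1).
have mA : measurable (cell `*` `]0, e[ : set (R * R)).
  by apply: measurableX; [exact: measurable_cell|exact: measurable_itv].
have mB : measurable (cell `*` `[e, r] : set (R * R)).
  by apply: measurableX; [exact: measurable_cell|exact: measurable_itv].
rewrite stripE ge0_integral_setU//=; last 2 first.
- by rewrite -stripE; apply/measurable_EFinP; apply: measurableT_comp.
- apply/disj_setPS => p /= -[[_ p1] [_]]; move: p1; rewrite /= !in_itv /=.
  by move=> /andP[_ pe] /andP[]; rewrite leNgt pe.
apply: lte_add_pinfty; last first.
  apply: (ht_loc U).2; first exact: compact_rect.
  by move=> p [_ /=]; rewrite in_itv /= => /andP[p1 _]; exact: lt_le_trans p1.
pose g (p : R * R) : \bar R := (1 + 2 * (extend0 (ht_fun U) p - u p.1) ^+ 2 + 2 * u p.1 ^+ 2)%:E.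
have mg : measurable_fun setT g.
  have mu1 : measurable_fun setT (fun p : R * R => u p.1) := measurable_fst_comp measurable_trace.
  apply/measurable_EFinP; apply: measurable_funD.
    apply: measurable_funD => //; apply: measurable_funM => //; apply: measurable_funX.
    by apply: measurable_funB => //; apply: measurable_extend0; exact: measurable_ht_fun.
  by apply: measurable_funM => //; apply: measurable_funX.
have g0 p : (0 <= g p)%E by rewrite /g; nneg.
apply: (@le_lt_trans _ _ (\int[mu2]_(p in cell `*` `]0%R, e[) g p)%E).
  apply: ge0_le_integral => //.
  - apply/measurable_EFinP; apply: measurableT_comp => //; apply: measurable_funS mU.
      exact: measurable_strip.
    by rewrite stripE; exact: subsetUl.
  - exact: measurable_funTS.
  - move=> p [_ /=]; rewrite in_itv /= => /andP[p0 _]; rewrite /g /extend0 p0 lee_fin.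
    set v := ht_fun U p; set w := u p.1.
    have h1 : v ^+ 2 <= 2 * (v - w) ^+ 2 + 2 * w ^+ 2.
      rewrite -subr_ge0 (_ : _ - _ = (v - 2 * w) ^+ 2) ?sqr_ge0//; ring.
    have h2 : `|v| <= 1 + v ^+ 2.
      rewrite -subr_ge0 -real_normK ?num_real// (_ : _ - _ = (`|v| - 2^-1) ^+ 2 + 3 / 4); last by field.
      by rewrite addr_ge0 ?sqr_ge0// divr_ge0.
    lra.
rewrite tonelli_rect2//; last exact: measurable_cell.
pose L := L2T_sqnorm T u.
apply: (@le_lt_trans _ _ (\int[mu]_(y in `]0%R, e[) (T%:E + 2%:E * 1 + 2%:E * L))%E).
  apply: ae_ge0_le_integral => //.
  - by move=> y _; apply: integral_ge0.
  - by apply: measurable_funTS; apply: measurable_slice_y => //; exact: measurable_cell.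
  - move=> y _; have L0 : (0 <= L)%E by exact: L2T_sqnorm_ge0.
    by rewrite !adde_ge0// ?mule_ge0// lee_fin ltW.
  apply: (ae_impl hd) => y hy /=; rewrite in_itv /= => /andP[y0 ye].
  have /hy : 0 < y < d by rewrite y0 (lt_trans ye).
  rewrite /g /extend0 /= y0.
  have mh : measurable_fun cell (fun x => ht_fun U (x, y)).
    by apply: measurable_funTS; exact: measurable_slice_half_plane measurable_ht_fun y0.
  have mu' : measurable_fun cell u by apply: measurable_funTS; exact: measurable_trace.
  have -> : (\int[mu]_(x in cell) (1 + 2 * (ht_fun U (x, y) - u x) ^+ 2 + 2 * u x ^+ 2)%:E =
    \int[mu]_(x in cell) (1%:E + 2%:E * ((ht_fun U (x, y) - u x) ^+ 2)%:E
      + 2%:E * (u x ^+ 2)%:E))%E.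
    by apply: eq_integral => x _; rewrite !EFinD !EFinM.
  have m1 : measurable_fun cell (fun x => ((ht_fun U (x, y) - u x) ^+ 2)%:E).
    by apply/measurable_EFinP; apply: measurable_funX; exact: measurable_funB.
  have m2 : measurable_fun cell (fun x => (u x ^+ 2)%:E).
    by apply/measurable_EFinP; exact: measurable_funX.
  rewrite ge0_integralD//; try first [exact: measurable_cell | by move=> *; nneg
    | by apply: emeasurable_funD => //; apply: emeasurable_funM | by apply: emeasurable_funM].
  rewrite ge0_integralD//; try first [exact: measurable_cell | by move=> *; nneg
    | by apply: emeasurable_funM].
  rewrite !ge0_integralZl//; try first [exact: measurable_cell | by move=> *; nneg].
  rewrite integral_cst_cell mul1r => h; apply: leeD => //; apply: leeD => //.
  by apply: lee_wpmul2l.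
rewrite integral_cst//.
have Lf : L \is a fin_num by rewrite ge0_fin_numE ?L2T_sqnorm_ge0// trace_lty.
have mf : mu `]0%R, e[%classic \is a fin_num.
  by rewrite lebesgue_measure_itv /= lte_fin e0 -EFinD.
have h : (mu `]0%R, e[%classic < +oo)%E by rewrite lebesgue_measure_itv /= lte_fin e0 -EFinD ltry.
rewrite -(fineK Lf) -!EFinM -!EFinD lte_mul_pinfty// lee_fin.
by rewrite !addr_ge0// ?mulr_ge0// ?(ltW hT)// fine_ge0// L2T_sqnorm_ge0.
Qed.

Lemma test1_strip (g h : R -> R) (r : R) (p : R * R) :
  test1 (- (T / 2)) (T / 2) g -> test1 0 r h -> ~ strip r p -> g p.1 * h p.2 = 0.
Proof.
move=> tg th np; have [p1|p1] := boolP (- (T / 2) < p.1 < T / 2); last first.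
  by rewrite (test1_outside tg p1) mul0r.
have [p2|p2] := boolP (0 < p.2 < r); last by rewrite (test1_outside th p2) mulr0.
by case: np; split; rewrite ?/period_cell /= in_itv /=;
  [case/andP: p1 => /ltW -> /ltW ->|case/andP: p2 => -> /ltW ->].
Qed.

Lemma Rintegral_half_plane (f g : R * R -> R) : (forall p, 0 < p.2 -> f p = g p) ->
  (forall p, p.2 <= 0 -> g p = 0) ->
  \int[mu2]_(p in half_plane R) f p = \int[mu2]_p g p.
Proof.
move=> fg g0; rewrite Rintegral_mkcond; apply: eq_Rintegral => p _; rewrite patchE.
case: ifPn; first by rewrite inE /half_plane /= => /fg.
by rewrite notin_setE /half_plane /= => /negP; rewrite -leNgt => /g0.
Qed.

Lemma weak_dy_strip (r : R) (g h : R -> R) :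
  test1 (- (T / 2)) (T / 2) g -> test1 0 r h ->
  \int[mu2]_p ((ht_fun U \_ (strip r)) p * (g p.1 * derive1 h p.2)) =
  - \int[mu2]_p ((W2 \_ (strip r)) p * (g p.1 * h p.2)).
Proof.
move=> tg th; have td := test1_deriv th.
have := (ht_weak_dy U).2 _ (test_function_tensor (lexx 0) tg th).
have key (f : R * R -> R) (k : R -> R) : test1 0 r k ->
    \int[mu2]_(p in half_plane R) (f p * tensor g k p) =
    \int[mu2]_p ((f \_ (strip r)) p * (g p.1 * k p.2)).
  move=> tk; apply: Rintegral_half_plane => p p0; rewrite patchE /tensor.
    case: ifPn => //; rewrite notin_setE => np.
    by rewrite (test1_strip tg tk np) !mulr0.
  case: ifPn => [|_]; last by rewrite mul0r.
  by rewrite inE => /strip_half_plane; rewrite /half_plane /= ltNge p0.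
rewrite -(key _ _ td) -(key _ _ th) => <-; apply: eq_Rintegral => p _.
by congr (_ * _); have [_ ->] := is_derive_tensor_y g p th.1.
Qed.

Lemma weak_dx_strip (r : R) (g h : R -> R) :
  test1 (- (T / 2)) (T / 2) g -> test1 0 r h ->
  \int[mu2]_p ((ht_fun U \_ (strip r)) p * (derive1 g p.1 * h p.2)) =
  - \int[mu2]_p ((W1 \_ (strip r)) p * (g p.1 * h p.2)).
Proof.
move=> tg th; have td := test1_deriv tg.
have := (ht_weak_dx U).2 _ (test_function_tensor (lexx 0) tg th).
have key (f : R * R -> R) (k : R -> R) : test1 (- (T / 2)) (T / 2) k ->
    \int[mu2]_(p in half_plane R) (f p * tensor k h p) =
    \int[mu2]_p ((f \_ (strip r)) p * (k p.1 * h p.2)).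
  move=> tk; apply: Rintegral_half_plane => p p0; rewrite patchE /tensor.
    case: ifPn => //; rewrite notin_setE => np.
    by rewrite (test1_strip tk th np) !mulr0.
  case: ifPn => [|_]; last by rewrite mul0r.
  by rewrite inE => /strip_half_plane; rewrite /half_plane /= ltNge p0.
rewrite -(key _ _ td) -(key _ _ tg) => <-; apply: eq_Rintegral => p _.
by congr (_ * _); have [_ ->] := is_derive_tensor_x h p tg.1.
Qed.

Lemma vertical_lines_cst (r : R) : 0 < r ->
  exists2 c : R -> R, measurable_fun setT c &
    {ae mu2, forall p, - (T / 2) < p.1 < T / 2 -> 0 < p.2 < r ->
      (ht_fun U \_ (strip r)) p = c p.1 + \int[mu]_(t in `]0, p.2[) (W2 \_ (strip r)) (p.1, t)}.
Proof.
move=> r0; apply: weak_derivative_lines => //.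
- by apply: integrable_patch; [exact: measurable_strip|exact: integrable_fun].
- by apply: integrable_patch; [exact: measurable_strip|exact: integrable_dy].
- by move=> g h tg th; exact: weak_dy_strip.
Qed.

Lemma ae_open_cell : {ae mu, forall x : R, cell x -> - (T / 2) < x < T / 2}.
Proof.
apply: (ae_impl (ae_conj (ae_neq (- (T / 2))) (ae_neq (T / 2)))) => x [xa xb].
rewrite /period_cell /= in_itv /= => /andP[h1 h2].
by rewrite !lt_neqAle h1 h2 xb eq_sym xa.
Qed.

Lemma strip_open (r : R) p : - (T / 2) < p.1 < T / 2 -> 0 < p.2 < r -> strip r p.
Proof.
move=> /andP[h1 h2] /andP[h3 h4]; split; rewrite ?/period_cell /= in_itv /=.
  by rewrite !ltW.
by rewrite h3 ltW.
Qed.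

(** The lines start at the trace: c of [vertical_lines_cst] equals u. There are heights
    y_k -> 0 at which U(.,y_k) = c + G(.,y_k), and U(.,y_k) tends to u in L^2, while
    G(.,y_k) tends to 0 almost everywhere; by Fatou's lemma the integral of (c - u)^2
    is 0. *)
Lemma vertical_lines (r : R) : 0 < r ->
  {ae mu2, forall p, - (T / 2) < p.1 < T / 2 -> 0 < p.2 < r ->
    ht_fun U p - u p.1 = \int[mu]_(t in `]0, p.2[) (W2 \_ (strip r)) (p.1, t)}.
Proof.
move=> r0; have [c mc hc] := vertical_lines_cst r0.
set w := W2 \_ (strip r) in hc *.
have wi : mu2.-integrable setT (EFin \o w).
  by apply: integrable_patch; [exact: measurable_strip|exact: integrable_dy].
have mw := measurable_integrable_plane wi.
pose G (p : R * R) := \int[mu]_(t in `]0, p.2[) w (p.1, t).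
have mG : measurable_fun setT G by exact: measurable_running_integral.
have hcu k : exists y, [/\ 0 < y, y < r, y <= k.+1%:R^-1,
   {ae mu, forall x, - (T / 2) < x < T / 2 -> ht_fun U (x, y) = c x + G (x, y)} &
   (\int[mu]_(x in cell) ((ht_fun U (x, y) - u x) ^+ 2)%:E <= (k.+1%:R^-1)%:E)%E].
  have k0 : 0 < k.+1%:R^-1 :> R by rewrite invr_gt0.
  have [d d0 hd] := ht_is_trace U k0.
  have m0 : 0 < Num.min d (Num.min r k.+1%:R^-1) by rewrite !lt_min d0 r0 k0.
  have [y /andP[y0]] := ae_exists_itv m0 (ae_conj hd (ae_slice2 hc)).
  rewrite !lt_min => /and3P[yd yr yk] [hy1 hy2].
  exists y; split => //; first exact: ltW.
    apply: (ae_impl hy2) => x /= + xc => /(_ xc); rewrite y0 yr => /(_ isT) <-.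
    by rewrite patchE mem_set//; apply: strip_open; rewrite //= y0.
  by apply: hy1; rewrite y0.
have {hcu} [y hy] := choice hcu.
pose f k x := (c x + G (x, y k) - u x) ^+ 2.
have mf k : measurable_fun cell (f k).
  apply: measurable_funTS; apply: measurable_funX.
  apply: measurable_funB; last exact: measurable_trace.
  by apply: measurable_funD => //; apply: (measurableT_comp mG); exact: pair2_measurable.
have fk k : (\int[mu]_(x in cell) (f k x)%:E <= (k.+1%:R^-1)%:E)%E.
  have [y0 yr yk h1 h2] := hy k; apply: le_trans h2.
  apply: ae_ge0_le_integral => //; first exact: measurable_cell.
  - by move=> x _; rewrite lee_fin sqr_ge0.
  - by apply/measurable_EFinP; exact: mf.
  - by move=> x _; nneg.
  - apply: measurable_funTS; apply/measurable_EFinP; apply: measurable_funX.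
    apply: measurable_funB; last exact: measurable_trace.
    exact: measurable_slice_half_plane measurable_ht_fun y0.
  - apply: (ae_impl (ae_conj h1 ae_open_cell)) => x [hx1 hx2] xc.
    by rewrite /f -hx1//; exact: hx2.
have mcu : measurable_fun cell (fun x => c x - u x).
  by apply: measurable_funTS; apply: measurable_funB => //; exact: measurable_trace.
have cu : {ae mu, forall x, cell x -> c x - u x = 0}.
  apply: ae0_of_integral_sq => //; first exact: measurable_cell.
  apply/lee_addgt0Pr => e e0; rewrite add0e.
  have := @cvg_harmonic R => /cvgrPdist_lt /(_ _ e0) [n _ hn].
  apply: (@ge0_integral_limit_le _ _ _ mu cell f _ _ n) => //.
  - exact: measurable_cell.
  - exact: measurable_funX.
  - by move=> k x _; exact: sqr_ge0.
  - by move=> x _; exact: sqr_ge0.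
  - apply: (ae_impl (ae_integrable_x wi)) => x ix _.
    have Gx : G (x, y k) @[k --> \oo] --> (0 : R).
      have yk k : y k <= k.+1%:R^-1 by have [] := hy k.
      exact: (@cvg_small_Rintegral _ (fun t => w (x, t)) y ix yk).
    have h1 : c x + G (x, y k) - u x @[k --> \oo] --> c x - u x.
      rewrite -[X in _ --> X - _]addr0; apply: cvgB; last exact: cvg_cst.
      by apply: cvgD => //; exact: cvg_cst.
    by rewrite /f; under eq_fun do rewrite expr2; rewrite expr2; exact: cvgM.
  - move=> k nk; apply: le_trans (fk k) _; rewrite lee_fin.
    by have := hn k nk; rewrite sub0r normrN ger0_norm ?harmonic_ge0//; exact: ltW.
apply: (ae_impl (ae_conj hc (ae_fst cu))) => p [h1 h2] p1 p2.
have ps : strip r p by exact: strip_open.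
have := h1 p1 p2; rewrite patchE mem_set// => ->.
have -> : c p.1 = u p.1 by apply/eqP; rewrite -subr_eq0; apply/eqP; apply: h2; case: ps.
by rewrite [u p.1 + _]addrC addrK.
Qed.

Lemma vertical_oscillation : {ae mu2, forall p, half_strip T p ->
  (`|ht_fun U p - u p.1|%:E <= \int[mu]_(t in `]0%R, p.2[) `|extend0 W2 (p.1, t)|%:E)%E}.
Proof.
have h (n : nat) : {ae mu2, forall p, - (T / 2) < p.1 < T / 2 -> 0 < p.2 < n.+1%:R ->
    ht_fun U p - u p.1 = \int[mu]_(t in `]0, p.2[) (W2 \_ (strip n.+1%:R)) (p.1, t)}.
  exact: vertical_lines.
apply: (ae_impl (ae_conj (ae_foralln h) (ae_fst ae_open_cell))) => p [hp op] [pc p0].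
have pn : p.2 < (Num.bound p.2).+1%:R.
  by apply: lt_trans (archi_boundP (ltW p0)) _; rewrite ltr_nat.
rewrite (hp (Num.bound p.2) (op pc)); last by rewrite p0 pn.
have me : measurable_fun setT (fun t => extend0 W2 (p.1, t)).
  by apply: (measurableT_comp (measurable_extend0 measurable_ht_dy)); exact: pair1_measurable.
rewrite (_ : \int[mu]_(t in `]0, p.2[) _ = \int[mu]_(t in `]0, p.2[) extend0 W2 (p.1, t)).
  by apply: abs_Rintegral_le => //; exact: measurable_funTS.
apply: eq_Rintegral => t; rewrite inE /= in_itv /= => /andP[t0 tp].
rewrite patchE /extend0 t0 mem_set//; split => //; rewrite /= in_itv /= t0.
by rewrite (ltW (lt_trans tp pn)).
Qed.

End one_extension.
End extension_lines.

(** * Changes of variables in the plane *)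

Section plane_maps.
Context {R : realType}.
Local Notation mu := (@lebesgue_measure R).
Local Notation mu2 := (mu \x mu)%E.

Definition swap (p : R * R) : R * R := (p.2, p.1).
Definition shift_x (c : R) (p : R * R) : R * R := (p.1 + c, p.2).
(** The change of variables from the pair of end points (x,z) to the end point x and
    the distance h, which is also the height at which the two points get joined. *)
Definition polar_shear (p : R * R) : R * R := (p.1, `|p.1 - p.2|).

Lemma measurable_swap : measurable_fun setT swap.
Proof. by apply: measurable_fun_pair. Qed.

Lemma measurable_shift_x c : measurable_fun setT (shift_x c).
Proof. by apply: measurable_fun_pair => //; apply: measurable_funD. Qed.

Lemma measurable_polar_shear : measurable_fun setT polar_shear.
Proof.
apply: measurable_fun_pair => //; apply: measurableT_comp => //.
by apply: measurable_funB.
Qed.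

Lemma ge0_integral_swap (f : R * R -> \bar R) : measurable_fun setT f ->
  (forall p, 0 <= f p)%E -> (\int[mu2]_p f (swap p) = \int[mu2]_p f p)%E.
Proof.
move=> mf f0; rewrite -[in LHS]setXTT -[in RHS]setXTT.
rewrite tonelli_rect1//; last by apply: measurableT_comp => //; exact: measurable_swap.
by rewrite tonelli_rect2.
Qed.

Lemma ge0_integral_shift_x (c : R) (f : R * R -> \bar R) : measurable_fun setT f ->
  (forall p, 0 <= f p)%E -> (\int[mu2]_p f (shift_x c p) = \int[mu2]_p f p)%E.
Proof.
move=> mf f0; rewrite -[in LHS]setXTT -[in RHS]setXTT.
have mfs : measurable_fun setT (f \o shift_x c).
  by apply: measurableT_comp => //; exact: measurable_shift_x.
rewrite [RHS](@tonelli_rect2 _ setT setT f)//.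
rewrite [LHS](@tonelli_rect2 _ setT setT (f \o shift_x c) _ _ mfs (fun p => f0 _))//.
apply: eq_integral => y _.
rewrite /shift_x /= (ge0_integral_translate (f := fun x => f (x, y)))//.
by apply: (measurableT_comp mf); exact: pair2_measurable.
Qed.

Lemma integrable_plane_map (phi : R * R -> R * R) (f : R * R -> R) :
  measurable_fun setT phi ->
  (forall f : R * R -> \bar R, measurable_fun setT f -> (forall p, 0 <= f p)%E ->
     (\int[mu2]_p f (phi p) = \int[mu2]_p f p)%E) ->
  mu2.-integrable setT (EFin \o f) ->
  mu2.-integrable setT (EFin \o (fun p => f (phi p))) /\
  \int[mu2]_p f (phi p) = \int[mu2]_p f p.
Proof.
move=> mphi hphi fi; have mf := measurable_integrable_plane fi.
split.
  apply/integrableP; split; first by apply/measurable_EFinP; exact: (measurableT_comp mf).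
  have h := hphi (fun p => `|(f p)%:E|%E); rewrite /= h//; last first.
    by apply/measurable_EFinP; apply: measurableT_comp.
  by case/integrableP: fi.
rewrite /Rintegral integralE [in RHS]integralE; congr (fine (_ - _)%E).
- have h := hphi (fun p => ((EFin \o f)^\+ p)%E); rewrite -h//.
    by apply: eq_integral => p _; rewrite !funeposE.
  by apply: measurable_funepos; apply/measurable_EFinP.
- have h := hphi (fun p => ((EFin \o f)^\- p)%E); rewrite -h//.
    by apply: eq_integral => p _; rewrite !funenegE.
  by apply: measurable_funeneg; apply/measurable_EFinP.
Qed.

Lemma ae_plane_map (phi : R * R -> R * R) (P : R * R -> Prop) :
  measurable_fun setT phi ->
  (forall N, measurable N -> mu2 N = 0%E -> mu2 (phi @^-1` N) = 0%E) ->
  {ae mu2, forall p, P p} -> {ae mu2, forall p, P (phi p)}.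
Proof.
move=> mphi hphi [N [mN N0 PN]]; exists (phi @^-1` N); split.
- by rewrite -[X in measurable X]setTI; exact: mphi.
- exact: hphi.
- by move=> p /= np; exact: PN.
Qed.

Lemma integral_indic_plane (N : set (R * R)) : measurable N ->
  (\int[mu2]_p (\1_N p)%:E = mu2 N)%E.
Proof. by move=> mN; rewrite integral_indic// setIT. Qed.

Lemma ae_plane_preserving (phi : R * R -> R * R) (P : R * R -> Prop) :
  measurable_fun setT phi ->
  (forall f : R * R -> \bar R, measurable_fun setT f -> (forall p, 0 <= f p)%E ->
     (\int[mu2]_p f (phi p) = \int[mu2]_p f p)%E) ->
  {ae mu2, forall p, P p} -> {ae mu2, forall p, P (phi p)}.
Proof.
move=> mphi hphi; apply: ae_plane_map => // N mN N0.
have mN' : measurable (phi @^-1` N) by rewrite -[X in measurable X]setTI; exact: mphi.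
rewrite -(integral_indic_plane mN').
have h := hphi (fun p => (\1_N p)%:E); rewrite [LHS]h//; last first.
  by apply/measurable_EFinP; exact: measurable_indic.
by rewrite integral_indic_plane.
Qed.

(** Each fibre {z : |x - z| in A} has at most twice the measure of A, so preimages of
    null sets are null. *)
Lemma ae_polar_shear (P : R * R -> Prop) : {ae mu2, forall p, P p} ->
  {ae mu2, forall p, P (polar_shear p)}.
Proof.
apply: ae_plane_map; first exact: measurable_polar_shear.
move=> N mN N0; pose f p : \bar R := (\1_N p)%:E.
have f0 p : (0 <= f p)%E by rewrite lee_fin indicE; case: (_ \in _).
have mf : measurable_fun setT f by apply/measurable_EFinP; exact: measurable_indic.
have mN' : measurable (polar_shear @^-1` N).
  by rewrite -[X in measurable X]setTI; exact: measurable_polar_shear.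
apply/eqP; rewrite eq_le measure_ge0 andbT -(integral_indic_plane mN') -setXTT.
rewrite tonelli_rect1//; last by apply/measurable_EFinP; exact: measurable_indic.
apply: (@le_trans _ _ (\int[mu]_x (2%:E * \int[mu]_(h in `]0%R, +oo[) f (x, h)))%E).
  have mfx x : measurable_fun setT (fun h => f (x, h)).
    by apply: (measurableT_comp mf); exact: pair1_measurable.
  have mS : measurable_fun setT (fun x => \int[mu]_(h in `]0%R, +oo[) f (x, h))%E.
    apply: (@measurable_slice_x _ `]0, +oo[%classic f) => //; exact: measurable_itv.
  apply: ge0_le_integral => //.
  - by move=> x _; exact: integral_ge0.
  - apply: (@measurable_slice_x _ setT (fun p => (\1_(polar_shear @^-1` N) p)%:E)) => //.
    by apply/measurable_EFinP; exact: measurable_indic.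
  - exact: (emeasurable_funM (measurable_cst _) mS).
  - move=> x _; have := ge0_integral_dist_le x (mfx x).
    by apply => h; rewrite /f.
rewrite ge0_integralZl//; first last.
- by move=> x _; apply: integral_ge0 => h _; exact: f0.
- by apply: (@measurable_slice_x _ `]0, +oo[%classic f) => //; exact: measurable_itv.
rewrite -(@tonelli_rect1 _ setT `]0, +oo[%classic f)//.
apply: (@le_trans _ _ (2%:E * \int[mu2]_p f p)%E); last first.
  by rewrite integral_indic_plane// N0 mule0.
apply: lee_wpmul2l => //; apply: ge0_subset_integral => //.
by apply: measurableX => //; exact: measurable_itv.
Qed.

Lemma weak_derivative_columns (p0 q0 r0 r1 : R) (f w : R * R -> R) : p0 < q0 ->
  mu2.-integrable setT (EFin \o f) -> mu2.-integrable setT (EFin \o w) ->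
  (forall g h, test1 p0 q0 g -> test1 r0 r1 h ->
    \int[mu2]_p (f p * (derive1 g p.1 * h p.2)) = - \int[mu2]_p (w p * (g p.1 * h p.2))) ->
  exists2 c : R -> R, measurable_fun setT c &
    {ae mu2, forall p, p0 < p.1 < q0 -> r0 < p.2 < r1 ->
      f p = c p.2 + \int[mu]_(t in `]p0, p.1[) w (t, p.2)}.
Proof.
move=> pq fi wi fw.
have hs := ge0_integral_swap.
have [f'i _] := integrable_plane_map measurable_swap hs fi.
have [w'i _] := integrable_plane_map measurable_swap hs wi.
have [|c mc hc] := @weak_derivative_lines _ r0 r1 p0 q0 _ _ pq f'i w'i.
  move=> g h tg th.
  have hd := test1_deriv th.
  have [C1 hC1] := test1_bnd tg; have [C2 hC2] := test1_bnd th; have [C3 hC3] := test1_bnd hd.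
  have key (k : R * R -> R) (a b : R -> R) (Ca Cb : R) (ki : mu2.-integrable setT (EFin \o k)) :
      measurable_fun setT a -> measurable_fun setT b ->
      (forall x, `|a x| <= Ca) -> (forall x, `|b x| <= Cb) ->
      \int[mu2]_p (k (swap p) * (a p.1 * b p.2)) = \int[mu2]_p (k p * (b p.1 * a p.2)).
    move=> ma mb ha hb; have i1 := integrable_Mfst ki mb hb.
    have i2 := integrable_Msnd i1 ma ha.
    have [_ e] := integrable_plane_map measurable_swap hs i2.
    transitivity (\int[mu2]_p (k p * b p.1 * a p.2)).
      by rewrite -e; apply: eq_Rintegral => p _; rewrite /swap /= -mulrA; congr (_ * _); rewrite mulrC.
    by apply: eq_Rintegral => p _; rewrite mulrA.
  rewrite (key _ _ _ _ _ fi (measurable_test1 tg) (measurable_test1 hd) hC1 hC3).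
  rewrite (key _ _ _ _ _ wi (measurable_test1 tg) (measurable_test1 th) hC1 hC2).
  exact: fw.
exists c => //.
have := ae_plane_preserving measurable_swap hs hc.
by move/ae_impl; apply => -[x y] /= h1 h2 h3; exact: h1.
Qed.

End plane_maps.

(** * The trace inequality *)

Section gagliardo_kernels.
Context {R : realType} (s T : R) (hs : 0 < s < 1) (hT : 0 < T).
Local Notation mu := (@lebesgue_measure R).
Local Notation mu2 := (mu \x mu)%E.
Local Notation cell := (period_cell T).

Let s0 : 0 < s. Proof. by case/andP: hs. Qed.

Lemma measurable_param_integral (g : (R * R) * R -> R) : measurable_fun setT g ->
  (forall z, 0 <= g z) -> measurable_fun setT (fun p => (\int[mu]_t (g (p, t))%:E)%E).
Proof.
move=> mg g0; apply: (measurable_fun_fubini_tonelli_F (m2 := mu) (EFin \o g)).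
  by apply/measurable_EFinP.
by move=> z; rewrite lee_fin.
Qed.

Lemma ge0_integral_if (D : set R) (b : R -> bool) (f : R -> \bar R) : measurable D ->
  (forall t, b t <-> D t) ->
  (\int[mu]_t (if b t then f t else 0) = \int[mu]_(t in D) f t)%E.
Proof.
move=> mD bD; rewrite [RHS]integral_mkcond; apply: eq_integral => t _.
rewrite patchE; case: ifPn => [/bD Dt|nb]; first by rewrite mem_set.
by rewrite memNset// => /bD; apply/negP.
Qed.

(** What a vertical side at x of height h contributes to the seminorm, after
    Cauchy-Schwarz with the weight t^(1-s), whose reciprocal integrates to h^s / s,
    and division by h^(1+2s); up to the factor 1/s. *)
Definition vert_term (W : R * R -> R) (p : R * R) : \bar R :=
  (p.2 `^ (- s - 1))%:E *
  \int[mu]_t (if (0 < t) && (t < p.2) then t `^ (1 - s) * W (p.1, t) ^+ 2 else 0)%:E.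

(** What the horizontal side at height h contributes: the side from x to z is enclosed
    in the segment of centre x and length 2 h, to which Cauchy-Schwarz without weight
    applies; after division by h^(1+2s) and up to the factor 2. *)
Definition hor_term (W : R * R -> R) (p : R * R) : \bar R :=
  (p.2 `^ (- (2 * s)))%:E *
  \int[mu]_t (if `|t - p.1| <= p.2 then W (t, p.2) ^+ 2 else 0)%:E.

Lemma measurable_vert_kernel (W : R * R -> R) : measurable_fun setT W ->
  measurable_fun setT (fun z : (R * R) * R =>
    if (0 < z.2) && (z.2 < z.1.2) then z.2 `^ (1 - s) * W (z.1.1, z.2) ^+ 2 else 0).
Proof.
move=> mW; apply: measurable_fun_ifT => //.
  apply: measurable_and; apply: measurable_fun_ltr => //.
  by apply: measurableT_comp => //; exact: measurable_fst.
apply: measurable_funM.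
  by apply: (measurableT_comp (measurable_powR _)).
apply: measurable_funX; apply: (measurableT_comp mW); apply: measurable_fun_pair => //.
by apply: measurableT_comp => //; exact: measurable_fst.
Qed.

Lemma measurable_vert_term (W : R * R -> R) : measurable_fun setT W ->
  measurable_fun setT (vert_term W).
Proof.
move=> mW; apply: emeasurable_funM.
  by apply/measurable_EFinP; exact: (measurable_snd_comp (measurable_powR _)).
apply: (measurable_param_integral (measurable_vert_kernel mW)) => z.
by case: ifP => // _; nneg.
Qed.

Lemma measurable_hor_kernel (W : R * R -> R) : measurable_fun setT W ->
  measurable_fun setT (fun z : (R * R) * R =>
    if `|z.2 - z.1.1| <= z.1.2 then W (z.2, z.1.2) ^+ 2 else 0).
Proof.
move=> mW; have m12 : measurable_fun setT (fun z : (R * R) * R => z.1.2).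
  by apply: measurableT_comp => //; exact: measurable_fst.
have m11 : measurable_fun setT (fun z : (R * R) * R => z.1.1).
  by apply: measurableT_comp => //; exact: measurable_fst.
apply: measurable_fun_ifT => //.
  apply: measurable_fun_ler => //; apply: measurableT_comp => //.
  exact: measurable_funB.
by apply: measurable_funX; apply: (measurableT_comp mW); apply: measurable_fun_pair.
Qed.

Lemma measurable_hor_term (W : R * R -> R) : measurable_fun setT W ->
  measurable_fun setT (hor_term W).
Proof.
move=> mW; apply: emeasurable_funM.
  by apply/measurable_EFinP; exact: (measurable_snd_comp (measurable_powR _)).
apply: (measurable_param_integral (measurable_hor_kernel mW)) => z.
by case: ifP => // _; nneg.
Qed.

Lemma vert_term_ge0 W p : (0 <= vert_term W p)%E.
Proof.
by apply: mule_ge0; [nneg|apply: integral_ge0 => t _; case: ifP => // _; nneg].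
Qed.

Lemma hor_term_ge0 W p : (0 <= hor_term W p)%E.
Proof.
by apply: mule_ge0; [nneg|apply: integral_ge0 => t _; case: ifP => // _; nneg].
Qed.

(** Exchange the order of integration: for fixed t the heights h > t contribute
    int_t^oo h^(-s-1) dh = t^(-s) / s, and t^(1-s) t^(-s) = t^(1-2s) is the weight of the
    energy. *)
Lemma integral_vert_term (W : R * R -> R) (x : R) : measurable_fun setT W ->
  (\int[mu]_(h in `]0%R, +oo[) vert_term W (x, h) <=
   s^-1%:E * \int[mu]_(t in `]0%R, +oo[) (t `^ (1 - 2 * s) * W (x, t) ^+ 2)%:E)%E.
Proof.
move=> mW; pose k (p : R * R) : R :=
  if (0 < p.2) && (p.2 < p.1) then p.2 `^ (1 - s) * W (x, p.2) ^+ 2 else 0.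
have k0 p : 0 <= k p by rewrite /k; case: ifP => // _; nneg.
have mk : measurable_fun setT k.
  have mx : measurable_fun setT (fun p : R * R => ((x, p.1), p.2)).
    by apply: measurable_fun_pair => //; apply: measurable_fun_pair.
  exact: (measurableT_comp (measurable_vert_kernel mW) mx).
pose f (p : R * R) : \bar R := (p.1 `^ (- s - 1) * k p)%:E.
have f0 p : (0 <= f p)%E by rewrite /f lee_fin mulr_ge0// powR_ge0.
have mf : measurable_fun setT f.
  apply/measurable_EFinP; apply: measurable_funM => //.
  exact: (measurable_fst_comp (measurable_powR _)).
have moo : measurable (`]0, +oo[%classic : set R) by exact: measurable_itv.
have -> : (\int[mu]_(h in `]0%R, +oo[) vert_term W (x, h) =
    \int[mu]_(h in `]0%R, +oo[) \int[mu]_t f (h, t))%E.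
  apply: eq_integral => h _; rewrite /vert_term /f /=.
  have mi : measurable_fun setT (fun t => (k (h, t))%:E).
    by apply/measurable_EFinP; apply: (measurableT_comp mk); exact: pair1_measurable.
  transitivity ((h `^ (- s - 1))%:E * \int[mu]_t (k (h, t))%:E)%E => //.
  rewrite -(@ge0_integralZl _ _ _ mu _ measurableT _ mi)//.
    by move=> t _; rewrite lee_fin.
  by rewrite lee_fin powR_ge0.
rewrite -(@tonelli_rect1 _ `]0, +oo[%classic setT f)// tonelli_rect2//.
have e : (\int[mu]_t \int[mu]_(h in `]0%R, +oo[) f (h, t) =
    \int[mu]_(t in `]0%R, +oo[) \int[mu]_(h in `]0%R, +oo[) f (h, t))%E.
  rewrite [RHS]integral_mkcond; apply: eq_integral => t _; rewrite patchE.
  case: ifPn => //; rewrite notin_setE /= in_itv /= andbT => /negP/negbTE t0.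
  by apply: integral0_eq => h _; rewrite /f /k /= t0 mulr0.
rewrite e -ge0_integralZl//; first last.
- by rewrite lee_fin invr_ge0 ltW.
- by move=> t _; nneg.
- apply: measurable_funTS; apply/measurable_EFinP; apply: measurable_funM.
    exact: measurable_powR.
  by apply: measurable_funX; apply: (measurableT_comp mW); exact: pair1_measurable.
apply: ge0_le_integral => //.
- by move=> t _; apply: integral_ge0.
- by apply: measurable_funTS; apply: (@measurable_slice_y _ `]0, +oo[%classic f).
- apply: measurable_funTS; apply/measurable_EFinP; apply: measurable_funM => //.
  apply: measurable_funM; first exact: measurable_powR.
  by apply: measurable_funX; apply: (measurableT_comp mW); exact: pair1_measurable.
move=> t /=; rewrite in_itv /= andbT => t0.
set c := t `^ (1 - s) * W (x, t) ^+ 2.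
have c0 : 0 <= c by rewrite /c; nneg.
apply: (@le_trans _ _ (\int[mu]_(h in `[t, +oo[) (c%:E * (h `^ (- s - 1))%:E))%E).
  rewrite integral_mkcond [leRHS]integral_mkcond; apply: ge0_le_integral => //.
  - by move=> h _; apply: erestrict_ge0.
  - apply/(measurable_restrictT _ _).1 => //; apply: measurable_funTS.
    by apply: (measurableT_comp mf); exact: pair2_measurable.
  - apply/(measurable_restrictT _ _).1; first exact: measurable_itv.
    apply: emeasurable_funM => //; apply: measurable_funTS; apply/measurable_EFinP.
    exact: measurable_powR.
  - move=> h _; rewrite !patchE /f /k /= t0 /=; case: ifPn => //; last first.
      by move=> _; case: ifP => // _; nneg.
    rewrite inE /= in_itv /= andbT => h0; case: (ltP t h) => th.
      rewrite mem_set; last by rewrite /= in_itv /= andbT ltW.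
      by rewrite -EFinM lee_fin mulrC.
    by rewrite mulr0; case: ifP => // _; nneg.
rewrite ge0_integralZl//; try first [by move=> *; nneg
  | by apply: measurable_funTS; apply/measurable_EFinP; exact: measurable_powR].
rewrite ge0_integral_pow_nearoo// -EFinM lee_fin /c le_eqVlt; apply/orP; left; apply/eqP.
rewrite (_ : 1 - 2 * s = 1 - s + - s); last by ring.
by rewrite (@powRD _ t (1 - s) (- s)) ?(gt_eqF t0) ?implybT//; ring.
Qed.

(** Exchange the order of integration: at height h a point t is at distance at most h
    of a set of x of measure 2 h, and 2 h h^(-2s) = 2 h^(1-2s). *)
Lemma integral_hor_term (W : R * R -> R) : measurable_fun setT W ->
  (\int[mu]_x \int[mu]_(h in `]0%R, +oo[) hor_term W (x, h) <=
   2%:E * \int[mu]_(h in `]0%R, +oo[) \int[mu]_t (h `^ (1 - 2 * s) * W (t, h) ^+ 2)%:E)%E.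
Proof.
move=> mW; have mh := measurable_hor_term mW.
have moo : measurable (`]0, +oo[%classic : set R) by exact: measurable_itv.
have h0 := @hor_term_ge0 W.
rewrite -(@tonelli_rect1 _ setT `]0, +oo[%classic (hor_term W))// tonelli_rect2//.
pose q (p : R * R) : \bar R := (p.2 `^ (1 - 2 * s) * W p ^+ 2)%:E.
have q0 p : (0 <= q p)%E by rewrite /q; nneg.
have mq : measurable_fun setT q.
  apply/measurable_EFinP; apply: measurable_funM; last exact: measurable_funX.
  exact: (measurable_snd_comp (measurable_powR _)).
have mqS : measurable_fun setT (fun h => \int[mu]_t q (t, h))%E.
  exact: (@measurable_slice_y _ setT q).
rewrite -ge0_integralZl//; first last.
- by move=> h _; apply: integral_ge0 => t _; nneg.
- exact: measurable_funTS.
apply: ge0_le_integral => //.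
- by move=> h _; apply: integral_ge0 => x _; exact: h0.
- by apply: measurable_funTS; apply: (@measurable_slice_y _ setT (hor_term W)).
- by apply: measurable_funTS; exact: (emeasurable_funM (measurable_cst _) mqS).
move=> h /=; rewrite in_itv /= andbT => hp.
pose k (p : R * R) : R := h `^ (- (2 * s)) * if `|p.2 - p.1| <= h then W (p.2, h) ^+ 2 else 0.
have k0 p : 0 <= k p by rewrite /k mulr_ge0 ?powR_ge0//; case: ifP => // _; nneg.
have mk : measurable_fun setT k.
  apply: measurable_funM => //.
  have mx : measurable_fun setT (fun p : R * R => ((p.1, h), p.2)).
    by apply: measurable_fun_pair => //; apply: measurable_fun_pair.
  exact: (measurableT_comp (measurable_hor_kernel mW) mx).
have kE x : (hor_term W (x, h) = \int[mu]_t (k (x, t))%:E)%E.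
  have mi : measurable_fun setT (fun t : R => (if `|t - x| <= h then W (t, h) ^+ 2 else 0)%:E).
    have mx : measurable_fun setT (fun t : R => ((x, h), t)).
      by apply: measurable_fun_pair.
    by apply/measurable_EFinP; exact: (measurableT_comp (measurable_hor_kernel mW) mx).
  rewrite /hor_term -(@ge0_integralZl _ _ _ mu _ measurableT _ mi)//.
    by move=> t _; case: ifP => // _; nneg.
  by nneg.
under eq_integral do rewrite kE.
have mkE : measurable_fun setT (EFin \o k) by exact/measurable_EFinP.
have kE0 p : (0 <= (EFin \o k) p)%E by rewrite lee_fin.
rewrite -(@tonelli_rect1 _ setT setT (EFin \o k))// tonelli_rect2//.
have mqh : measurable_fun setT (fun x => q (x, h)).
  by apply: (measurableT_comp mq); exact: pair2_measurable.
rewrite -(@ge0_integralZl _ _ _ mu _ measurableT _ mqh)//.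
apply: ge0_le_integral => //.
- by move=> t _; exact: integral_ge0.
- exact: (@measurable_slice_y _ setT (EFin \o k)).
- exact: (emeasurable_funM (measurable_cst _) mqh).
move=> t _; set c := h `^ (- (2 * s)) * W (t, h) ^+ 2.
have c0 : 0 <= c by rewrite /c; nneg.
have -> : (\int[mu]_x (EFin \o k) (x, t) = \int[mu]_(x in `[(t - h)%R, (t + h)%R]) c%:E)%E.
  rewrite -(@ge0_integral_if `[(t - h)%R, (t + h)%R]%classic (fun x => `|t - x| <= h)); last 2 first.
  - exact: measurable_itv.
  - by move=> x; rewrite ler_distlC /= in_itv.
  by apply: eq_integral => x _; rewrite /k /=; case: ifP => // _; rewrite mulr0.
rewrite integral_cst; last exact: measurable_itv.
have mi : (mu `[(t - h)%R, (t + h)%R]%classic = (h + h)%:E)%E.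
  rewrite lebesgue_measure_itv /= lte_fin ifT; last by rewrite ltrBlDr -addrA ltrDl addr_gt0.
  by rewrite -EFinB; congr EFin; ring.
rewrite [X in (_ * X <= _)%E]mi /q -!EFinM lee_fin /c le_eqVlt; apply/orP; left; apply/eqP.
rewrite (@powRD _ h 1 (- (2 * s))) ?(gt_eqF hp) ?implybT// powRr1 ?(ltW hp)//=; ring.
Qed.

Lemma integral_distance_le (Phi : R * R -> \bar R) : measurable_fun setT Phi ->
  (forall p, 0 <= Phi p)%E ->
  (\int[mu]_(x in cell) \int[mu]_(z in cell) Phi (polar_shear (x, z)) <=
   2%:E * \int[mu]_(x in cell) \int[mu]_(h in `]0%R, +oo[) Phi (x, h))%E.
Proof.
move=> mP P0; have moo : measurable (`]0, +oo[%classic : set R) by exact: measurable_itv.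
have mS : measurable_fun setT (fun x => \int[mu]_(h in `]0%R, +oo[) Phi (x, h))%E.
  exact: (@measurable_slice_x _ `]0, +oo[%classic Phi).
have mPs : measurable_fun setT (Phi \o polar_shear).
  exact: (measurableT_comp mP measurable_polar_shear).
rewrite -ge0_integralZl//; first last.
- by move=> x _; exact: integral_ge0.
- exact: measurable_funTS.
- exact: measurable_cell.
apply: ge0_le_integral => //.
- exact: measurable_cell.
- by move=> x _; exact: integral_ge0.
- by apply: measurable_funTS; apply: (@measurable_slice_x _ cell (Phi \o polar_shear)); [exact: measurable_cell|exact: mPs|move=> p; exact: P0].
- by apply: measurable_funTS; exact: (emeasurable_funM (measurable_cst _) mS).
move=> x _; have mx : measurable_fun setT (fun h => Phi (x, h)).
  by apply: (measurableT_comp mP); exact: pair1_measurable.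
apply: le_trans (ge0_integral_dist_le x mx _) => //.
apply: ge0_subset_integral => //; first exact: measurable_cell.
by apply: (measurableT_comp mPs); exact: pair1_measurable.
Qed.

(** Convexity of the square; the terms on the right may be infinite. *)
Lemma sq_sum3_le (r : R) (a b c : \bar R) : 0 <= r -> (0 <= a)%E -> (0 <= b)%E -> (0 <= c)%E ->
  (r%:E <= a + b + c)%E -> ((r ^+ 2)%:E <= 3%:E * (a * a + b * b + c * c))%E.
Proof.
move=> r0; have oo3 : (3%:E * +oo = +oo :> \bar R)%E by rewrite gt0_muley// lte_fin.
case: a => [a||]//; case: b => [b||]//; case: c => [c||]//;
  rewrite ?lee_fin => a0 b0 c0 h; rewrite ?mulyy; last first;
  try by rewrite ?addey ?addye ?oo3 ?leey//.
have h2 : r ^+ 2 <= (a + b + c) ^+ 2 by rewrite lerXn2r// ?nnegrE// !addr_ge0.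
apply: le_trans h2 _; rewrite -subr_ge0.
have -> : 3 * (a * a + b * b + c * c) - (a + b + c) ^+ 2 = (a - b) ^+ 2 + (b - c) ^+ 2 + (a - c) ^+ 2.
  ring.
by rewrite !addr_ge0 ?sqr_ge0.
Qed.

End gagliardo_kernels.

Section trace_estimates.
Context {R : realType} (s T : R) (hs : 0 < s < 1) (hT : 0 < T).
Local Notation mu := (@lebesgue_measure R).
Local Notation mu2 := (mu \x mu)%E.
Local Notation cell := (period_cell T).

Let s0 : 0 < s. Proof. by case/andP: hs. Qed.
Let s1 : s < 1. Proof. by case/andP: hs. Qed.
Let s20 : 0 < 2 * s. Proof. by rewrite mulr_gt0. Qed.
Let moo : measurable (`]0, +oo[%classic : set R). Proof. exact: measurable_itv. Qed.

Lemma measurable_patch_hs (W : R * R -> R) : measurable_fun (half_plane R) W ->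
  measurable_fun setT (W \_ (half_strip T)).
Proof.
move=> mW; apply/(measurable_restrictT _ _).1; first exact: measurable_half_strip.
apply: measurable_funS mW; [exact: measurable_half_plane|exact: half_strip_half_plane].
Qed.

Lemma energy1_patch (W : R * R -> R) : energy1 s T W = energy1 s T (W \_ (half_strip T)).
Proof. by apply: eq_integral => p ps; rewrite patchE ps. Qed.

Lemma energy1_x (W : R * R -> R) : measurable_fun (half_plane R) W ->
  energy1 s T W = (\int[mu]_(x in cell) \int[mu]_(t in `]0%R, +oo[)
    (t `^ (1 - 2 * s) * (W \_ (half_strip T)) (x, t) ^+ 2)%:E)%E.
Proof.
move=> mW; rewrite energy1_patch /energy1 half_stripE tonelli_rect1//.
- exact: measurable_cell.
- apply/measurable_EFinP; apply: measurable_funM; first exact: measurable_wt.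
  by apply: measurable_funX; rewrite -half_stripE; exact: measurable_patch_hs.
- by move=> p; nneg.
Qed.

Lemma energy1_y (W : R * R -> R) : measurable_fun (half_plane R) W ->
  energy1 s T W = (\int[mu]_(h in `]0%R, +oo[) \int[mu]_t
    (h `^ (1 - 2 * s) * (W \_ (half_strip T)) (t, h) ^+ 2)%:E)%E.
Proof.
move=> mW; pose f p : \bar R := (wt s p * (W \_ (half_strip T)) p ^+ 2)%:E.
have mf : measurable_fun setT f.
  apply/measurable_EFinP; apply: measurable_funM; first exact: measurable_wt.
  by apply: measurable_funX; exact: measurable_patch_hs.
have f0 p : (0 <= f p)%E by rewrite /f; nneg.
rewrite energy1_patch /energy1 -/f [X in integral _ X _]half_stripE.
rewrite [LHS](@tonelli_rect2 _ cell `]0, +oo[%classic f (measurable_cell T) moo mf f0).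
apply: eq_integral => h _; rewrite [LHS]integral_mkcond; apply: eq_integral => t _.
rewrite patchE; case: ifPn => //; rewrite notin_setE => nt.
rewrite patchE memNset ?expr0n/= ?mulr0// => -[/= ct _]; exact: nt.
Qed.

(** Cauchy-Schwarz with the weight t^(1-p), whose reciprocal t^(p-1) has integral
    y^p / p. Two exponents are used: p = 2 s produces the weight of the energy, while
    p = s leaves the spare power of h that makes the seminorm estimate converge. *)
Lemma vertical_square_le (p y : R) (g : R -> R) : 0 < p -> 0 < y -> measurable_fun setT g ->
  ((\int[mu]_(t in `]0%R, y[) `|g t|%:E) * (\int[mu]_(t in `]0%R, y[) `|g t|%:E) <=
   (y `^ p / p)%:E * \int[mu]_(t in `]0%R, y[) (t `^ (1 - p) * g t ^+ 2)%:E)%E.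
Proof.
move=> p0 y0 mg; apply: (@weighted_cauchy_schwarz _ _ _ mu _ _ (y `^ p / p) (fun t => t `^ (1 - p))).
- exact: measurable_itv.
- by apply: measurable_funTS; exact: measurable_powR.
- exact: measurable_funTS.
- by move=> t /=; rewrite in_itv /= => /andP[t0 _]; exact: powR_gt0.
- by rewrite divr_gt0// powR_gt0.
have -> : (fun t : R => ((t `^ (1 - p))^-1)%:E) = (fun t => (t `^ (p - 1))%:E).
  by apply/funext => t; rewrite -powRN opprB.
apply: le_trans (ge0_integral_pow_near0 p0 y0); apply: ge0_subset_integral => //; try exact: measurable_itv.
- by apply: measurable_funTS; apply/measurable_EFinP; exact: measurable_powR.
- by move=> t _; nneg.
- by move=> t /=; rewrite !in_itv /= => /andP[-> /ltW].
Qed.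

Section one_function.
Variable U : HT s T.
Local Notation u := (ht_trace U).
Local Notation w1 := (ht_dx U \_ (half_strip T)).
Local Notation w2 := (ht_dy U \_ (half_strip T)).
Local Notation E := (energy s T (ht_dx U) (ht_dy U)).

Let mw1 : measurable_fun setT w1.
Proof. exact: measurable_patch_hs (measurable_ht_dx U). Qed.
Let mw2 : measurable_fun setT w2.
Proof. exact: measurable_patch_hs (measurable_ht_dy U). Qed.

Lemma vertical_oscillation_patch : {ae mu2, forall p, half_strip T p ->
  (`|ht_fun U p - u p.1|%:E <= \int[mu]_(t in `]0%R, p.2[) `|w2 (p.1, t)|%:E)%E}.
Proof.
apply: (ae_impl (vertical_oscillation hs hT U)) => p + hp => /(_ hp) /le_trans; apply.
rewrite le_eqVlt; apply/orP; left; apply/eqP; apply: eq_integral => t.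
rewrite inE /= in_itv /= => /andP[t0 _].
by rewrite /extend0 /= t0 patchE mem_set//; split => //; case: hp.
Qed.

(** The vertical oscillation is squared with [vertical_square_le] for p = 2 s, so that
    the energy itself appears on the right. *)
Lemma trace_slice_bound : {ae mu, forall y, 0 < y ->
  (\int[mu]_(x in cell) ((ht_fun U (x, y) - u x) ^+ 2)%:E <=
   (y `^ (2 * s) / (2 * s))%:E * energy1 s T (ht_dy U))%E}.
Proof.
apply: (ae_impl (ae_slice2 vertical_oscillation_patch)) => y hy y0.
have c0 : (0 <= (y `^ (2 * s) / (2 * s))%:E)%E.
  by rewrite lee_fin divr_ge0 ?powR_ge0// ltW.
pose q (p : R * R) : \bar R := (p.2 `^ (1 - 2 * s) * w2 p ^+ 2)%:E.
have q0 p : (0 <= q p)%E by rewrite /q; nneg.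
have mq : measurable_fun setT q.
  apply/measurable_EFinP; apply: measurable_funM; last exact: measurable_funX.
  exact: (measurable_snd_comp (measurable_powR _)).
have mqS : measurable_fun setT (fun x => \int[mu]_(t in `]0%R, +oo[) q (x, t))%E.
  exact: (@measurable_slice_x _ `]0, +oo[%classic q).
rewrite energy1_x; last exact: measurable_ht_dy.
rewrite -(@ge0_integralZl _ _ _ mu _ (measurable_cell T) _ (measurable_funTS mqS))//; last first.
  by move=> x _; apply: integral_ge0 => t _; exact: q0.
apply: ae_ge0_le_integral.
- exact: measurable_cell.
- by move=> x _; nneg.
- apply/measurable_EFinP; apply: measurable_funX; apply: measurable_funB; last first.
    by apply: measurable_funTS; exact: measurable_trace.
  by apply: measurable_funTS; exact: measurable_slice_half_plane (measurable_ht_fun U) y0.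
- by move=> x _; apply: mule_ge0 => //; apply: integral_ge0 => t _; exact: q0.
- by apply: measurable_funTS; exact: (emeasurable_funM (measurable_cst _) mqS).
apply: (ae_impl hy) => x hx xc.
have /hx {hx} /= hx : half_strip T (x, y) by [].
have mwx : measurable_fun setT (fun t => w2 (x, t)).
  by apply: (measurableT_comp mw2); exact: pair1_measurable.
have h := vertical_square_le s20 y0 mwx.
rewrite -real_normK ?num_real// EFinM.
apply: le_trans (lee_pmul _ _ hx hx) _; rewrite ?lee_fin//.
apply: le_trans h _; apply: lee_wpmul2l => //.
have mqx : measurable_fun setT (fun t => q (x, t)).
  by apply: (measurableT_comp mq); exact: pair1_measurable.
apply: ge0_subset_integral => //; try exact: measurable_itv.
- exact: measurable_funTS mqx.
- by move=> t _; nneg.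
- by move=> t /=; rewrite !in_itv /= andbT => /andP[].
Qed.

(** The height T + 1 exceeds every distance |x - z| between two points of a period,
    hence the height of every path considered in [trace_difference_le]. *)
Lemma horizontal_lines : exists2 c : R -> R, measurable_fun setT c &
  {ae mu2, forall p, - (T / 2) < p.1 < T / 2 -> 0 < p.2 < T + 1 ->
    ht_fun U p = c p.2 + \int[mu]_(t in `]- (T / 2), p.1[) (ht_dx U \_ (strip T (T + 1))) (t, p.2)}.
Proof.
have r0 : 0 < T + 1 by rewrite addr_gt0.
have [||||c mc hc] := @weak_derivative_columns _ (- (T / 2)) (T / 2) 0 (T + 1)
    (ht_fun U \_ (strip T (T + 1))) (ht_dx U \_ (strip T (T + 1))).
- by rewrite gtrN// divr_gt0.
- by apply: integrable_patch; [exact: measurable_strip|exact: integrable_fun].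
- by apply: integrable_patch; [exact: measurable_strip|exact: integrable_dx].
- by move=> g h tg th; exact: weak_dx_strip.
exists c => //; apply: (ae_impl hc) => p hp p1 p2.
by rewrite -(hp p1 p2) patchE mem_set//; exact: strip_open.
Qed.

(** The two primitives differ only by integrals over points between x and z, all of
    which lie within |x - z| of x. *)
Lemma primitive_difference_le (w : R -> R) (a x z : R) : mu.-integrable setT (EFin \o w) ->
  (`|\int[mu]_(t in `]a, x[) w t - \int[mu]_(t in `]a, z[) w t|%:E <=
   \int[mu]_t (if `|t - x| <= `|x - z| then `|w t| else 0)%R%:E)%E.
Proof.
move=> wi; have mw : measurable_fun setT w by move/measurable_int : wi => /measurable_EFinP.
have pi (b : R) : mu.-integrable setT (EFin \o (w \_ `]a, b[)).
  have mD : measurable (`]a, b[%classic : set R) by exact: measurable_itv.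
  rewrite -restrict_EFin; apply: (@integrable_mkcond _ _ _ mu _ (EFin \o w) mD).1.
  by apply: integrableS wi.
rewrite (Rintegral_mkcond mu `]a, x[%classic w) (Rintegral_mkcond mu `]a, z[%classic w) -RintegralB//.
have mB : measurable_fun setT (fun t => (w \_ `]a, x[) t - (w \_ `]a, z[) t).
  by apply: measurable_funB; apply/(measurable_restrictT _ _).1;
    [exact: measurable_itv|exact: measurable_funTS|exact: measurable_itv|exact: measurable_funTS].
apply: le_trans (abs_Rintegral_le measurableT mB) _.
apply: ge0_le_integral => //.
- by apply/measurable_EFinP; apply: measurableT_comp.
- apply/measurable_EFinP; apply: measurable_fun_ifT => //; last exact: measurableT_comp.
  by apply: measurable_fun_ler => //; apply: measurableT_comp => //; apply: measurable_funB.
move=> t _; rewrite !patchE lee_fin (_ : point = 0 :> R)//.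
have [_|nt] := boolP (`|t - x| <= `|x - z|).
  by do 2 case: (_ \in _); rewrite ?subrr ?subr0 ?sub0r ?normrN ?normr0.
suff -> : (t \in `]a, x[%classic) = (t \in `]a, z[%classic) by case: ifP; rewrite subrr normr0.
move: nt; rewrite -ltNge => nt.
apply/idP/idP; rewrite !inE /= !in_itv /= => /andP[-> /= h].
- rewrite ltNge; apply/negP => zt; move: nt; rewrite ltNge => /negP; apply.
  by rewrite ltr0_norm ?subr_lt0// opprB ger0_norm; lra.
- rewrite ltNge; apply/negP => xt; move: nt; rewrite ltNge => /negP; apply.
  by rewrite ger0_norm ?subr_ge0// ltr0_norm; lra.
Qed.

(** The path from (x,0) to (z,0) through (x,h) and (z,h), with h = |x - z|. The sides
    are good for almost all pairs (x,z) because the maps that send (x,z) to (x,h) and to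
    (z,h) pull null sets back to null sets ([ae_polar_shear]). *)
Lemma trace_difference_le : {ae mu2, forall p, cell p.1 -> cell p.2 ->
  (`|u p.1 - u p.2|%R%:E <=
   \int[mu]_(t in `]0%R, (`|p.1 - p.2|)%R[) `|w2 (p.1, t)|%:E
   + \int[mu]_t (if `|t - p.1| <= `|p.1 - p.2| then `|w1 (t, `|p.1 - p.2|)| else 0)%R%:E
   + \int[mu]_(t in `]0%R, (`|p.1 - p.2|)%R[) `|w2 (p.2, t)|%:E)%E}.
Proof.
set r := T + 1; have r0 : 0 < r by rewrite addr_gt0.
have [c mc hc] := horizontal_lines.
have wi : mu2.-integrable setT (EFin \o (ht_dx U \_ (strip T r))).
  by apply: integrable_patch; [exact: measurable_strip|exact: integrable_dx].
have swp := @ae_plane_preserving R swap _ (@measurable_swap R) (@ge0_integral_swap R).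
have v1 := ae_polar_shear vertical_oscillation_patch.
have c1 := ae_polar_shear hc.
have i1 := ae_polar_shear (ae_snd (ae_integrable_y wi)).
have o1 := ae_fst (ae_open_cell T).
have ne : {ae mu2, forall p : R * R, p.1 != p.2}.
  apply: ae_of_slice2.
    have me : measurable_fun setT (fun p : R * R => p.1 == p.2) by exact: measurable_fun_eqr.
    rewrite (_ : [set p | _] = setT `&` (fun p : R * R => p.1 == p.2) @^-1` [set true]).
      exact: me.
    by rewrite setTI; apply/seteqP; split => p /=; rewrite /preimage /=; case: eqP => // ? /(_ isT).
  by apply: nearW => y; exact: ae_neq.
have v2 := swp _ v1; have c2 := swp _ c1; have o2 := swp _ o1.
apply: (ae_impl (ae_conj (ae_conj (ae_conj v1 v2) (ae_conj c1 c2)) (ae_conj (ae_conj o1 o2) (ae_conj ne i1)))).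
rewrite /swap /polar_shear => -[x z] /= [[[{}v1 {}v2] [{}c1 {}c2]] [[{}o1 {}o2] [{}ne {}i1]]] xc zc.
rewrite [`|z - x|]distrC in v2 c2.
set h := `|x - z| in v1 v2 c1 c2 i1 *.
have h0 : 0 < h by rewrite normr_gt0 subr_eq0.
have hr : 0 < h < r.
  rewrite h0 /=; apply: (@le_lt_trans _ _ T); last by rewrite ltrDl.
  move: xc zc; rewrite /h /period_cell /= !in_itv /= => /andP[x1 x2] /andP[z1 z2].
  by rewrite ler_norml; apply/andP; split; lra.
have {}v1 := v1 (conj xc h0); have {}v2 := v2 (conj zc h0).
have {}c1 := c1 (o1 xc) hr; have {}c2 := c2 (o2 zc) hr.
have hH := primitive_difference_le (- (T / 2)) x z i1.
rewrite (_ : u x - u z = (u x - ht_fun U (x, h)) + (ht_fun U (x, h) - ht_fun U (z, h))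
   + (ht_fun U (z, h) - u z)); last by ring.
apply: (@le_trans _ _ (`|u x - ht_fun U (x, h)|%:E + `|ht_fun U (x, h) - ht_fun U (z, h)|%:E
   + `|ht_fun U (z, h) - u z|%:E)%E).
  rewrite -!EFinD lee_fin; apply: le_trans (ler_normD _ _) _.
  by rewrite lerD2r; exact: ler_normD.
apply: leeD => //; apply: leeD; first by rewrite distrC.
rewrite c1 c2 (_ : forall a b d : R, a + b - (a + d) = b - d); last by move=> *; ring.
apply: le_trans hH _; rewrite le_eqVlt; apply/orP; left; apply/eqP.
apply: eq_integral => t _; case: ifP => // _; congr (`|_|%:E); rewrite !patchE.
suff -> : ((t, h) \in strip T r) = ((t, h) \in half_strip T) by [].
apply/idP/idP; rewrite !inE => -[/= tc _]; split => //=.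
by rewrite in_itv /= h0; case/andP: hr => _ /ltW.
Qed.

Lemma pow_div_le (h : R) : 0 < h ->
  (h `^ s / s) * (h `^ (1 + 2 * s))^-1 = s^-1 * h `^ (- s - 1).
Proof.
move=> h0; rewrite -powRN mulrAC -powRD ?(gt_eqF h0) ?implybT// mulrC.
by congr (_ * h `^ _); ring.
Qed.

Lemma pow_div_le2 (h : R) : 0 < h ->
  (h + h) * (h `^ (1 + 2 * s))^-1 = 2 * h `^ (- (2 * s)).
Proof.
move=> h0; have -> : h + h = 2 * h `^ 1 by rewrite powRr1 ?(ltW h0)// mulr_natl mulr2n.
rewrite -powRN -mulrA; by rewrite -powRD ?(gt_eqF h0) ?implybT//; congr (_ * h `^ _); ring.
Qed.

Lemma gagliardo_pointwise : {ae mu2, forall p, cell p.1 -> cell p.2 ->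
  ((`|u p.1 - u p.2| ^+ 2 / `|p.1 - p.2| `^ (1 + 2 * s))%:E <=
   3%:E * (s^-1%:E * vert_term s w2 (polar_shear p) + 2%:E * hor_term s w1 (polar_shear p)
           + s^-1%:E * vert_term s w2 (polar_shear (swap p))))%E}.
Proof.
apply: (ae_impl trace_difference_le) => -[x z] /= hp xc zc.
have {hp} := hp xc zc; rewrite /polar_shear /= [`|z - x|]distrC.
have [->|xz] := eqVneq x z.
  move=> _; rewrite subrr normr0 expr0n mul0r.
  have vt p : (0 <= s^-1%:E * vert_term s w2 p)%E.
    by rewrite mule_ge0 ?vert_term_ge0// lee_fin invr_ge0 ltW.
  have ht p : (0 <= 2%:E * hor_term s w1 p)%E by rewrite mule_ge0 ?hor_term_ge0.
  by rewrite mule_ge0// adde_ge0// adde_ge0.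
set h := `|x - z|; have h0 : 0 < h by rewrite normr_gt0 subr_eq0.
set V1 := integral _ _ _; set H := integral _ _ _; set V2 := integral _ _ _.
have V10 : (0 <= V1)%E by apply: integral_ge0 => t _; nneg.
have V20 : (0 <= V2)%E by apply: integral_ge0 => t _; nneg.
have H0 : (0 <= H)%E by apply: integral_ge0 => t _; case: ifP => // _; nneg.
move=> /(sq_sum3_le (normr_ge0 _) V10 H0 V20) hsq.
set k := (h `^ (1 + 2 * s))^-1; have k0 : 0 <= k by rewrite /k; nneg.
have kE : (0 <= k%:E)%E by rewrite lee_fin.
rewrite EFinM; apply: le_trans (lee_wpmul2r kE hsq) _.
rewrite -muleA; apply: lee_wpmul2l => //.
rewrite ge0_muleDl ?adde_ge0 ?mule_ge0// ge0_muleDl ?mule_ge0//.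
have vert (y : R) :
    ((\int[mu]_(t in `]0%R, h[) `|w2 (y, t)|%:E) * (\int[mu]_(t in `]0%R, h[) `|w2 (y, t)|%:E) * k%:E <=
     s^-1%:E * vert_term s w2 (y, h))%E.
  have my : measurable_fun setT (fun t => w2 (y, t)).
    by apply: (measurableT_comp mw2); exact: pair1_measurable.
  apply: le_trans (lee_wpmul2r kE (vertical_square_le s0 h0 my)) _.
  rewrite /vert_term /= muleAC -EFinM pow_div_le// EFinM -muleA.
  apply: lee_wpmul2l; first by rewrite lee_fin invr_ge0 ltW.
  apply: lee_wpmul2l; first by nneg.
  rewrite -(@ge0_integral_if _ `]0, h[%classic (fun t => (0 < t) && (t < h)))//.
  rewrite le_eqVlt; apply/orP; left; apply/eqP; apply: eq_integral => t _.
  by case: ifP.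
apply: leeD; last exact: vert.
apply: leeD; first exact: vert.
have mh : measurable_fun setT (fun t => w1 (t, h)).
  by apply: (measurableT_comp mw1); exact: pair2_measurable.
pose D := `[x - h, x + h]%classic : set R.
have mD : measurable D by exact: measurable_itv.
have hD t : `|t - x| <= h <-> D t by rewrite distrC ler_distlC /D /= in_itv.
have HE : H = (\int[mu]_(t in D) `|w1 (t, h)|%:E)%E.
  rewrite -(ge0_integral_if _ mD hD); apply: eq_integral => t _.
  by case: ifP.
have hh0 : 0 < h + h by rewrite addr_gt0.
have cs : (H * H <= (h + h)%:E * \int[mu]_(t in D) (1 * w1 (t, h) ^+ 2)%:E)%E.
  rewrite HE; apply: (@weighted_cauchy_schwarz _ _ _ mu D mD (h + h) (fun=> 1)) => //.
    exact: measurable_funTS.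
  rewrite invr1 integral_cst// mul1e /D.
  have mi : mu `[x - h, x + h]%classic = (h + h)%:E.
    rewrite lebesgue_measure_itv /= lte_fin ifT; last by rewrite ltrBlDr -addrA ltrDl.
    by rewrite -EFinB; congr EFin; ring.
  by rewrite le_eqVlt; apply/orP; left; apply/eqP; exact: mi.
apply: le_trans (lee_wpmul2r kE cs) _.
rewrite /hor_term /= muleAC -EFinM pow_div_le2// EFinM -muleA.
apply: lee_wpmul2l => //; apply: lee_wpmul2l; first by nneg.
rewrite -(ge0_integral_if _ mD hD) le_eqVlt; apply/orP; left; apply/eqP.
by apply: eq_integral => t _; case: ifP => //; rewrite mul1r.
Qed.

(** Integrating [gagliardo_pointwise], each of the two vertical terms contributes
    2 E2 / s^2 and the horizontal one 8 E1, where E1 and E2 are the energies of the two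
    partial derivatives and the factors 2 come from [integral_distance_le]; the total
    3 (4 E2 / s^2 + 8 E1) is at most 24 (E1 + E2) / s^2 since s < 1. *)
Lemma gagliardo_le :
  (\int[mu]_(x in cell) \int[mu]_(z in cell)
     (`|u x - u z| ^+ 2 / `|x - z| `^ (1 + 2 * s))%:E <= (24 / s ^+ 2)%:E * E)%E.
Proof.
have mC := measurable_cell T.
pose A (p : R * R) : \bar R := (`|u p.1 - u p.2| ^+ 2 / `|p.1 - p.2| `^ (1 + 2 * s))%:E.
have A0 p : (0 <= A p)%E by rewrite /A; nneg.
have mA : measurable_fun setT A.
  apply/measurable_EFinP; apply: measurable_funM.
    apply: measurable_funX; apply: measurableT_comp => //; apply: measurable_funB.
      exact: (measurable_fst_comp (measurable_trace U)).
    exact: (measurable_snd_comp (measurable_trace U)).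
  have -> : (fun p : R * R => (`|p.1 - p.2| `^ (1 + 2 * s))^-1) =
      (fun p => `|p.1 - p.2| `^ (- (1 + 2 * s))) by apply/funext => p; rewrite -powRN.
  apply: (measurableT_comp (measurable_powR _)); apply: measurableT_comp => //.
  by apply: measurable_funB.
pose P p := (s^-1%:E * vert_term s w2 p)%E; pose Q p := (2%:E * hor_term s w1 p)%E.
have sV : 0 <= s^-1 by rewrite invr_ge0 ltW.
have P0 p : (0 <= P p)%E by rewrite /P mule_ge0 ?vert_term_ge0// lee_fin.
have Q0 p : (0 <= Q p)%E by rewrite /Q mule_ge0 ?hor_term_ge0.
have mP : measurable_fun setT P.
  exact: (emeasurable_funM (measurable_cst _) (measurable_vert_term s mw2)).
have mQ : measurable_fun setT Q.
  exact: (emeasurable_funM (measurable_cst _) (measurable_hor_term s mw1)).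
have mPs : measurable_fun setT (P \o @polar_shear R).
  exact: (measurableT_comp mP (@measurable_polar_shear R)).
have mQs : measurable_fun setT (Q \o @polar_shear R).
  exact: (measurableT_comp mQ (@measurable_polar_shear R)).
have mPw : measurable_fun setT (P \o @polar_shear R \o @swap R).
  exact: (measurableT_comp mPs (@measurable_swap R)).
have m1 : measurable_fun setT (fun p => P (polar_shear p) + Q (polar_shear p))%E.
  exact: (emeasurable_funD mPs mQs).
have m2 : measurable_fun setT (fun p => P (polar_shear p) + Q (polar_shear p) + P (polar_shear (swap p)))%E.
  exact: (emeasurable_funD m1 mPw).
have mCC : measurable (cell `*` cell : set (R * R)) by exact: measurableX.
rewrite -[leLHS](@tonelli_rect1 _ cell cell A)//.
apply: (@le_trans _ _ (\int[mu2]_(p in cell `*` cell)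
    (3%:E * (P (polar_shear p) + Q (polar_shear p) + P (polar_shear (swap p)))))%E).
  apply: ae_ge0_le_integral => //.
  - exact: measurable_funTS.
  - by move=> p _; rewrite mule_ge0// !adde_ge0.
  - by apply: measurable_funTS; exact: (emeasurable_funM (measurable_cst _) m2).
  - by apply: (ae_impl gagliardo_pointwise) => p hp [p1 p2]; exact: hp.
rewrite (@ge0_integralZl _ _ _ mu2 _ mCC _ (measurable_funTS m2))//; last first.
  by move=> p _; rewrite !adde_ge0.
rewrite (@ge0_integralD _ _ _ mu2 _ mCC _ _ _ (measurable_funTS m1) _ (measurable_funTS mPw))//; try first [by move=> p _; exact: P0 | by move=> p _; rewrite adde_ge0].
rewrite (@ge0_integralD _ _ _ mu2 _ mCC _ _ _ (measurable_funTS mPs) _ (measurable_funTS mQs))//; try first [by move=> p _; exact: P0 | by move=> p _; exact: Q0].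
set E1 := energy1 s T (ht_dx U); set E2 := energy1 s T (ht_dy U).
have E10 : (0 <= E1)%E by exact: energy1_ge0.
have E20 : (0 <= E2)%E by exact: energy1_ge0.
have bP : (\int[mu]_(x in cell) \int[mu]_(h in `]0%R, +oo[) P (x, h) <= (s^-1 * s^-1)%:E * E2)%E.
  have msx (F : R * R -> \bar R) (mF : measurable_fun setT F) (F0 : forall p, (0 <= F p)%E) :
      measurable_fun cell (fun x => \int[mu]_(h in `]0%R, +oo[) F (x, h))%E.
    by apply: measurable_funTS; apply: (@measurable_slice_x _ `]0, +oo[%classic F).
  have mV := measurable_vert_term s mw2.
  apply: (@le_trans _ _ (\int[mu]_(x in cell) ((s^-1 * s^-1)%:E *
      \int[mu]_(t in `]0%R, +oo[) (t `^ (1 - 2 * s) * w2 (x, t) ^+ 2)%:E))%E).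
    apply: ge0_le_integral => //.
    - by move=> x _; exact: integral_ge0.
    - exact: msx.
    - apply: emeasurable_funM => //.
      apply: (msx (fun p => (p.2 `^ (1 - 2 * s) * w2 p ^+ 2)%:E)).
        apply/measurable_EFinP; apply: measurable_funM; last exact: measurable_funX.
        exact: (measurable_snd_comp (measurable_powR _)).
      by move=> p; nneg.
    move=> x _; rewrite /P ge0_integralZl//; last 2 first.
    - by apply: measurable_funTS; apply: (measurableT_comp mV); exact: pair1_measurable.
    - by move=> h _; exact: vert_term_ge0.
    rewrite EFinM -muleA; apply: lee_wpmul2l; first by rewrite lee_fin.
    exact: integral_vert_term.
  rewrite ge0_integralZl//; first last.
  - by rewrite lee_fin mulr_ge0.
  - by move=> x _; apply: integral_ge0 => t _; nneg.
  - apply: (msx (fun p => (p.2 `^ (1 - 2 * s) * w2 p ^+ 2)%:E)).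
      apply/measurable_EFinP; apply: measurable_funM; last exact: measurable_funX.
      exact: (measurable_snd_comp (measurable_powR _)).
    by move=> p; nneg.
  by rewrite /E2 energy1_x//; exact: measurable_ht_dy.
have bQ : (\int[mu]_(x in cell) \int[mu]_(h in `]0%R, +oo[) Q (x, h) <= 4%:E * E1)%E.
  have mH := measurable_hor_term s mw1.
  have mS : measurable_fun setT (fun x => \int[mu]_(h in `]0%R, +oo[) hor_term s w1 (x, h))%E.
    by apply: (@measurable_slice_x _ `]0, +oo[%classic (hor_term s w1)) => // p; exact: hor_term_ge0.
  have -> : (\int[mu]_(x in cell) \int[mu]_(h in `]0%R, +oo[) Q (x, h) =
      2%:E * \int[mu]_(x in cell) \int[mu]_(h in `]0%R, +oo[) hor_term s w1 (x, h))%E.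
    rewrite -ge0_integralZl//; last 2 first.
    - exact: measurable_funTS.
    - by move=> x _; apply: integral_ge0 => h _; exact: hor_term_ge0.
    apply: eq_integral => x _; rewrite /Q ge0_integralZl//.
    - by apply: measurable_funTS; apply: (measurableT_comp mH); exact: pair1_measurable.
    - by move=> h _; exact: hor_term_ge0.
  rewrite (_ : 4%:E = 2%:E * 2%:E)%E; last by rewrite -EFinM -natrM.
  rewrite -muleA; apply: lee_wpmul2l => //.
  rewrite /E1 energy1_y; last exact: measurable_ht_dx.
  apply: le_trans (integral_hor_term _ mw1); apply: ge0_subset_integral => //.
  by move=> x _; apply: integral_ge0 => h _; exact: hor_term_ge0.
have sP : (\int[mu2]_(p in cell `*` cell) P (polar_shear p) <= 2%:E * ((s^-1 * s^-1)%:E * E2))%E.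
  rewrite (@tonelli_rect1 _ cell cell (P \o @polar_shear R))//.
    by apply: le_trans (integral_distance_le T mP P0) _; apply: lee_wpmul2l.
  by move=> p; exact: P0.
have sQ : (\int[mu2]_(p in cell `*` cell) Q (polar_shear p) <= 2%:E * (4%:E * E1))%E.
  rewrite (@tonelli_rect1 _ cell cell (Q \o @polar_shear R))//.
    by apply: le_trans (integral_distance_le T mQ Q0) _; apply: lee_wpmul2l.
  by move=> p; exact: Q0.
have sPw : (\int[mu2]_(p in cell `*` cell) P (polar_shear (swap p)) <= 2%:E * ((s^-1 * s^-1)%:E * E2))%E.
  rewrite (@tonelli_rect2 _ cell cell (P \o @polar_shear R \o @swap R))//.
    by apply: le_trans (integral_distance_le T mP P0) _; apply: lee_wpmul2l.
  by move=> p; exact: P0.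
apply: le_trans (lee_wpmul2l _ (leeD (leeD sP sQ) sPw)) _ => //.
have Efin : E \is a fin_num by rewrite ge0_fin_numE ?energy_ge0// energy_lty.
have E1f : E1 \is a fin_num.
  by rewrite ge0_fin_numE//; apply: le_lt_trans (energy1_dx_le U) (energy_lty U).
have E2f : E2 \is a fin_num.
  by rewrite ge0_fin_numE//; apply: le_lt_trans (energy1_dy_le U) (energy_lty U).
rewrite (energyE s T (measurable_ht_dx U) (measurable_ht_dy U)) -/E1 -/E2.
rewrite -(fineK E1f) -(fineK E2f) -!EFinM -?EFinD -?EFinM lee_fin.
have e1 : 0 <= fine E1 by rewrite fine_ge0.
have e2 : 0 <= fine E2 by rewrite fine_ge0.
move: (fine E1) (fine E2) e1 e2 => a b a0 b0.
have i1 : 1 <= s^-1 * s^-1 by rewrite -[1]mulr1 ler_pM// invf_ge1// ltW.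
rewrite expr2 invfM; set i := s^-1 * s^-1 in i1 *.
have h1 : a <= i * a by rewrite ler_peMl.
have h2 : 0 <= i * b by rewrite mulr_ge0// (le_trans _ i1).
rewrite -subr_ge0 (_ : _ - _ = 24 * (i * a - a) + 12 * (i * b)); last by ring.
by rewrite addr_ge0// mulr_ge0// subr_ge0.
Qed.

End one_function.

(** The squared distance of the slice U(.,y) to the trace grows at most like y^(2s)
    ([trace_slice_bound]), a growth that the weight e^(-y) makes integrable; the constants
    are values of the Gamma integral. *)
Lemma exp_weight_bound : exists2 C : R, 0 <= C & forall U : HT s T,
  (\int[mu2]_(p in half_strip T) (expR (- p.2) * ht_fun U p ^+ 2)%:E <=
   C%:E * (energy s T (ht_dx U) (ht_dy U) + L2T_sqnorm T (ht_trace U)))%E.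
Proof.
pose g (p : R) := (\int[mu]_(t in `]0%R, +oo[) (t `^ (p - 1) * expR (- t))%:E)%E.
have p1 : 0 < 2 * s + 1 by rewrite addr_gt0.
have g0 p : (0 <= g p)%E by apply: integral_ge0 => t _; nneg.
have gf p : 0 < p -> g p \is a fin_num.
  by move=> p0; rewrite ge0_fin_numE// gamma_integral_lty.
pose C := fine (g (2 * s + 1)) / s + 2 * fine (g 1).
have C1 : 0 <= fine (g (2 * s + 1)) / s by rewrite divr_ge0 ?fine_ge0// ltW.
have C2 : 0 <= 2 * fine (g 1) by rewrite mulr_ge0// fine_ge0.
exists C; first exact: addr_ge0.
move=> U; set u := ht_trace U; set E := energy _ _ _ _; set L := L2T_sqnorm _ _.
have mC := measurable_cell T.
have E0 : (0 <= E)%E by exact: energy_ge0.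
have L0 : (0 <= L)%E by exact: L2T_sqnorm_ge0.
pose f (p : R * R) : \bar R := (expR (- p.2) * extend0 (ht_fun U) p ^+ 2)%:E.
have f0 p : (0 <= f p)%E by rewrite /f; nneg.
have mf : measurable_fun setT f.
  apply/measurable_EFinP; apply: measurable_funM.
    apply: measurableT_comp; first exact: measurable_expR.
    by apply: measurableT_comp.
  by apply: measurable_funX; apply: measurable_extend0; exact: measurable_ht_fun.
have -> : (\int[mu2]_(p in half_strip T) (expR (- p.2) * ht_fun U p ^+ 2)%:E =
    \int[mu2]_(p in cell `*` `]0%R, +oo[) f p)%E.
  rewrite -half_stripE; apply: eq_integral => p; rewrite inE => -[_ /= p0].
  by rewrite /f /extend0 p0.
rewrite tonelli_rect2//.
have mg p : measurable_fun (`]0, +oo[%classic : set R) (fun t : R => (t `^ (p - 1) * expR (- t))%:E).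
  by apply: measurable_funTS; exact: measurable_gamma_density.
apply: (@le_trans _ _ (\int[mu]_(y in `]0%R, +oo[)
   ((y `^ (2 * s + 1 - 1) * expR (- y))%:E * (s^-1%:E * E) + (y `^ (1 - 1) * expR (- y))%:E * (2%:E * L)))%E).
  apply: ae_ge0_le_integral => //.
  - by move=> y _; exact: integral_ge0.
  - by apply: measurable_funTS; apply: (@measurable_slice_y _ cell f).
  - move=> y _; apply: adde_ge0; apply: mule_ge0; try by nneg.
      by rewrite mule_ge0// lee_fin invr_ge0 ltW.
    by rewrite mule_ge0.
  - by apply: emeasurable_funD; apply: emeasurable_funM; [exact: mg|exact: measurable_cst|exact: mg|exact: measurable_cst].
  apply: (ae_impl (trace_slice_bound U)) => y hy /=; rewrite in_itv /= andbT => y0.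
  have {hy} hy := hy y0.
  have mh : measurable_fun cell (fun x => ht_fun U (x, y)).
    by apply: measurable_funTS; exact: measurable_slice_half_plane (measurable_ht_fun U) y0.
  have mu' : measurable_fun cell u by apply: measurable_funTS; exact: measurable_trace.
  have m1 : measurable_fun cell (fun x => ((ht_fun U (x, y) - u x) ^+ 2)%:E).
    by apply/measurable_EFinP; apply: measurable_funX; exact: measurable_funB.
  have m2 : measurable_fun cell (fun x => (u x ^+ 2)%:E).
    by apply/measurable_EFinP; exact: measurable_funX.
  apply: (@le_trans _ _ (\int[mu]_(x in cell) ((2 * expR (- y))%:E * ((ht_fun U (x, y) - u x) ^+ 2)%:E
      + (2 * expR (- y))%:E * (u x ^+ 2)%:E))%E).
    apply: ge0_le_integral => //.
    - by apply: measurable_funTS; apply: (measurableT_comp mf); exact: pair2_measurable.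
    - by apply: emeasurable_funD; apply: emeasurable_funM.
    move=> x _; rewrite /f /extend0 /= y0 -!EFinM -EFinD lee_fin.
    rewrite -mulrDr [2 * _]mulrC -mulrA ler_pM2l ?expR_gt0//.
    rewrite -subr_ge0 (_ : _ - _ = (ht_fun U (x, y) - 2 * u x) ^+ 2) ?sqr_ge0//; ring.
  rewrite ge0_integralD//; try first [by move=> *; nneg | by apply: emeasurable_funM].
  have e0 : (0 <= (2 * expR (- y))%:E)%E by nneg.
  rewrite !ge0_integralZl//; try by move=> *; nneg.
  apply: leeD.
    apply: le_trans (lee_wpmul2l e0 hy) _.
    rewrite muleA -EFinM [leRHS]muleA -EFinM.
    have -> : 2 * expR (- y) * (y `^ (2 * s) / (2 * s)) = y `^ (2 * s + 1 - 1) * expR (- y) * s^-1.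
      by rewrite addrK; field; rewrite gt_eqF.
    by apply: lee_wpmul2l; [rewrite lee_fin !mulr_ge0 ?powR_ge0 ?expR_ge0// invr_ge0 ltW|exact: energy1_dy_le].
  rewrite muleA -EFinM subrr powRr0 mul1r [(2 * _)%R]mulrC.
  by [].
rewrite (@ge0_integralD _ _ _ mu _ moo); last 4 first.
- by move=> y _; rewrite !mule_ge0//; nneg; rewrite invr_ge0 ltW.
- by apply: emeasurable_funM; [exact: mg|exact: measurable_cst].
- by move=> y _; rewrite !mule_ge0//; nneg.
- by apply: emeasurable_funM; [exact: mg|exact: measurable_cst].
rewrite ge0_integralZr//; try exact: mg; last 2 first.
- by move=> y _; nneg.
- by rewrite mule_ge0// lee_fin invr_ge0 ltW.
rewrite ge0_integralZr//; try exact: mg; last 2 first.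
- by move=> y _; nneg.
- by rewrite mule_ge0.
rewrite -/(g (2 * s + 1)) -/(g 1) -(fineK (gf _ p1)) -(fineK (gf _ ltr01)) /C.
move: C1 C2; move: (fine (g (2 * s + 1))) (fine (g 1)) => a b a0 b0.
have Efin : E \is a fin_num by rewrite ge0_fin_numE// energy_lty.
have Lfin : L \is a fin_num by rewrite ge0_fin_numE// trace_lty.
rewrite -(fineK Efin) -(fineK Lfin) -!EFinM -?EFinD -?EFinM lee_fin.
have e0 : 0 <= fine E by rewrite fine_ge0.
have l0 : 0 <= fine L by rewrite fine_ge0.
move: (fine E) (fine L) e0 l0 => e l e0 l0.
rewrite -subr_ge0 (_ : _ - _ = 2 * b * e + a / s * l); last by ring.
by rewrite addr_ge0// mulr_ge0.
Qed.

End trace_estimates.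

(** * Weak derivatives of periodic functions *)

Section admissible_functions.
Context {R : realType}.
Local Notation mu := (@lebesgue_measure R).
Local Notation mu2 := (mu \x mu)%E.

(** An open set of the plane is a countable union of products of rational intervals,
    which is the link between the product topology and the product sigma-algebra. *)
Lemma measurable_open_plane (O : set (R * R)) : open O -> measurable O.
Proof.
move=> oO; pose I : Type := (rat * rat * rat * rat)%type.
pose B (i : I) : set (R * R) :=
  `](ratr i.1.1.1 : R), (ratr i.1.1.2)[ `*` `](ratr i.1.2 : R), (ratr i.2)[.
pose F i := if pselect (B i `<=` O) then B i else set0.
have -> : O = \bigcup_i F i.
  apply/seteqP; split=> [[x y] Oxy|p [i _]]; last by rewrite /F; case: pselect => // BO /BO.
  have : nbhs (x, y) O by rewrite nbhsE; exists O.
  move=> [[A1 A2] /= [n1 n2] AO].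
  move/nbhs_ballP : n1 => [e1 /= e10 be1]; move/nbhs_ballP : n2 => [e2 /= e20 be2].
  have lt1 (z e : R) : 0 < e -> z - e < z by move=> e0; rewrite ltrBlDr ltrDl.
  have lt2 (z e : R) : 0 < e -> z < z + e by move=> e0; rewrite ltrDl.
  have [a] := rat_in_itvoo (lt1 x _ e10); rewrite in_itv /= => /andP[a1 a2].
  have [b] := rat_in_itvoo (lt2 x _ e10); rewrite in_itv /= => /andP[b1 b2].
  have [c] := rat_in_itvoo (lt1 y _ e20); rewrite in_itv /= => /andP[c1 c2].
  have [d] := rat_in_itvoo (lt2 y _ e20); rewrite in_itv /= => /andP[d1 d2].
  have BO : B (a, b, c, d) `<=` O; last first.
    exists (a, b, c, d) => //; rewrite /F; case: pselect => [BO'|/(_ BO)//].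
    by split; rewrite /= in_itv /= ?a2 ?b1 ?c2 ?d1.
  move=> [z t] [/=]; rewrite !in_itv /= => /andP[z1 z2] /andP[t1 t2].
  apply: AO; split => /=.
    by apply: be1; rewrite /ball /= ltr_distlC (lt_trans a1 z1) (lt_trans z2 b2).
  by apply: be2; rewrite /ball /= ltr_distlC (lt_trans c1 t1) (lt_trans t2 d2).
apply: countable_bigcupT_measurable; first exact: countableP.
move=> i; have [->|->] : F i = B i \/ F i = set0.
- by rewrite /F; case: pselect => ?; [left|right].
- by apply: measurableX; exact: measurable_itv.
- exact: measurable0.
Qed.

Lemma measurable_continuous_plane (f : R * R -> R) : continuous f -> measurable_fun setT f.
Proof.
move=> cf; apply: (measurability (@RGenOInfty.G R)).
  exact: RGenOInfty.measurableE.
move=> _ [_ [a ->] <-]; rewrite setTI; apply: measurable_open_plane.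
apply: open_comp; first by move=> p _; exact: cf.
exact: interval_open.
Qed.

Lemma compact_plane_closed (K : set (R * R)) : compact K -> closed K.
Proof. by apply: compact_closed; exact: norm_hausdorff. Qed.

Lemma measurable_compact_plane (K : set (R * R)) : compact K -> measurable K.
Proof.
move=> cK; rewrite -[K]setCK; apply: measurableC; apply: measurable_open_plane.
by rewrite openC; exact: compact_plane_closed.
Qed.

Lemma compact_image_bnd (K : set (R * R)) (f : R * R -> R) : compact K -> continuous f ->
  exists C : R, forall p, K p -> `|f p| <= C.
Proof.
move=> cK cf; have : compact (f @` K).
  by apply: continuous_compact => //; exact: continuous_subspaceT.
move=> /compact_bounded [M [_ hM]]; exists (M + 1) => p Kp.
by apply: (hM (M + 1)); [rewrite ltrDl|exists p].
Qed.

(** A class of multipliers that contains the test functions and their derivatives, is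
    stable under translation, and pairs with every locally integrable function. *)
Definition admissible (psi : R * R -> R) : Prop :=
  [/\ measurable_fun setT psi, exists C : R, forall p, `|psi p| <= C &
      exists K : set (R * R), [/\ compact K, K `<=` half_plane R & forall p, ~ K p -> psi p = 0]].

Lemma admissible_of_continuous (psi : R * R -> R) (K : set (R * R)) : continuous psi ->
  compact K -> K `<=` half_plane R -> (forall p, ~ K p -> psi p = 0) -> admissible psi.
Proof.
move=> cpsi cK Khp psi0; split; first exact: measurable_continuous_plane.
  have [C hC] := compact_image_bnd cK cpsi; exists (Num.max C 0) => p.
  have [Kp|nKp] := pselect (K p); first by rewrite le_max hC.
  by rewrite psi0// normr0 le_max lexx orbT.
by exists K.
Qed.

Definition coord_dir (v : R * R) : Prop := v = e_x R \/ v = e_y R.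

Lemma admissible_test phi : test_function phi -> admissible phi.
Proof.
move=> [sphi [K [cK Khp phi0]]]; apply: (admissible_of_continuous _ cK Khp phi0).
exact: (sphi 0%N).
Qed.

Lemma admissible_test_deriv v phi : coord_dir v -> test_function phi ->
  admissible (fun p => 'D_v phi p).
Proof.
move=> hv [sphi [K [cK Khp phi0]]].
have cD : continuous (fun p => 'D_v phi p).
  by have [_ _ c1 c2] := sphi 1%N; case: hv => ->; [exact: c1|exact: c2].
apply: (admissible_of_continuous cD cK Khp) => p nKp.
rewrite (_ : 0 = 'D_v (cst 0 : R * R -> R) p); last by rewrite derive_cst.
apply: near_eq_derive.
have oK : open (~` K) by rewrite openC; exact: compact_plane_closed.
by have := open_nbhs_nbhs (conj oK nKp); apply: filterS => q; exact: phi0.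
Qed.

Lemma integrable_loc_patch (F : R * R -> R) (K : set (R * R)) : loc_integrable F ->
  compact K -> K `<=` half_plane R -> mu2.-integrable setT (EFin \o (F \_ K)).
Proof.
move=> [mF lF] cK Khp; apply: integrable_patch; first exact: measurable_compact_plane.
apply/integrableP; split; last exact: lF.
apply/measurable_EFinP; apply: measurable_funS mF => //; exact: measurable_half_plane.
Qed.

Lemma extend0_mul (F psi : R * R -> R) (K : set (R * R)) : K `<=` half_plane R ->
  (forall p, ~ K p -> psi p = 0) -> (fun p => extend0 F p * psi p) = (fun p => (F \_ K) p * psi p).
Proof.
move=> Khp psi0; apply/funext => p; have [Kp|nKp] := pselect (K p).
  have := Khp _ Kp; rewrite /half_plane /extend0 /= => ->.
  by rewrite patchE mem_set.
by rewrite psi0// !mulr0.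
Qed.

Lemma integrable_admissible (F psi : R * R -> R) : loc_integrable F -> admissible psi ->
  mu2.-integrable setT (EFin \o (fun p => extend0 F p * psi p)).
Proof.
move=> lF [mpsi [C hC] [K [cK Khp psi0]]]; rewrite (extend0_mul _ Khp psi0).
exact: (@integrable_bddM _ _ _ mu2 setT measurableT _ psi C (integrable_loc_patch lF cK Khp) mpsi).
Qed.

Lemma Rintegral_half_plane0 (F psi : R * R -> R) :
  \int[mu2]_(p in half_plane R) (F p * psi p) = \int[mu2]_p (extend0 F p * psi p).
Proof.
apply: Rintegral_half_plane => p p0; rewrite /extend0; first by rewrite p0.
by rewrite ltNge p0 mul0r.
Qed.

Lemma admissible_shift c (psi : R * R -> R) : admissible psi -> admissible (psi \o shift_x c).
Proof.
move=> [mpsi [C hC] [K [cK Khp psi0]]]; split.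
- by apply: (measurableT_comp mpsi); exact: measurable_shift_x.
- by exists C => p; exact: hC.
exists (shift_x (- c) @` K); split.
- apply: continuous_compact => //; apply: continuous_subspaceT => p.
  have -> : shift_x (- c) = (fun q : R * R => q + (- c, 0)).
    by apply/funext => -[x y]; rewrite /shift_x /=; congr pair; rewrite addr0.
  by apply: cvgD; [exact: cvg_id|exact: cvg_cst].
- by move=> _ [p /Khp hp <-].
- move=> p np; rewrite /= psi0// => Kp; apply: np; exists (shift_x c p) => //.
  by case: p Kp => x y _; rewrite /shift_x /= addrK.
Qed.

Lemma derive_shift_x c v (phi : R * R -> R) p :
  'D_v (phi \o shift_x c) p = 'D_v phi (shift_x c p).
Proof.
have e : (fun h : R => h^-1 *: (((phi \o shift_x c) \o shift p) (h *: v) - (phi \o shift_x c) p)) =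
    (fun h : R => h^-1 *: ((phi \o shift (shift_x c p)) (h *: v) - phi (shift_x c p))).
  apply/funext => h /=; congr (_ *: (phi _ - _)); case: p => x y; case: v => v1 v2.
  by rewrite /shift_x /=; congr pair; rewrite addrA.
by rewrite /derive e.
Qed.

Lemma smooth_translate c (f : R -> R) : smooth f -> smooth (fun x => f (x + c)).
Proof.
by move=> sf; have := smooth_affine 1 c sf; under eq_fun do rewrite mul1r.
Qed.

Lemma test1_translate c a b (f : R -> R) : test1 (a + c) (b + c) f -> test1 a b (fun x => f (x + c)).
Proof.
move=> [sf [p [q [ap pq qb f0]]]]; split; first exact: smooth_translate.
exists (p - c), (q - c); split.
- by rewrite ltrBrDr.
- by rewrite ltrD2r.
- by rewrite ltrBlDr.
- by move=> x nx; apply: f0; move: nx; rewrite ltrBlDr ltrBrDr.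
Qed.

End admissible_functions.

Section periodicity.
Context {R : realType} (s T : R) (hT : 0 < T).
Local Notation mu := (@lebesgue_measure R).
Local Notation mu2 := (mu \x mu)%E.
Variables (v : R * R) (hv : coord_dir v) (U W : R * R -> R).
Hypotheses (lU : loc_integrable U) (perU : forall x y, 0 < y -> U (x + T, y) = U (x, y))
  (wUW : weak_partial v U W).

Let shp := @ge0_integral_shift_x R T.
Let msh := @measurable_shift_x R T.

Lemma Rintegral_shift_admissible (F psi : R * R -> R) : loc_integrable F -> admissible psi ->
  \int[mu2]_p (extend0 F (shift_x T p) * psi p) =
  \int[mu2]_p (extend0 F p * psi (shift_x (- T) p)).
Proof.
move=> lF ap; have ip := integrable_admissible lF (admissible_shift (- T) ap).
have [_ <-] := integrable_plane_map msh shp ip.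
apply: eq_Rintegral => -[x y] _; rewrite /shift_x /=; congr (_ * psi (_, _)).
by rewrite addrK.
Qed.

(** Translating the test function instead of W, the integral becomes one of U against
    a translated derivative, and U is periodic. *)
Lemma weak_partial_shift (g h : R -> R) (a b c d : R) : 0 <= c ->
  test1 a b g -> test1 c d h ->
  \int[mu2]_p (extend0 W (shift_x T p) * tensor g h p) = \int[mu2]_p (extend0 W p * tensor g h p).
Proof.
move=> c0 tg th; have [lW hW] := wUW.
have tphi := test_function_tensor c0 tg th.
have tg' : test1 (a + T) (b + T) (fun x => g (x + - T)).
  by apply: test1_translate; rewrite !addrK.
have tphi' := test_function_tensor c0 tg' th.
have e' : tensor (fun x => g (x + - T)) h = tensor g h \o shift_x (- T) by [].
rewrite Rintegral_shift_admissible//; last exact: admissible_test.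
have := hW _ tphi'; have := hW _ tphi.
rewrite !Rintegral_half_plane0.
rewrite e' => h1 h2; apply: oppr_inj.
rewrite -[RHS]h1 -[LHS]h2.
under eq_Rintegral do rewrite derive_shift_x.
rewrite -(@Rintegral_shift_admissible U (fun p => 'D_v (tensor g h) p) lU); last exact: admissible_test_deriv.
apply: eq_Rintegral => -[x y] _; congr (_ * _); rewrite /extend0 /shift_x /=.
by case: ifP => // y0; rewrite perU.
Qed.

(** By [weak_partial_shift], W and its translate agree when tested against tensor
    products, hence almost everywhere on each of the rectangles
    (-m,m) x (1/m,m) that exhaust the half-plane. *)
Lemma ae_periodic_partial : {ae mu2, forall p, 0 < p.2 -> W (shift_x T p) = W p}.
Proof.
have [lW _] := wUW.
have key (m : nat) : {ae mu2, forall p, - m.+1%:R < p.1 < m.+1%:R -> m.+1%:R^-1 < p.2 < m.+1%:R ->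
    extend0 W (shift_x T p) - extend0 W p = 0}.
  set M : R := m.+1%:R; have M0 : 0 < M by rewrite ltr0n.
  have c0 : 0 <= M^-1 by rewrite invr_ge0 ltW.
  pose B : set (R * R) := `[- M, M] `*` `[M^-1, M].
  have cB : compact B by exact: compact_rect.
  have Bhp : B `<=` half_plane R.
    move=> p [_ /=]; rewrite in_itv /= => /andP[p1 _]; rewrite /half_plane /=.
    by apply: lt_le_trans p1; rewrite invr_gt0.
  have mB := measurable_compact_plane cB.
  pose B' : set (R * R) := `[- M + T, M + T] `*` `[M^-1, M].
  have cB' : compact B' by exact: compact_rect.
  have B'hp : B' `<=` half_plane R.
    move=> p [_ /=]; rewrite in_itv /= => /andP[p1 _]; rewrite /half_plane /=.
    by apply: lt_le_trans p1; rewrite invr_gt0.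
  have i1 := integrable_loc_patch lW cB Bhp.
  have i2 := integrable_loc_patch lW cB' B'hp.
  have [i2' _] := integrable_plane_map msh shp i2.
  have B'B p : (shift_x T p \in B') = (p \in B).
    by apply/idP/idP; rewrite !inE /B /B' /shift_x => -[/= p1 p2]; split => //=;
      move: p1; rewrite !in_itv /= !lerD2r.
  pose f p := (W \_ B') (shift_x T p) - (W \_ B) p.
  have fi : mu2.-integrable setT (EFin \o f) := integrable_RB measurableT i2' i1.
  have fE p : B p -> f p = extend0 W (shift_x T p) - extend0 W p.
    move=> Bp; rewrite /f !patchE B'B mem_set//.
    have p0 : 0 < p.2 := Bhp _ Bp.
    by rewrite /extend0 /= p0.
  have f0 p : ~ B p -> f p = 0.
    by move=> nBp; rewrite /f !patchE B'B memNset// subrr.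
  have tens (g h : R -> R) : test1 (- M) M g -> test1 M^-1 M h ->
      \int[mu2]_p (f p * (g p.1 * h p.2)) = 0.
    move=> tg th; have at1 := admissible_test (test_function_tensor c0 tg th).
    have ga p : ~ B p -> tensor g h p = 0.
      move=> nB; rewrite /tensor; have [p1|p1] := boolP (- M < p.1 < M); last first.
        by rewrite (test1_outside tg p1) mul0r.
      have [p2|p2] := boolP (M^-1 < p.2 < M); last by rewrite (test1_outside th p2) mulr0.
      by case: nB; split; rewrite /= in_itv /=;
        [case/andP: p1 => /ltW -> /ltW ->|case/andP: p2 => /ltW -> /ltW ->].
    have e : \int[mu2]_p (f p * (g p.1 * h p.2)) =
        \int[mu2]_p (extend0 W (shift_x T p) * tensor g h p - extend0 W p * tensor g h p).
      apply: eq_Rintegral => p _; have [Bp|nB] := pselect (B p).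
        by rewrite fE// mulrBl.
      by rewrite (f0 _ nB) (ga _ nB) mul0r !mulr0 subrr.
    rewrite e RintegralB//; last exact: integrable_admissible.
      by rewrite (weak_partial_shift c0 tg th) subrr.
    have ip := integrable_admissible lW (admissible_shift (- T) at1).
    have [ip' _] := integrable_plane_map msh shp ip.
    apply: eq_integrable ip' => // -[x y] _ /=; rewrite /shift_x /=.
    by congr (_ * _)%:E; rewrite /shift_x /= addrK.
  apply: (ae_impl (ae0_of_tensor fi tens)) => p hp p1 p2.
  rewrite -fE; first exact: hp.
  by split; rewrite /= in_itv /=;
        [case/andP: p1 => /ltW -> /ltW ->|case/andP: p2 => /ltW -> /ltW ->].
apply: (ae_impl (ae_foralln key)) => p hp p0.
pose m := Num.bound (`|p.1| + p.2 + p.2^-1).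
have hm : `|p.1| + p.2 + p.2^-1 < m.+1%:R.
  apply: lt_trans (archi_boundP _) _; last by rewrite ltr_nat.
  by rewrite !addr_ge0// ?invr_ge0 ltW.
have p20 : 0 < p.2^-1 by rewrite invr_gt0.
have n0 := normr_ge0 p.1.
have h1 : - m.+1%:R < p.1 < m.+1%:R by rewrite -ltr_norml; lra.
have h2 : m.+1%:R^-1 < p.2 < m.+1%:R.
  apply/andP; split; last by lra.
  by rewrite -[ltRHS]invrK ltf_pV2 ?posrE//; lra.
have := hp m h1 h2; rewrite /extend0 /= p0 => /eqP; rewrite subr_eq0 => /eqP.
by [].
Qed.

End periodicity.

(** * Limits of periodic functions in weighted norms *)

Section wide_strips.
Context {R : realType} (T : R) (hT : 0 < T).
Local Notation mu := (@lebesgue_measure R).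
Local Notation mu2 := (mu \x mu)%E.
Local Notation cell := (period_cell T).

Definition wide (n : nat) (r : R) : set (R * R) :=
  `[- (T / 2) - n%:R * T, T / 2 + n%:R * T] `*` `]0, r].

Definition ae_periodic (Z : Type) (f : R * R -> Z) : Prop :=
  {ae mu2, forall p, 0 < p.2 -> f (shift_x T p) = f p}.

Lemma measurable_wide n r : measurable (wide n r).
Proof. by apply: measurableX; exact: measurable_itv. Qed.

Lemma wide0 r : wide 0 r = strip T r.
Proof. by rewrite /wide mul0r subr0 addr0. Qed.

Lemma wide_half_plane n r : wide n r `<=` half_plane R.
Proof. by move=> p [_ /=]; rewrite in_itv /= => /andP[]. Qed.

Lemma wideS_cover n r p : wide n.+1 r p ->
  [\/ wide n r p, wide n r (shift_x T p) | wide n r (shift_x (- T) p)].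
Proof.
have n0 : 0 <= n%:R * T by rewrite mulr_ge0// ltW.
case: p => x y [/=]; rewrite in_itv /= -[n.+1%:R]natr1 [(_ + 1) * T]mulrDl mul1r => /andP[x1 x2] hy.
have [xl|xl] := ltP x (- (T / 2) - n%:R * T).
  by apply: Or32; split; rewrite //= in_itv /=; apply/andP; split; lra.
have [xr|xr] := ltP (T / 2 + n%:R * T) x.
  by apply: Or33; split; rewrite //= in_itv /=; apply/andP; split; lra.
by apply: Or31; split; rewrite //= in_itv /= xl xr.
Qed.

Lemma compact_sub_wide (K : set (R * R)) : compact K -> K `<=` half_plane R ->
  exists n r, 0 < r /\ K `<=` wide n r.
Proof.
move=> cK Khp.
have [C hC] := compact_image_bnd cK (fun p => @cvg_fst _ _ _ _ _).
have [D hD] := compact_image_bnd cK (fun p => @cvg_snd _ _ _ _ _).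
exists (Num.bound (`|C| / T)), (`|D| + 1); split; first by rewrite ltr_wpDl.
move=> p Kp; have p0 : 0 < p.2 := Khp _ Kp.
have := archi_boundP (divr_ge0 (normr_ge0 C) (ltW hT)).
rewrite ltr_pdivrMr// => hn; have := hC _ Kp; have := hD _ Kp => h2 h1.
have c1 := ler_norm C; have d1 := ler_norm D; have := ler_norm p.2 => e2.
move: h1; rewrite ler_norml => /andP[h1 h1'].
split; rewrite /= in_itv /=; apply/andP; split => //; last by lra.
  by have : 0 < T / 2; [rewrite divr_gt0|lra].
by have : 0 < T / 2; [rewrite divr_gt0|lra].
Qed.

Lemma ae_periodicN (Z : Type) (f : R * R -> Z) : ae_periodic f ->
  {ae mu2, forall p, 0 < p.2 -> f (shift_x (- T) p) = f p}.
Proof.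
move=> pf; have := ae_plane_preserving (@measurable_shift_x R (- T)) (@ge0_integral_shift_x R (- T)) pf.
move/ae_impl; apply => -[x y] /= hp y0; move: (hp y0).
by rewrite /shift_x /= subrK.
Qed.

(** A strip of 2 n + 3 periods is covered by three translates of one of 2 n + 1
    periods ([wideS_cover]), which gives the crude factor 3^n by induction; any finite
    factor will do. *)
Lemma ge0_integral_wide (f : R * R -> \bar R) n r : measurable_fun setT f ->
  (forall p, 0 <= f p)%E -> ae_periodic f ->
  (\int[mu2]_(p in wide n r) f p <= (3 ^+ n)%:E * \int[mu2]_(p in strip T r) f p)%E.
Proof.
move=> mf f0 pf; elim: n => [|n IH]; first by rewrite wide0 expr0 mul1e.
pose g := f \_ (wide n r).
have mg : measurable_fun setT g.
  by apply/(measurable_restrictT _ _).1; [exact: measurable_wide|exact: measurable_funTS].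
have g0 p : (0 <= g p)%E by apply: erestrict_ge0.
have mgT c : measurable_fun setT (g \o shift_x c).
  by apply: (measurableT_comp mg); exact: measurable_shift_x.
have mg2 : measurable_fun setT (fun p => g p + g (shift_x T p))%E.
  exact: (emeasurable_funD mg (mgT T)).
apply: (@le_trans _ _ (\int[mu2]_p (g p + g (shift_x T p) + g (shift_x (- T) p)))%E).
  rewrite integral_mkcond; apply: ae_ge0_le_integral => //.
  - by move=> p _; apply: erestrict_ge0.
  - by apply/(measurable_restrictT _ _).1; [exact: measurable_wide|exact: measurable_funTS].
  - by move=> p _; rewrite !adde_ge0.
  - exact: (emeasurable_funD mg2 (mgT (- T))).
  apply: (ae_impl (ae_conj pf (ae_periodicN pf))) => p [h1 h2] _.
  rewrite patchE; case: ifPn => [|_]; last by rewrite !adde_ge0.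
  rewrite inE => pw; have p0 : 0 < p.2 := wide_half_plane pw.
  have [w|w|w] := wideS_cover pw.
  - rewrite -addeA; apply: (@le_trans _ _ (g p)); first by rewrite /g patchE mem_set.
    by rewrite leeDl// adde_ge0.
  - rewrite addeAC; apply: (@le_trans _ _ (g (shift_x T p))).
      by rewrite /g patchE mem_set// h1.
    by rewrite leeDr// adde_ge0.
  - apply: (@le_trans _ _ (g (shift_x (- T) p))).
      by rewrite /g patchE mem_set// h2.
    by rewrite leeDr// adde_ge0.
rewrite (@ge0_integralD _ _ _ mu2 _ measurableT _ _ _ mg2 _ (mgT (- T)))//; try by move=> p _; rewrite ?adde_ge0// /= g0.
rewrite (@ge0_integralD _ _ _ mu2 _ measurableT _ _ _ mg _ (mgT T))//; try by move=> p _; rewrite /= ?g0.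
rewrite [X in (_ + X + _)%E]ge0_integral_shift_x// [X in (_ + X)%E]ge0_integral_shift_x//.
have -> : (\int[mu2]_p g p = \int[mu2]_(p in wide n r) f p)%E by rewrite [RHS]integral_mkcond.
set I := integral _ _ _ in IH *; set J := integral _ _ _ in IH *.
have J0 : (0 <= J)%E by apply: integral_ge0 => p _; exact: f0.
apply: le_trans (leeD (leeD IH IH) IH) _.
have c0 : (0 <= (3 ^+ n)%:E :> \bar R)%E by rewrite lee_fin exprn_ge0.
rewrite -ge0_muleDl// -ge0_muleDl ?adde_ge0// -!EFinD lee_wpmul2r// lee_fin exprS.
by rewrite le_eqVlt; apply/orP; left; apply/eqP; ring.
Qed.

Lemma loc_integrable_periodic (g : R * R -> R) : measurable_fun (half_plane R) g ->
  ae_periodic g -> (forall r, 0 < r -> mu2.-integrable (strip T r) (EFin \o g)) ->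
  loc_integrable g.
Proof.
move=> mg pg ig; split => // K cK Khp.
have [n [r [r0 Kw]]] := compact_sub_wide cK Khp.
have mK := measurable_compact_plane cK.
have mh : measurable_fun setT (fun p => `|extend0 g p|%:E).
  by apply/measurable_EFinP; apply: measurableT_comp => //; exact: measurable_extend0.
apply: (@le_lt_trans _ _ (\int[mu2]_(p in wide n r) `|extend0 g p|%:E)%E).
  have -> : (\int[mu2]_(p in K) `|g p|%:E = \int[mu2]_(p in K) `|extend0 g p|%:E)%E.
    by apply: eq_integral => p; rewrite inE => /Khp; rewrite /half_plane /extend0 /= => ->.
  apply: ge0_subset_integral => //; try exact: measurable_wide.
  - exact: measurable_funTS.
have := @ge0_integral_wide (fun p => `|extend0 g p|%:E) n r mh.
move=> /(_ _ _)/le_lt_trans; apply.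
- by move=> p; rewrite lee_fin.
- by apply: (ae_impl pg) => p hp p0; rewrite /extend0 /= p0 hp.
have := ig _ r0 => /integrableP[_].
rewrite (_ : (\int[mu2]_(p in strip T r) `|(EFin \o g) p|)%E =
    (\int[mu2]_(p in strip T r) `|extend0 g p|%:E)%E); last first.
  by apply: eq_integral => p; rewrite inE => /strip_half_plane; rewrite /half_plane /extend0 /= => ->.
by move=> h; rewrite lte_mul_pinfty// lee_fin exprn_ge0.
Qed.

End wide_strips.

Section weighted_limits.
Context {R : realType} (T : R) (hT : 0 < T).
Local Notation mu := (@lebesgue_measure R).
Local Notation mu2 := (mu \x mu)%E.

Lemma cvg_of_sq_le (f : nat -> R) (l M : R) :
  (forall n, (f n - l) ^+ 2 <= M * 8 ^- n) -> f n @[n --> \oo] --> l.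
Proof.
move=> h; apply/cvgrPdist_lt => e e0.
have M0 : 0 <= M by have := le_trans (sqr_ge0 _) (h 0%N); rewrite expr0 invr1 mulr1.
have c8 : (8^-1 : R) ^+ n @[n --> \oo] --> (0 : R).
  by apply: cvg_expr; rewrite ger0_norm ?invr_ge0// invf_lt1// ltr1n.
have d0 : 0 < e ^+ 2 / (M + 1) by rewrite divr_gt0 ?exprn_gt0// ltr_wpDl.
move/cvgrPdist_lt : c8 => /(_ _ d0); apply: filterS => n.
rewrite sub0r normrN ger0_norm ?exprn_ge0 ?invr_ge0// exprVn => hn.
rewrite distrC -(ltr_pXn2r (n := 2)) ?nnegrE//; last exact: ltW.
rewrite real_normK ?num_real//; apply: le_lt_trans (h n) _.
rewrite ltr_pdivlMr ?ltr_wpDl// in hn.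
apply: le_lt_trans hn; rewrite mulrC ler_wpM2l ?invr_ge0 ?exprn_ge0//.
by rewrite lerDl.
Qed.

Variables (w : R * R -> R) (mw : measurable_fun setT w).
Hypotheses (w0 : forall p, 0 < p.2 -> 0 < w p)
  (wV : forall r, 0 < r -> (\int[mu2]_(p in strip T r) ((w p)^-1)%:E < +oo)%E).

(** Cauchy-Schwarz on one period, spread to several periods by periodicity. *)
Lemma wide_L1_le n r : 0 < r -> exists2 A : R, 0 < A & forall g : R * R -> R,
  measurable_fun (half_plane R) g -> ae_periodic T g ->
  ((\int[mu2]_(p in wide T n r) `|g p|%:E) * (\int[mu2]_(p in wide T n r) `|g p|%:E) <=
   A%:E * \int[mu2]_(p in half_strip T) (w p * g p ^+ 2)%:E)%E.
Proof.
move=> r0; pose I := (\int[mu2]_(p in strip T r) ((w p)^-1)%:E)%E.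
have w0s p : strip T r p -> 0 < w p by move=> /strip_half_plane; exact: w0.
have I0 : (0 <= I)%E by apply: integral_ge0 => p /w0s /ltW; rewrite lee_fin invr_ge0.
have If : I \is a fin_num by rewrite ge0_fin_numE// wV.
pose A := fine I + 1; have A0 : 0 < A by rewrite ltr_wpDl// fine_ge0.
have IA : (I <= A%:E)%E by rewrite -(fineK If) lee_fin lerDl.
exists (3 ^+ n * 3 ^+ n * A); first by rewrite !mulr_gt0// exprn_gt0.
move=> g mg pg.
have mh : measurable_fun setT (fun p => `|extend0 g p|%:E).
  by apply/measurable_EFinP; apply: measurableT_comp => //; exact: measurable_extend0.
have pe : ae_periodic T (fun p => `|extend0 g p|%:E).
  by apply: (ae_impl pg) => p hp p0; rewrite /extend0 /= p0 hp.
have e0 D : D `<=` half_plane R ->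
    (\int[mu2]_(p in D) `|g p|%:E = \int[mu2]_(p in D) `|extend0 g p|%:E)%E.
  move=> Dh; apply: eq_integral => p; rewrite inE => /Dh.
  by rewrite /half_plane /extend0 /= => ->.
have hw : (\int[mu2]_(p in wide T n r) `|g p|%:E <= (3 ^+ n)%:E * \int[mu2]_(p in strip T r) `|g p|%:E)%E.
  rewrite e0; last exact: wide_half_plane.
  rewrite (e0 (strip T r)); last exact: strip_half_plane.
  by apply: ge0_integral_wide => // p; rewrite lee_fin.
have i0 D : (0 <= \int[mu2]_(p in D) `|g p|%:E)%E by apply: integral_ge0 => p _; rewrite lee_fin.
apply: le_trans (lee_pmul (i0 _) (i0 _) hw hw) _.
have mgs : measurable_fun (strip T r) g.
  by apply: measurable_funS mg; [exact: measurable_half_plane|exact: strip_half_plane].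
have cs := @weighted_cauchy_schwarz _ _ _ mu2 _ (measurable_strip T r) A w g (measurable_funTS mw) mgs w0s A0 IA.
rewrite muleACA -EFinM (EFinM _ A) -muleA.
have c0 : (0 <= (3 ^+ n * 3 ^+ n)%:E :> \bar R)%E by rewrite lee_fin mulr_ge0// exprn_ge0.
apply: lee_wpmul2l => //; apply: le_trans cs _; apply: lee_wpmul2l; first by rewrite lee_fin ltW.
apply: ge0_subset_integral => //.
- exact: measurable_strip.
- exact: measurable_half_strip.
- apply/measurable_EFinP; apply: measurable_funM; first exact: measurable_funTS.
  apply: measurable_funX; apply: measurable_funS mg; first exact: measurable_half_plane.
  exact: half_strip_half_plane.
- by move=> p /half_strip_half_plane /w0 /ltW wp; rewrite lee_fin mulr_ge0// sqr_ge0.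
- exact: strip_half_strip.
Qed.

Variables (F : nat -> R * R -> R) (K : R).
Hypotheses (mF : forall n, measurable_fun (half_plane R) (F n))
  (pF : forall n, ae_periodic T (F n))
  (iF : forall n r, 0 < r -> mu2.-integrable (strip T r) (EFin \o F n))
  (cF : forall n m, (n <= m)%N ->
    (\int[mu2]_(p in half_strip T) (w p * (F m p - F n p) ^+ 2)%:E <= (K * 8 ^- n)%:E)%E).

Local Notation G := (seq_limit F).

Let mFhs n : measurable_fun (half_strip T) (F n).
Proof. by apply: measurable_funS (mF n); [exact: measurable_half_plane|exact: half_strip_half_plane]. Qed.

Lemma measurable_limit : measurable_fun (half_plane R) G.
Proof. exact: measurable_seq_limit. Qed.

Lemma ae_periodic_limit : ae_periodic T G.
Proof.
apply: (ae_impl (ae_foralln pF)) => p hp p0; rewrite /seq_limit.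
by congr (fine (limn_esup _)); apply/funext => n; rewrite hp.
Qed.

Lemma limit_dist n :
  (\int[mu2]_(p in half_strip T) (w p * (G p - F n p) ^+ 2)%:E <= (K * 8 ^- n)%:E)%E.
Proof.
apply: seq_limit_dist => //; first exact: measurable_half_strip.
- exact: measurable_funTS.
- by move=> p /half_strip_half_plane; exact: w0.
Qed.

Lemma integrable_limit r : 0 < r -> mu2.-integrable (strip T r) (EFin \o G).
Proof.
move=> r0; have mD n : measurable_fun (half_plane R) (fun p => G p - F n p).
  by apply: measurable_funB => //; exact: measurable_limit.
have iD : mu2.-integrable (strip T r) (EFin \o (fun p => G p - F 0%N p)).
  apply: (@integrable_of_weight _ _ _ mu2 _ (measurable_strip T r) w) => //.
  - exact: measurable_funTS.
  - by apply: measurable_funS (mD 0%N); [exact: measurable_half_plane|exact: strip_half_plane].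
  - by move=> p /strip_half_plane; exact: w0.
  - exact: wV.
  apply: le_lt_trans (ltry (K * 8 ^- 0)); apply: le_trans (limit_dist 0).
  apply: ge0_subset_integral => //.
  - exact: measurable_strip.
  - exact: measurable_half_strip.
  - apply/measurable_EFinP; apply: measurable_funM; first exact: measurable_funTS.
    apply: measurable_funX; apply: measurable_funS (mD 0%N); first exact: measurable_half_plane.
    exact: half_strip_half_plane.
  - by move=> p /half_strip_half_plane /w0 /ltW wp; rewrite lee_fin mulr_ge0// sqr_ge0.
  - exact: strip_half_strip.
have := @integrable_RD _ _ _ mu2 _ (measurable_strip T r) _ _ iD (@iF 0%N r r0).
apply: eq_integrable; first exact: measurable_strip.
by move=> p _ /=; rewrite subrK.
Qed.

Lemma loc_integrable_limit : loc_integrable G.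
Proof.
apply: (loc_integrable_periodic hT measurable_limit ae_periodic_limit).
exact: integrable_limit.
Qed.

(** The support of psi lies in finitely many periods, where by [wide_L1_le] convergence
    in the weighted L^2 norm of one period implies convergence in L^1. *)
Lemma cvg_limit_test psi : admissible psi ->
  \int[mu2]_(p in half_plane R) (F n p * psi p) @[n --> \oo] -->
  \int[mu2]_(p in half_plane R) (G p * psi p).
Proof.
move=> ap; have [mpsi [C hC] [L [cL Lhp psi0]]] := ap.
have [n [r [r0 Lw]]] := compact_sub_wide hT cL Lhp.
have [A A0 hA] := wide_L1_le n r0.
have lF m := loc_integrable_periodic hT (mF m) (pF m) (iF m).
apply: (@cvg_of_sq_le _ _ (C ^+ 2 * (A * K))) => m.
rewrite !Rintegral_half_plane0 -RintegralB//; last 2 first.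
- exact: integrable_admissible.
- by apply: integrable_admissible => //; exact: loc_integrable_limit.
pose D p := G p - F m p.
have mD : measurable_fun (half_plane R) D.
  by apply: measurable_funB => //; exact: measurable_limit.
have pD : ae_periodic T D.
  by apply: (ae_impl (ae_conj ae_periodic_limit (pF m))) => p [h1 h2] p0; rewrite /D h1// h2.
set x := Rintegral _ _ _.
have C0 : 0 <= C by apply: le_trans (normr_ge0 _) (hC (0, 0)).
set I := (\int[mu2]_(p in wide T n r) `|D p|%:E)%E.
have hx : (`|x|%:E <= C%:E * I)%E.
  have mf : measurable_fun setT (fun p => extend0 (F m) p * psi p - extend0 G p * psi p).
    apply: measurable_funB; apply: measurable_funM => //; apply: measurable_extend0 => //.
    exact: measurable_limit.
  apply: (@le_trans _ _ (\int[mu2]_p `|extend0 (F m) p * psi p - extend0 G p * psi p|%:E)%E).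
    apply: le_trans (abse_fine_le _) _.
    apply: le_trans (le_abse_integral mu2 measurableT _) _; first exact/measurable_EFinP.
    by [].
  have mDw : measurable_fun (wide T n r) D.
    by apply: measurable_funS mD; [exact: measurable_half_plane|exact: wide_half_plane].
  rewrite -ge0_integralZl//; last 2 first.
  - exact: measurable_wide.
  - by apply/measurable_EFinP; apply: measurableT_comp.
  rewrite [leRHS]integral_mkcond; apply: ge0_le_integral => //.
  - by apply/measurable_EFinP; apply: measurableT_comp.
  - apply/(measurable_restrictT _ _).1; first exact: measurable_wide.
    apply: emeasurable_funM => //.
    by apply/measurable_EFinP; apply: measurableT_comp.
  move=> p _; rewrite -mulrBl normrM patchE; have [Lp|nLp] := pselect (L p).
    rewrite mem_set; last exact: Lw.
    have p0 : 0 < p.2 := Lhp _ Lp.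
    by rewrite /extend0 /= p0 distrC mulrC -EFinM lee_fin ler_wpM2r.
  rewrite psi0// normr0 mulr0; case: ifP => // _.
  by rewrite -EFinM lee_fin mulr_ge0.
have I0 : (0 <= I)%E by apply: integral_ge0 => p _; rewrite lee_fin.
have ax : (0 <= `|x|%:E)%E by rewrite lee_fin.
have := lee_pmul ax ax hx hx; rewrite muleACA -!EFinM => h.
rewrite -real_normK ?num_real// expr2 -lee_fin; apply: le_trans h _.
have cc : (0 <= (C * C)%:E)%E by rewrite lee_fin mulr_ge0.
rewrite (_ : C ^+ 2 * (A * K) * 8 ^- m = C * C * (A * (K * 8 ^- m))); last by rewrite expr2 !mulrA.
rewrite (EFinM (C * C) (A * _)); apply: lee_wpmul2l => //; apply: le_trans (hA D mD pD) _.
by rewrite EFinM; apply: lee_wpmul2l; [rewrite lee_fin ltW|exact: limit_dist].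
Qed.

End weighted_limits.

(** * The linear structure of H_T *)

Section linear_combinations.
Context {R : realType} (s T : R).
Local Notation mu := (@lebesgue_measure R).
Local Notation mu2 := (mu \x mu)%E.
Local Notation cell := (period_cell T).

Lemma loc_integrable_comb (F G : R * R -> R) (t : R) : loc_integrable F -> loc_integrable G ->
  loc_integrable (fun p => F p + t * G p).
Proof.
move=> lF lG; split.
  by apply: measurable_funD; [exact: lF.1|apply: measurable_funM => //; exact: lG.1].
move=> K cK Khp; have mK := measurable_compact_plane cK.
have iK (H : R * R -> R) : loc_integrable H -> mu2.-integrable K (EFin \o H).
  move=> [mH lH]; apply/integrableP; split; last exact: lH.
  apply/measurable_EFinP; apply: measurable_funS mH => //; exact: measurable_half_plane.
have iG := @integrable_RZ _ _ _ mu2 _ mK t _ (iK _ lG).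
by have /integrableP[] := @integrable_RD _ _ _ mu2 _ mK _ _ (iK _ lF) iG.
Qed.

Lemma Rintegral_comb_admissible (F G psi : R * R -> R) (t : R) : loc_integrable F ->
  loc_integrable G -> admissible psi ->
  \int[mu2]_(p in half_plane R) ((F p + t * G p) * psi p) =
  \int[mu2]_(p in half_plane R) (F p * psi p) + t * \int[mu2]_(p in half_plane R) (G p * psi p).
Proof.
move=> lF lG ap; rewrite !Rintegral_half_plane0.
have iF := integrable_admissible lF ap; have iG := integrable_admissible lG ap.
rewrite -(@RintegralZl _ _ _ mu2 _ _ t measurableT iG).
rewrite -(@RintegralD _ _ _ mu2 _ _ _ measurableT iF); last exact: (@integrable_RZ _ _ _ mu2).
by apply: eq_Rintegral => p _; rewrite /extend0; case: ifP => _; ring.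
Qed.

Lemma weak_partial_comb (v : R * R) (F G W Z : R * R -> R) (t : R) : coord_dir v ->
  loc_integrable F -> loc_integrable G -> weak_partial v F W -> weak_partial v G Z ->
  weak_partial v (fun p => F p + t * G p) (fun p => W p + t * Z p).
Proof.
move=> hv lF lG [lW hW] [lZ hZ]; split; first exact: loc_integrable_comb.
move=> phi tphi.
rewrite Rintegral_comb_admissible//; last exact: admissible_test_deriv.
rewrite Rintegral_comb_admissible//; last exact: admissible_test.
by rewrite hW// hZ// mulrN opprD.
Qed.

Lemma sq_comb_le (a b t : R) : (a + t * b) ^+ 2 <= 2 * a ^+ 2 + 2 * t ^+ 2 * b ^+ 2.
Proof.
rewrite -subr_ge0 (_ : _ - _ = (a - t * b) ^+ 2) ?sqr_ge0//; ring.
Qed.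

Lemma ge0_integral_comb_le d (X : measurableType d) (m : {measure set X -> \bar R}) (D : set X)
  (a b c e : R) (f g h : X -> R) : measurable D ->
  measurable_fun D f -> measurable_fun D g -> measurable_fun D h ->
  0 <= a -> 0 <= b -> (forall x, D x -> 0 <= f x) -> (forall x, D x -> 0 <= g x) ->
  (forall x, D x -> 0 <= h x <= a * f x + b * g x) ->
  (\int[m]_(x in D) (f x)%:E <= c%:E)%E -> (\int[m]_(x in D) (g x)%:E <= e%:E)%E ->
  (\int[m]_(x in D) (h x)%:E <= (a * c + b * e)%:E)%E.
Proof.
move=> mD mf mg mh a0 b0 f0 g0 hle hc he.
have mf' : measurable_fun D (EFin \o f) by exact/measurable_EFinP.
have mg' : measurable_fun D (EFin \o g) by exact/measurable_EFinP.
apply: (@le_trans _ _ (\int[m]_(x in D) (a%:E * (f x)%:E + b%:E * (g x)%:E))%E).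
  apply: ge0_le_integral => //.
  - by move=> x Dx; rewrite lee_fin; case/andP: (hle x Dx).
  - exact/measurable_EFinP.
  - by apply: emeasurable_funD; apply: emeasurable_funM.
  - by move=> x Dx; rewrite -!EFinM -EFinD lee_fin; case/andP: (hle x Dx).
rewrite ge0_integralD//; first last.
- by apply: emeasurable_funM.
- by move=> x Dx; rewrite -EFinM lee_fin mulr_ge0// g0.
- by apply: emeasurable_funM.
- by move=> x Dx; rewrite -EFinM lee_fin mulr_ge0// f0.
rewrite (@ge0_integralZl _ _ _ m _ mD _ mf')//.
rewrite (@ge0_integralZl _ _ _ m _ mD _ mg')//.
by rewrite EFinD !EFinM; apply: leeD; apply: lee_wpmul2l; rewrite ?lee_fin.
Qed.

Lemma is_trace_comb (U V : HT s T) (t : R) :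
  is_trace T (fun p => ht_fun U p + t * ht_fun V p) (fun x => ht_trace U x + t * ht_trace V x).
Proof.
move=> e e0; have e4 : 0 < e / 4 by rewrite divr_gt0.
have t1 : 0 < t ^+ 2 + 1 by rewrite ltr_wpDl ?sqr_ge0.
(* The share of V is reduced by t^2 + 1 because (a + t b)^2 <= 2 a^2 + 2 t^2 b^2. *)
have e5 : 0 < e / 4 / (t ^+ 2 + 1) by rewrite divr_gt0.
have [d1 d10 h1] := ht_is_trace U e4; have [d2 d20 h2] := ht_is_trace V e5.
exists (Num.min d1 d2); first by rewrite lt_min d10 d20.
apply: (ae_impl (ae_conj h1 h2)) => y [hU hV] /andP[y0]; rewrite lt_min => /andP[y1 y2].
have {hU} hU := hU (introT andP (conj y0 y1)).
have {hV} hV := hV (introT andP (conj y0 y2)).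
have mU : measurable_fun cell (fun x => (ht_fun U (x, y) - ht_trace U x) ^+ 2).
  apply: measurable_funTS; apply: measurable_funX; apply: measurable_funB.
    exact: measurable_slice_half_plane (measurable_ht_fun _) y0.
  exact: measurable_trace.
have mV : measurable_fun cell (fun x => (ht_fun V (x, y) - ht_trace V x) ^+ 2).
  apply: measurable_funTS; apply: measurable_funX; apply: measurable_funB.
    exact: measurable_slice_half_plane (measurable_ht_fun _) y0.
  exact: measurable_trace.
have t0 : 0 <= 2 * t ^+ 2 by rewrite mulr_ge0 ?sqr_ge0.
have h := @ge0_integral_comb_le _ _ mu cell 2 (2 * t ^+ 2) (e / 4) (e / 4 / (t ^+ 2 + 1)) _ _
  (fun x => (ht_fun U (x, y) + t * ht_fun V (x, y) - (ht_trace U x + t * ht_trace V x)) ^+ 2)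
  (measurable_cell T) mU mV.
apply: le_trans (h _ _ t0 _ _ _ hU hV) _ => //.
- apply: measurable_funTS; apply: measurable_funX; apply: measurable_funB.
    apply: measurable_funD; first exact: measurable_slice_half_plane (measurable_ht_fun _) y0.
    by apply: measurable_funM => //; exact: measurable_slice_half_plane (measurable_ht_fun _) y0.
  apply: measurable_funD; first exact: measurable_trace.
  by apply: measurable_funM => //; exact: measurable_trace.
- by move=> x _; exact: sqr_ge0.
- by move=> x _; exact: sqr_ge0.
- move=> x _; rewrite sqr_ge0 /=.
  apply: le_trans (sq_comb_le (ht_fun U (x, y) - ht_trace U x) (ht_fun V (x, y) - ht_trace V x) t).
  by rewrite le_eqVlt; apply/orP; left; apply/eqP; congr (_ ^+ 2); ring.
rewrite lee_fin -subr_ge0.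
have -> : e - (2 * (e / 4) + 2 * t ^+ 2 * (e / 4 / (t ^+ 2 + 1))) = e / 2 / (t ^+ 2 + 1).
  by field; rewrite gt_eqF.
by rewrite divr_ge0 ?divr_ge0// ltW.
Qed.

Lemma energy1_lty (U : HT s T) :
  (energy1 s T (ht_dx U) < +oo)%E /\ (energy1 s T (ht_dy U) < +oo)%E.
Proof.
by split; [apply: le_lt_trans (energy1_dx_le U) (energy_lty U)
  |apply: le_lt_trans (energy1_dy_le U) (energy_lty U)].
Qed.

Lemma measurable_hs (W : R * R -> R) : measurable_fun (half_plane R) W ->
  measurable_fun (half_strip T) W.
Proof.
by apply: measurable_funS; [exact: measurable_half_plane|exact: half_strip_half_plane].
Qed.

Lemma energy1_comb_lty (W Z : R * R -> R) (t : R) : measurable_fun (half_plane R) W ->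
  measurable_fun (half_plane R) Z -> (energy1 s T W < +oo)%E -> (energy1 s T Z < +oo)%E ->
  (energy1 s T (fun p => W p + t * Z p)%R < +oo)%E.
Proof.
move=> /measurable_hs mW /measurable_hs mZ hW hZ.
have fW : energy1 s T W \is a fin_num by rewrite ge0_fin_numE// energy1_ge0.
have fZ : energy1 s T Z \is a fin_num by rewrite ge0_fin_numE// energy1_ge0.
have t0 : 0 <= 2 * t ^+ 2 by rewrite mulr_ge0 ?sqr_ge0.
apply: le_lt_trans (ltry (2 * fine (energy1 s T W) + 2 * t ^+ 2 * fine (energy1 s T Z))).
apply: (@ge0_integral_comb_le _ _ mu2 _ _ _ _ _ (fun p => wt s p * W p ^+ 2) (fun p => wt s p * Z p ^+ 2)) => //.
- exact: measurable_half_strip.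
- by apply: measurable_funM; [exact: measurable_wt|exact: measurable_funX].
- by apply: measurable_funM; [exact: measurable_wt|exact: measurable_funX].
- apply: measurable_funM; first exact: measurable_wt.
  by apply: measurable_funX; apply: measurable_funD => //; apply: measurable_funM.
- by move=> p _; nneg.
- by move=> p _; nneg.
- move=> p _; apply/andP; split; first by nneg.
  rewrite (_ : 2 * (_ * _) + _ = wt s p * (2 * W p ^+ 2 + 2 * t ^+ 2 * Z p ^+ 2)); last by ring.
  apply: ler_wpM2l; first exact: powR_ge0.
  exact: sq_comb_le.
- by rewrite (fineK fW).
- by rewrite (fineK fZ).
Qed.

Lemma L2T_comb_lty (f g : R -> R) (t : R) : measurable_fun setT f -> measurable_fun setT g ->
  (L2T_sqnorm T f < +oo)%E -> (L2T_sqnorm T g < +oo)%E ->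
  (L2T_sqnorm T (fun x => f x + t * g x)%R < +oo)%E.
Proof.
move=> mf mg hf hg.
have ff : L2T_sqnorm T f \is a fin_num by rewrite ge0_fin_numE// L2T_sqnorm_ge0.
have fg : L2T_sqnorm T g \is a fin_num by rewrite ge0_fin_numE// L2T_sqnorm_ge0.
have t0 : 0 <= 2 * t ^+ 2 by rewrite mulr_ge0 ?sqr_ge0.
apply: le_lt_trans (ltry (2 * fine (L2T_sqnorm T f) + 2 * t ^+ 2 * fine (L2T_sqnorm T g))).
apply: (@ge0_integral_comb_le _ _ mu _ _ _ _ _ (fun x => f x ^+ 2) (fun x => g x ^+ 2)) => //.
- exact: measurable_cell.
- by apply: measurable_funTS; exact: measurable_funX.
- by apply: measurable_funTS; exact: measurable_funX.
- apply: measurable_funTS; apply: measurable_funX; apply: measurable_funD => //.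
  exact: measurable_funM.
- by move=> x _; exact: sqr_ge0.
- by move=> x _; exact: sqr_ge0.
- by move=> x _; rewrite sqr_ge0 sq_comb_le.
- by rewrite (fineK ff).
- by rewrite (fineK fg).
Qed.

Lemma finite_comb (U V : HT s T) (t : R) :
  (energy s T (fun p => ht_dx U p + t * ht_dx V p)%R (fun p => ht_dy U p + t * ht_dy V p)%R +
   L2T_sqnorm T (fun x => ht_trace U x + t * ht_trace V x)%R < +oo)%E.
Proof.
have mc (W Z : R * R -> R) : measurable_fun (half_plane R) W -> measurable_fun (half_plane R) Z ->
    measurable_fun (half_plane R) (fun p => W p + t * Z p).
  by move=> mW mZ; apply: measurable_funD => //; apply: measurable_funM.
have [u1 u2] := energy1_lty U; have [v1 v2] := energy1_lty V.
rewrite energyE; try by apply: mc; [exact: measurable_ht_dx|exact: measurable_ht_dx].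
  apply: lte_add_pinfty; last first.
    by apply: L2T_comb_lty; [exact: measurable_trace|exact: measurable_trace|exact: trace_lty|exact: trace_lty].
  apply: lte_add_pinfty; apply: energy1_comb_lty => //;
    first [exact: measurable_ht_dx | exact: measurable_ht_dy].
by apply: mc; exact: measurable_ht_dy.
Qed.

(** One operation U + t V stands for sums, multiples and differences: being elements of
    a record with its proofs, the results of each operation have to be constructed. *)
Definition comb (U : HT s T) (t : R) (V : HT s T) : HT s T.
Proof.
apply: (@MkHT R s T (fun p => ht_fun U p + t * ht_fun V p)
  (fun p => ht_dx U p + t * ht_dx V p) (fun p => ht_dy U p + t * ht_dy V p)
  (fun x => ht_trace U x + t * ht_trace V x)).
- by apply: loc_integrable_comb; exact: ht_loc.
- by move=> x y y0; rewrite !ht_per.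
- by apply: weak_partial_comb; [left|exact: ht_loc|exact: ht_loc|exact: ht_weak_dx|exact: ht_weak_dx].
- by apply: weak_partial_comb; [right|exact: ht_loc|exact: ht_loc|exact: ht_weak_dy|exact: ht_weak_dy].
- by apply: measurable_funD; [exact: measurable_trace|apply: measurable_funM => //; exact: measurable_trace].
- by move=> x; rewrite !ht_trace_per.
- exact: is_trace_comb.
- exact: finite_comb.
Defined.

(** Since |f g| <= f^2 + g^2. *)
Lemma integrable_mul_sq d (X : measurableType d) (m : {measure set X -> \bar R}) (D : set X)
    (w f g : X -> R) : measurable D -> measurable_fun D w -> measurable_fun D f ->
  measurable_fun D g -> (forall x, D x -> 0 <= w x) ->
  (\int[m]_(x in D) (w x * f x ^+ 2)%:E < +oo)%E ->
  (\int[m]_(x in D) (w x * g x ^+ 2)%:E < +oo)%E ->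
  m.-integrable D (EFin \o (fun x => w x * (f x * g x))).
Proof.
move=> mD mw mf mg w0 hf hg; apply/integrableP; split.
  by apply/measurable_EFinP; do 2 apply: measurable_funM => //.
have mf2 : measurable_fun D (fun x => w x * f x ^+ 2).
  by apply: measurable_funM => //; exact: measurable_funX.
have mg2 : measurable_fun D (fun x => w x * g x ^+ 2).
  by apply: measurable_funM => //; exact: measurable_funX.
have p0 (h : X -> R) x : D x -> 0 <= w x * h x ^+ 2 by move=> Dx; rewrite mulr_ge0 ?sqr_ge0// w0.
have ff : (\int[m]_(x in D) (w x * f x ^+ 2)%:E)%E \is a fin_num.
  by rewrite ge0_fin_numE//; apply: integral_ge0 => x Dx; rewrite lee_fin p0.
have fg : (\int[m]_(x in D) (w x * g x ^+ 2)%:E)%E \is a fin_num.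
  by rewrite ge0_fin_numE//; apply: integral_ge0 => x Dx; rewrite lee_fin p0.
apply: le_lt_trans (ltry (1 * fine (\int[m]_(x in D) (w x * f x ^+ 2)%:E)%E +
  1 * fine (\int[m]_(x in D) (w x * g x ^+ 2)%:E)%E)).
apply: (@ge0_integral_comb_le _ _ m D 1 1 _ _ (fun x => w x * f x ^+ 2) (fun x => w x * g x ^+ 2)
  (fun x => `|w x * (f x * g x)|)) => //.
- by apply: measurableT_comp => //; do 2 apply: measurable_funM => //.
- by move=> x Dx; exact: p0.
- by move=> x Dx; exact: p0.
- move=> x Dx; rewrite normr_ge0 /= !mul1r normrM (ger0_norm (w0 _ Dx)) -mulrDr.
  apply: ler_wpM2l; first exact: w0.
  rewrite normrM -[f x ^+ 2]real_normK ?num_real// -[g x ^+ 2]real_normK ?num_real//.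
  have a0 := normr_ge0 (f x); have b0 := normr_ge0 (g x).
  have := sqr_ge0 (`|f x| - `|g x|); have := sqr_ge0 (`|f x| + `|g x|).
  by move: `|f x| `|g x| a0 b0 => a b a0 b0; rewrite !expr2 => h1 h2; nra.
- by rewrite (fineK ff).
- by rewrite (fineK fg).
Qed.

Definition cell_form (kappa : R -> R) (f g : R -> R) : R :=
  \int[mu]_(x in cell) (kappa x * (f x * g x)).

Lemma integrable_cell_form (kappa f g : R -> R) (M : R) : measurable_fun setT kappa ->
  (forall x, 0 <= kappa x <= M) -> measurable_fun setT f -> measurable_fun setT g ->
  (L2T_sqnorm T f < +oo)%E -> (L2T_sqnorm T g < +oo)%E ->
  mu.-integrable cell (EFin \o (fun x => kappa x * (f x * g x))).
Proof.
move=> mk hk mf mg hf hg.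
have b (h : R -> R) : measurable_fun setT h -> (L2T_sqnorm T h < +oo)%E ->
    (\int[mu]_(x in cell) (kappa x * h x ^+ 2)%:E < +oo)%E.
  move=> mh hh; have M0 : 0 <= M by case/andP: (hk 0); exact: le_trans.
  have fh : L2T_sqnorm T h \is a fin_num by rewrite ge0_fin_numE// L2T_sqnorm_ge0.
  apply: (@le_lt_trans _ _ (M%:E * L2T_sqnorm T h)%E); last by rewrite -(fineK fh) -EFinM ltry.
  rewrite -ge0_integralZl//; try exact: measurable_cell.
  - apply: ge0_le_integral => //; try exact: measurable_cell.
    + by move=> x _; rewrite lee_fin mulr_ge0 ?sqr_ge0//; case/andP: (hk x).
    + apply: measurable_funTS; apply/measurable_EFinP; apply: measurable_funM => //.
      exact: measurable_funX.
    + apply: measurable_funTS; apply/measurable_EFinP; apply: measurable_funM => //.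
      exact: measurable_funX.
    + by move=> x _; rewrite -EFinM lee_fin ler_wpM2r ?sqr_ge0//; case/andP: (hk x).
  - by apply: measurable_funTS; apply/measurable_EFinP; exact: measurable_funX.
  - by move=> x _; rewrite lee_fin sqr_ge0.
apply: integrable_mul_sq; try exact: measurable_funTS.
- exact: measurable_cell.
- by move=> x _; case/andP: (hk x).
- exact: b.
- exact: b.
Qed.

Lemma integrable_energy_form (U V : HT s T) : mu2.-integrable (half_strip T)
  (EFin \o (fun p => wt s p * (ht_dx U p * ht_dx V p + ht_dy U p * ht_dy V p))).
Proof.
have mS := measurable_half_strip T.
have [u1 u2] := energy1_lty U; have [v1 v2] := energy1_lty V.
have w0 (p : R * R) : half_strip T p -> 0 <= wt s p by move=> _; exact: powR_ge0.
have i1 := @integrable_mul_sq _ _ mu2 _ (wt s) (ht_dx U) (ht_dx V) mS (@measurable_wt R s _)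
  (measurable_hs (measurable_ht_dx U)) (measurable_hs (measurable_ht_dx V)) w0 u1 v1.
have i2 := @integrable_mul_sq _ _ mu2 _ (wt s) (ht_dy U) (ht_dy V) mS (@measurable_wt R s _)
  (measurable_hs (measurable_ht_dy U)) (measurable_hs (measurable_ht_dy V)) w0 u2 v2.
have := @integrable_RD _ _ _ mu2 _ mS _ _ i1 i2.
by apply: eq_integrable => // p _ /=; rewrite mulrDr.
Qed.

Lemma energy_formC (U V : HT s T) : energy_form U V = energy_form V U.
Proof. by apply: eq_Rintegral => p _; congr (_ * (_ + _)); rewrite mulrC. Qed.

Lemma energy_form_combr (U V W : HT s T) t :
  energy_form U (comb V t W) = energy_form U V + t * energy_form U W.
Proof.
have mS := measurable_half_strip T.
have i1 := integrable_energy_form U V; have i2 := integrable_energy_form U W.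
rewrite /energy_form -(@RintegralZl _ _ _ mu2 _ _ t mS i2).
rewrite -(@RintegralD _ _ _ mu2 _ _ _ mS i1); last exact: (@integrable_RZ _ _ _ mu2 _ mS).
by apply: eq_Rintegral => p _ /=; rewrite /wt; ring.
Qed.

Lemma energy_form_diag (U : HT s T) : (energy_form U U)%:E = energy s T (ht_dx U) (ht_dy U).
Proof.
have fE : energy s T (ht_dx U) (ht_dy U) \is a fin_num.
  by rewrite ge0_fin_numE ?energy_ge0// energy_lty.
by rewrite -(fineK fE).
Qed.

End linear_combinations.

(** * Completeness of H_T *)

Section completeness.
Context {R : realType} (s T : R) (hs : 0 < s < 1) (hT : 0 < T).
Local Notation mu := (@lebesgue_measure R).
Local Notation mu2 := (mu \x mu)%E.
Local Notation cell := (period_cell T).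

Let s0 : 0 < s. Proof. by case/andP: hs. Qed.

Definition ht_sqnorm (U : HT s T) : \bar R :=
  (energy s T (ht_dx U) (ht_dy U) + L2T_sqnorm T (ht_trace U))%E.

(** Functions of finite energy need not be square integrable on the half-strip (the
    constants are not), so their convergence is measured with a decaying weight. *)
Definition exp_wt (p : R * R) : R := expR (- p.2).

Lemma measurable_exp_wt : measurable_fun setT exp_wt.
Proof. by apply: measurableT_comp; [exact: measurable_expR|apply: measurableT_comp]. Qed.

Lemma integral_exp_wtV r : 0 < r -> (\int[mu2]_(p in strip T r) ((exp_wt p)^-1)%:E < +oo)%E.
Proof.
move=> r0; have mC := measurable_cell T.
have mI : measurable (`]0, r]%classic : set R) by exact: measurable_itv.
have e0 : 0 <= expR r by exact: expR_ge0.
apply: (@le_lt_trans _ _ (\int[mu2]_(p in strip T r) (expR r)%:E)%E).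
  apply: ge0_le_integral => //.
  - exact: measurable_strip.
  - by move=> p _; rewrite lee_fin invr_ge0 expR_ge0.
  - have -> : (fun p => ((exp_wt p)^-1)%:E) = (fun p : R * R => (expR p.2)%:E).
      by apply/funext => p; rewrite /exp_wt expRN invrK.
    apply: measurable_funTS; apply/measurable_EFinP.
    by apply: measurableT_comp => //; exact: measurable_expR.
  move=> p [_ /=]; rewrite in_itv /= => /andP[_ pr].
  by rewrite /exp_wt expRN invrK lee_fin ler_expR.
rewrite /strip (@tonelli_rect2 _ cell `]0, r]%classic (fun=> (expR r)%:E))//.
under eq_integral do rewrite integral_cst_cell//.
rewrite integral_cst// lte_mul_pinfty ?lee_fin ?mulr_ge0 ?(ltW hT)//.
have fi : (mu `]0%R, r]%classic < +oo)%E by rewrite lebesgue_measure_itv /= lte_fin r0 -EFinD ltry.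
exact: fi.
Qed.

Variables (Un : nat -> HT s T) (K : R).
Hypothesis cauchy : forall n m, (n <= m)%N ->
  (ht_sqnorm (comb (Un m) (-1) (Un n)) <= (K * 8 ^- n)%:E)%E.

Let F n := ht_fun (Un n).
Let W1 n := ht_dx (Un n).
Let W2 n := ht_dy (Un n).
Let u n := ht_trace (Un n).

Let K0 : 0 <= K.
Proof.
have := cauchy (leqnn 0); rewrite expr0 invr1 mulr1 -lee_fin; apply: le_trans.
by apply: adde_ge0; [exact: energy_ge0|exact: L2T_sqnorm_ge0].
Qed.

Let cauchy_energy n m : (n <= m)%N ->
  (energy s T (ht_dx (comb (Un m) (-1) (Un n))) (ht_dy (comb (Un m) (-1) (Un n))) <= (K * 8 ^- n)%:E)%E.
Proof. by move=> /cauchy; apply: le_trans; rewrite leeDl// L2T_sqnorm_ge0. Qed.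

Let cauchy_dx n m : (n <= m)%N ->
  (\int[mu2]_(p in half_strip T) (wt s p * (W1 m p - W1 n p) ^+ 2)%:E <= (K * 8 ^- n)%:E)%E.
Proof.
move=> nm; apply: le_trans (cauchy_energy nm); apply: le_trans (energy1_dx_le _).
by rewrite le_eqVlt; apply/orP; left; apply/eqP; apply: eq_integral => p _; rewrite /= mulN1r.
Qed.

Let cauchy_dy n m : (n <= m)%N ->
  (\int[mu2]_(p in half_strip T) (wt s p * (W2 m p - W2 n p) ^+ 2)%:E <= (K * 8 ^- n)%:E)%E.
Proof.
move=> nm; apply: le_trans (cauchy_energy nm); apply: le_trans (energy1_dy_le _).
by rewrite le_eqVlt; apply/orP; left; apply/eqP; apply: eq_integral => p _; rewrite /= mulN1r.
Qed.

Let cauchy_fun : exists C : R, forall n m, (n <= m)%N ->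
  (\int[mu2]_(p in half_strip T) (exp_wt p * (F m p - F n p) ^+ 2)%:E <= (C * K * 8 ^- n)%:E)%E.
Proof.
have [C C0 hC] := exp_weight_bound hs hT; exists C => n m nm.
have := hC (comb (Un m) (-1) (Un n)).
rewrite (_ : (\int[mu2]_(p in half_strip T) (expR (- p.2) * ht_fun (comb (Un m) (-1) (Un n)) p ^+ 2)%:E
  = \int[mu2]_(p in half_strip T) (exp_wt p * (F m p - F n p) ^+ 2)%:E)%E); last first.
  by apply: eq_integral => p _; rewrite /= mulN1r.
move=> /le_trans; apply; rewrite -mulrA EFinM; apply: lee_wpmul2l; first by rewrite lee_fin.
exact: cauchy.
Qed.

Let cauchy_trace n m : (n <= m)%N ->
  (\int[mu]_(x in cell) (1 * (u m x - u n x) ^+ 2)%:E <= (K * 8 ^- n)%:E)%E.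
Proof.
move=> /cauchy; apply: le_trans; apply: (@le_trans _ _ (L2T_sqnorm T (ht_trace (comb (Un m) (-1) (Un n))))).
  by rewrite le_eqVlt; apply/orP; left; apply/eqP; apply: eq_integral => x _; rewrite /= mulN1r mul1r.
by rewrite leeDr// energy_ge0.
Qed.

Let U := seq_limit F.
Let V1 := seq_limit W1.
Let V2 := seq_limit W2.
Let v := seq_limit u.

Let perU x y : 0 < y -> U (x + T, y) = U (x, y).
Proof.
move=> y0; rewrite /U /seq_limit; congr (fine (limn_esup _)).
by apply/funext => n; rewrite /F ht_per.
Qed.

Let ae_perF n : ae_periodic T (F n).
Proof. by apply: aeW => -[x y] /= y0; rewrite /shift_x /F ht_per. Qed.
Let ae_per1 n : ae_periodic T (W1 n).
Proof.
apply: (ae_periodic_partial _ (ht_loc (Un n)) _ (ht_weak_dx (Un n))); first by left.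
exact: ht_per.
Qed.
Let ae_per2 n : ae_periodic T (W2 n).
Proof.
apply: (ae_periodic_partial _ (ht_loc (Un n)) _ (ht_weak_dy (Un n))); first by right.
exact: ht_per.
Qed.

Let mF n : measurable_fun (half_plane R) (F n). Proof. exact: measurable_ht_fun. Qed.
Let mW1 n : measurable_fun (half_plane R) (W1 n). Proof. exact: measurable_ht_dx. Qed.
Let mW2 n : measurable_fun (half_plane R) (W2 n). Proof. exact: measurable_ht_dy. Qed.
Let mu_ n : measurable_fun setT (u n). Proof. exact: measurable_trace. Qed.
Let iF n r : 0 < r -> mu2.-integrable (strip T r) (EFin \o F n).
Proof. exact: integrable_fun. Qed.
Let i1 n r : 0 < r -> mu2.-integrable (strip T r) (EFin \o W1 n).
Proof. exact: integrable_dx. Qed.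
Let i2 n r : 0 < r -> mu2.-integrable (strip T r) (EFin \o W2 n).
Proof. exact: integrable_dy. Qed.
Let ew0 (p : R * R) : 0 < p.2 -> 0 < exp_wt p. Proof. by move=> _; exact: expR_gt0. Qed.
Let mwt : measurable_fun setT (wt s). Proof. exact: measurable_wt. Qed.

Let lU : loc_integrable U.
Proof.
have [C hC] := cauchy_fun.
exact: (loc_integrable_limit hT measurable_exp_wt ew0 integral_exp_wtV mF ae_perF iF hC).
Qed.

Let weak1 : weak_partial (e_x R) U V1.
Proof.
have [C hC] := cauchy_fun; have wV := integral_wtV hs hT.
have l1 := loc_integrable_limit hT mwt (@wt_gt0 R s) wV mW1 ae_per1 i1 cauchy_dx.
split => // phi tphi.
have aD := admissible_test_deriv (or_introl (erefl _) : coord_dir (e_x R)) tphi.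
have c0 := cvg_limit_test hT measurable_exp_wt ew0 integral_exp_wtV mF ae_perF iF hC aD.
have c1 := cvg_limit_test hT mwt (@wt_gt0 R s) wV mW1 ae_per1 i1 cauchy_dx (admissible_test tphi).
apply: (cvg_unique _ c0 _) => //.
have -> : (fun n => \int[mu2]_(p in half_plane R) (F n p * 'D_(e_x R) phi p)) =
    (fun n => - \int[mu2]_(p in half_plane R) (W1 n p * phi p)).
  by apply/funext => n; exact: (ht_weak_dx (Un n)).2.
exact: cvgN.
Qed.

Let weak2 : weak_partial (e_y R) U V2.
Proof.
have [C hC] := cauchy_fun; have wV := integral_wtV hs hT.
have l1 := loc_integrable_limit hT mwt (@wt_gt0 R s) wV mW2 ae_per2 i2 cauchy_dy.
split => // phi tphi.
have aD := admissible_test_deriv (or_intror (erefl _) : coord_dir (e_y R)) tphi.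
have c0 := cvg_limit_test hT measurable_exp_wt ew0 integral_exp_wtV mF ae_perF iF hC aD.
have c1 := cvg_limit_test hT mwt (@wt_gt0 R s) wV mW2 ae_per2 i2 cauchy_dy (admissible_test tphi).
apply: (cvg_unique _ c0 _) => //.
have -> : (fun n => \int[mu2]_(p in half_plane R) (F n p * 'D_(e_y R) phi p)) =
    (fun n => - \int[mu2]_(p in half_plane R) (W2 n p * phi p)).
  by apply/funext => n; exact: (ht_weak_dy (Un n)).2.
exact: cvgN.
Qed.

Let mv : measurable_fun setT v. Proof. exact: measurable_seq_limit. Qed.

Let perv : periodic v T.
Proof.
move=> x; rewrite /v /seq_limit; congr (fine (limn_esup _)).
by apply/funext => n; rewrite /u ht_trace_per.
Qed.

Let dist_trace n : (\int[mu]_(x in cell) (1 * (v x - u n x) ^+ 2)%:E <= (K * 8 ^- n)%:E)%E.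
Proof.
apply: (@seq_limit_dist _ _ _ mu cell (measurable_cell T) (fun=> 1)) => //.
by move=> m; exact: (measurable_funTS (mu_ m)).
Qed.

Let dist1 n : (\int[mu2]_(p in half_strip T) (wt s p * (V1 p - W1 n p) ^+ 2)%:E <= (K * 8 ^- n)%:E)%E.
Proof. exact: (limit_dist mwt (@wt_gt0 R s) mW1 cauchy_dx). Qed.

Let dist2 n : (\int[mu2]_(p in half_strip T) (wt s p * (V2 p - W2 n p) ^+ 2)%:E <= (K * 8 ^- n)%:E)%E.
Proof. exact: (limit_dist mwt (@wt_gt0 R s) mW2 cauchy_dy). Qed.

Let mUy (y : R) : 0 < y -> measurable_fun setT (fun x => U (x, y)).
Proof. exact: measurable_slice_half_plane lU.1. Qed.

(** The bound of [trace_slice_bound] for the differences Un m - Un 0, whose energies are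
    at most K, passes to the limit in m by Fatou's lemma. *)
Let slice : {ae mu, forall y, 0 < y ->
  (\int[mu]_(x in cell) ((U (x, y) - F 0%N (x, y) - (v x - u 0%N x)) ^+ 2)%:E <=
   (y `^ (2 * s) / (2 * s) * K)%:E)%E}.
Proof.
have sb (m : nat) := trace_slice_bound hs hT (comb (Un m) (-1) (Un 0)).
have [C hC] := cauchy_fun.
have mS := measurable_half_strip T.
have mFs n : measurable_fun (half_strip T) (F n) by exact: measurable_hs.
have ew0' p : half_strip T p -> 0 < exp_wt p by move=> _; exact: expR_gt0.
have cU := @ae_cvg_seq_limit _ _ _ mu2 _ mS exp_wt (measurable_funTS measurable_exp_wt) ew0' F _ mFs hC.
have muc n : measurable_fun cell (u n) by exact: measurable_funTS.
have cv := @ae_cvg_seq_limit _ _ _ mu _ (measurable_cell T) (fun=> 1) (measurable_cst _) (fun _ _ => ltr01) u _ muc cauchy_trace.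
apply: (ae_impl (ae_conj (ae_foralln sb) (ae_slice2 cU))) => y [hy cy] y0.
have mFy n : measurable_fun setT (fun x => F n (x, y)) by exact: measurable_slice_half_plane (mF n) y0.
have mA (a b : R -> R) (c d : R -> R) : measurable_fun setT a -> measurable_fun setT b ->
    measurable_fun setT c -> measurable_fun setT d ->
    measurable_fun cell (fun x => (a x - b x - (c x - d x)) ^+ 2).
  move=> ma mb mc md; apply: measurable_funTS; apply: measurable_funX.
  exact: (measurable_funB (measurable_funB ma mb) (measurable_funB mc md)).
apply: (@ge0_integral_limit_le _ _ _ mu cell
  (fun m x => (F m (x, y) - F 0%N (x, y) - (u m x - u 0%N x)) ^+ 2) _ _ 0).
- exact: measurable_cell.
- by move=> m; exact: mA.
- by apply: mA => //; exact: mUy.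
- by move=> m x _; exact: sqr_ge0.
- by move=> x _; exact: sqr_ge0.
- apply: (ae_impl (ae_conj cy cv)) => x [hU hv] xc.
  have h : F m (x, y) - F 0%N (x, y) - (u m x - u 0%N x) @[m --> \oo] -->
      U (x, y) - F 0%N (x, y) - (v x - u 0%N x).
    apply: cvgB; apply: cvgB; try exact: cvg_cst.
      by apply: hU; split.
    exact: hv.
  by under eq_fun do rewrite expr2; rewrite expr2; exact: cvgM.
move=> m _; have := hy m y0.
rewrite (_ : (\int[mu]_(x in cell) ((ht_fun (comb (Un m) (-1) (Un 0)) (x, y) -
    ht_trace (comb (Un m) (-1) (Un 0)) x) ^+ 2)%:E =
  \int[mu]_(x in cell) ((F m (x, y) - F 0%N (x, y) - (u m x - u 0%N x)) ^+ 2)%:E)%E); last first.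
  by apply: eq_integral => x _; rewrite /= !mulN1r.
move=> /le_trans; apply; rewrite (EFinM _ K); apply: lee_wpmul2l.
  by rewrite lee_fin divr_ge0 ?powR_ge0// mulr_ge0// ltW.
apply: le_trans (energy1_dy_le _) _; apply: le_trans (cauchy_energy (leq0n m)) _.
by rewrite expr0 invr1 mulr1.
Qed.

(** Combine [slice] with the trace property of Un 0; d2 is the height at which
    y^(2s) K / (2 s) stays below e / 4. *)
Let tr : is_trace T U v.
Proof.
move=> e e0; have e4 : 0 < e / 4 by rewrite divr_gt0.
have [d1 d10 h1] := ht_is_trace (Un 0) e4.
have K1 : 0 < K + 1 by rewrite ltr_wpDl.
have s20 : 0 < 2 * s by rewrite mulr_gt0.
pose q := e / 4 * (2 * s) / (K + 1).
have q0 : 0 < q by rewrite /q divr_gt0// mulr_gt0.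
pose d2 := q `^ (2 * s)^-1; have d20 : 0 < d2 by rewrite powR_gt0.
exists (Num.min d1 d2); first by rewrite lt_min d10.
apply: (ae_impl (ae_conj h1 slice)) => y [hU hV] /andP[y0]; rewrite lt_min => /andP[y1 y2].
have {hU} hU := hU (introT andP (conj y0 y1)).
have {hV} hV := hV y0.
have hy : y `^ (2 * s) / (2 * s) * K <= e / 4.
  have hq : y `^ (2 * s) <= q.
    have -> : q = d2 `^ (2 * s) by rewrite /d2 -powRrM mulVf ?gt_eqF// powRr1// ltW.
    by apply: ge0_ler_powR; rewrite ?nnegrE ?(ltW s20) ?(ltW y0) ?(ltW d20) ?(ltW y2).
  apply: (@le_trans _ _ (q / (2 * s) * K)).
    by rewrite ler_wpM2r// ler_wpM2r// invr_ge0 ltW.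
  rewrite /q (_ : _ * K = e / 4 * (K / (K + 1))); last by field; rewrite !gt_eqF.
  by rewrite ler_piMr ?(ltW e4)// ler_pdivrMr// mul1r lerDl.
have mFy n : measurable_fun setT (fun x => F n (x, y)) by exact: measurable_slice_half_plane (mF n) y0.
have mU' := mUy y0.
have m1 : measurable_fun cell (fun x => (U (x, y) - F 0%N (x, y) - (v x - u 0%N x)) ^+ 2).
  by apply: measurable_funTS; apply: measurable_funX; apply: measurable_funB; apply: measurable_funB.
have m2 : measurable_fun cell (fun x => (F 0%N (x, y) - u 0%N x) ^+ 2).
  by apply: measurable_funTS; apply: measurable_funX; apply: measurable_funB.
have hV' : (\int[mu]_(x in cell) ((U (x, y) - F 0%N (x, y) - (v x - u 0%N x)) ^+ 2)%:E <= (e / 4)%:E)%E.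
  by apply: le_trans hV _; rewrite lee_fin.
have h := @ge0_integral_comb_le _ _ _ mu cell 2 2 (e / 4) (e / 4) _ _
  (fun x => (U (x, y) - v x) ^+ 2) (measurable_cell T) m1 m2.
apply: le_trans (h _ _ _ _ _ _ hV' hU) _ => //.
- by apply: measurable_funTS; apply: measurable_funX; apply: measurable_funB.
- by move=> x _; exact: sqr_ge0.
- by move=> x _; exact: sqr_ge0.
- move=> x _; rewrite sqr_ge0 /=.
  have := sq_comb_le (U (x, y) - F 0%N (x, y) - (v x - u 0%N x)) (F 0%N (x, y) - u 0%N x) 1.
  rewrite expr1n mulr1 mul1r; apply: le_trans.
  by rewrite le_eqVlt; apply/orP; left; apply/eqP; congr (_ ^+ 2); ring.
rewrite lee_fin; lra.
Qed.

Let fin : (energy s T V1 V2 + L2T_sqnorm T v < +oo)%E.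
Proof.
have E1 (W : nat -> R * R -> R) (V : R * R -> R) : measurable_fun (half_plane R) V ->
    measurable_fun (half_plane R) (W 0%N) -> (energy1 s T (W 0%N) < +oo)%E ->
    (\int[mu2]_(p in half_strip T) (wt s p * (V p - W 0%N p) ^+ 2)%:E <= (K * 8 ^- 0)%:E)%E ->
    (energy1 s T V < +oo)%E.
  move=> mV mW hW hV.
  have := @energy1_comb_lty R s T (fun p => V p - W 0%N p) (W 0%N) 1.
  rewrite (_ : (fun p => V p - W 0%N p + 1 * W 0%N p) = V); last first.
    by apply/funext => p; rewrite mul1r subrK.
  apply => //; first exact: measurable_funB.
  by apply: le_lt_trans hV _; exact: ltry.
rewrite energyE; [|exact: weak1.1.1|exact: weak2.1.1].
have [e1 e2] := energy1_lty (Un 0).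
apply: lte_add_pinfty; first apply: lte_add_pinfty.
- by apply: (E1 W1) => //; exact: weak1.1.1.
- by apply: (E1 W2) => //; exact: weak2.1.1.
have := @L2T_comb_lty R T (fun x => v x - u 0%N x) (u 0%N) 1.
rewrite (_ : (fun x => v x - u 0%N x + 1 * u 0%N x) = v); last first.
  by apply/funext => x; rewrite mul1r subrK.
apply => //; first exact: measurable_funB.
  apply: le_lt_trans (ltry (K * 8 ^- 0)); apply: le_trans (dist_trace 0).
  by rewrite le_eqVlt; apply/orP; left; apply/eqP; apply: eq_integral => x _; rewrite mul1r.
exact: trace_lty.
Qed.

(** The three terms of the norm, for the two partial derivatives and the trace, converge
    separately at the rate 8^-n of the sequence. *)
Lemma ht_complete : exists V : HT s T, forall n,
  (ht_sqnorm (comb V (-1) (Un n)) <= (3 * K * 8 ^- n)%:E)%E.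
Proof.
exists (@MkHT R s T U V1 V2 v lU perU weak1 weak2 mv perv tr fin) => n.
have m1 : measurable_fun (half_plane R) (fun p => V1 p + -1 * W1 n p).
  by apply: measurable_funD; [exact: weak1.1.1|apply: measurable_funM].
have m2 : measurable_fun (half_plane R) (fun p => V2 p + -1 * W2 n p).
  by apply: measurable_funD; [exact: weak2.1.1|apply: measurable_funM].
rewrite /ht_sqnorm /= (energyE s T m1 m2).
rewrite (_ : (3 * K * 8 ^- n)%:E = ((K * 8 ^- n)%:E + (K * 8 ^- n)%:E + (K * 8 ^- n)%:E)%E); last first.
  by rewrite -!EFinD; congr EFin; ring.
apply: leeD; first apply: leeD.
- apply: le_trans (dist1 n); rewrite le_eqVlt; apply/orP; left; apply/eqP.
  by apply: eq_integral => p _; rewrite mulN1r.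
- apply: le_trans (dist2 n); rewrite le_eqVlt; apply/orP; left; apply/eqP.
  by apply: eq_integral => p _; rewrite mulN1r.
- apply: le_trans (dist_trace n); rewrite le_eqVlt; apply/orP; left; apply/eqP.
  by apply: eq_integral => x _; rewrite /= mulN1r mul1r.
Qed.

End completeness.

(** * Minimisation of a quadratic functional *)

Section quadratic_minimisation.
Context {R : realType} (H : Type) (cb : H -> R -> H -> H) (B : H -> H -> R) (l : H -> R) (G : R).
Hypotheses (Bsym : forall U V, B U V = B V U)
  (Bcb : forall U V W t, B U (cb V t W) = B U V + t * B U W)
  (lcb : forall V W t, l (cb V t W) = l V + t * l W)
  (Bge0 : forall U, 0 <= B U U)
  (lB : forall U, 2 * l U <= B U U + G)
  (Bcomplete : forall (Un : nat -> H) (K : R),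
    (forall n m, (n <= m)%N -> B (cb (Un m) (-1) (Un n)) (cb (Un m) (-1) (Un n)) <= K * 8 ^- n) ->
    exists (U : H) (K' : R), forall n, B (cb U (-1) (Un n)) (cb U (-1) (Un n)) <= K' * 8 ^- n).

Let J U := B U U - 2 * l U.

Let Bcbl U V W t : B (cb V t W) U = B V U + t * B W U.
Proof. by rewrite Bsym Bcb (Bsym U V) (Bsym U W). Qed.

(** With a = B U V - l V and b = B V V, the value of J at U - t V is
    J U - 2 t a + t^2 b. The choice t = a / (b + 1) makes sense even for b = 0 and lowers J
    by a^2 (b + 2) / (b + 1)^2, so a must be 0. *)
Lemma quadratic_min_solves (U V : H) : (forall W, J U <= J W) -> B U V = l V.
Proof.
move=> hmin; set a := B U V - l V; set b := B V V.
have b0 : 0 <= b by exact: Bge0.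
have b1 : 0 < b + 1 by rewrite ltr_wpDl.
have := hmin (cb U (- (a / (b + 1))) V); rewrite /J lcb Bcb !Bcbl (Bsym V U).
set t := a / (b + 1); rewrite -/b.
have -> : B U U + - t * B U V + - t * (B U V + - t * b) - 2 * (l U + - t * l V) =
    B U U - 2 * l U - (2 * t * a - t ^+ 2 * b) by rewrite /a; ring.
rewrite lerBrDr -[leRHS]addr0 lerD2l.
have -> : 2 * t * a - t ^+ 2 * b = a ^+ 2 * (b + 2) / (b + 1) ^+ 2.
  by rewrite /t; field; rewrite gt_eqF.
rewrite pmulr_lle0 ?invr_gt0 ?exprn_gt0// pmulr_lle0; last by rewrite ltr_wpDl.
move=> a0; apply/eqP; rewrite -subr_eq0 -/a -sqrf_eq0 eq_le a0 sqr_ge0.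
by [].
Qed.

(** The parallelogram identity: J at the midpoint of Un n and Un p is at least the
    infimum, so B of their difference is at most twice the sum of the two excesses.
    The value at the limit U is bounded from above by comparison with the
    reflection 2 Un n - U. *)
Lemma quadratic_min_exists (U0 : H) : exists U, forall W, J U <= J W.
Proof.
have Jge U : - G <= J U by rewrite /J lerBrDr addrC lerBlDr.
pose S : set R := range J.
have S0 : has_inf S.
  by split; [exists (J U0); exists U0|exists (- G) => _ [U _ <-]].
pose m := inf S.
have mJ U : m <= J U by apply: ge_inf; [case: S0|exists U].
have near_m (n : nat) : exists U, J U <= m + 8 ^- n.
  have e0 : 0 < 8 ^- n :> R by rewrite invr_gt0 exprn_gt0.
  have [_ [U _ <-] hU] := inf_adherent e0 S0.
  by exists U; exact: ltW.
have [Un hUn] := choice near_m.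
have e8 n p : (n <= p)%N -> (8 ^- p : R) <= 8 ^- n.
  by move=> np; rewrite lef_pV2 ?posrE ?exprn_gt0// ler_weXn2l// ler1n.
have [|U [K hU]] := Bcomplete (Un := Un) (K := 4).
  move=> n p np.
  (* The second argument is the midpoint of Un n and Un p. *)
  have hM := mJ (cb (Un n) 2^-1 (cb (Un p) (-1) (Un n))).
  have := hUn n; have := hUn p; have := e8 _ _ np; move: hM.
  rewrite /J !(lcb, Bcb, Bcbl) (Bsym (Un p) (Un n)).
  set x := B (Un n) (Un n); set y := B (Un n) (Un p); set z := B (Un p) (Un p).
  set c := l (Un n); set d := l (Un p); set e := 8 ^- n; set f := 8 ^- p.
  move: x y z c d e f (m) => x y z c d e f q.
  lra.
exists U => W; apply: le_trans (mJ W).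
have Jle n : J U <= m + (2 + 2 * K) * 8 ^- n.
  (* The point Un n - (U - Un n) is the reflection of U in Un n. *)
  have := mJ (cb (Un n) (-1) (cb U (-1) (Un n))); have := hU n; have := hUn n.
  rewrite /J !(lcb, Bcb, Bcbl) (Bsym U (Un n)).
  set x := B (Un n) (Un n); set y := B (Un n) U; set z := B U U.
  set c := l (Un n); set d := l U; set e := 8 ^- n.
  have -> : (2 + 2 * K) * e = 2 * e + 2 * (K * e) by ring.
  move: (K * e) => Ke.
  move: x y z c d e (m) => x y z c d e q.
  lra.
have cv : m + (2 + 2 * K) * 8 ^- n @[n --> \oo] --> m + (2 + 2 * K) * 0.
  apply: cvgD; first exact: cvg_cst.
  apply: cvgM; first exact: cvg_cst.
  under eq_fun do rewrite -exprVn.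
  by apply: cvg_expr; rewrite ger0_norm ?invr_ge0// invf_lt1// ltr1n.
rewrite -[m]addr0 -(mulr0 (2 + 2 * K)) -(cvg_lim _ cv)//.
by apply: limr_ge; [by apply/cvg_ex; exists (m + (2 + 2 * K) * 0)|exact: nearW].
Qed.

Lemma quadratic_solution (U0 : H) : exists U, forall V, B U V = l V.
Proof.
have [U hU] := quadratic_min_exists U0.
by exists U => V; exact: quadratic_min_solves.
Qed.

End quadratic_minimisation.

(** * Integrals of functions known up to null sets *)

Section integrals_up_to_null_sets.
Context d (X : measurableType d) (R : realType) (m : {measure set X -> \bar R}).

(** The integral of a nonnegative function is a supremum over simple functions below
    it, and this supremum is monotone even for functions that are not measurable. *)
Lemma ge0_integral_mono (f g : X -> \bar R) : (forall x, 0 <= f x)%E ->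
  (forall x, f x <= g x)%E -> (\int[m]_x f x <= \int[m]_x g x)%E.
Proof.
move=> f0 fg; have g0 x : (0 <= g x)%E by exact: le_trans (fg x).
rewrite !ge0_integralTE//; apply: le_ereal_sup => _ [h /= hf <-].
by exists h => //= x; exact: le_trans (hf x) (fg x).
Qed.

(** Outside measurable functions the integral is still a supremum over simple functions,
    hence monotone; f lies between the two Borel functions obtained
    from g by the values 0 and +oo on the exceptional null set, and these have the
    same integral as g. *)
Lemma ge0_integral_ae_eq (f g : X -> \bar R) : (forall x, 0 <= f x)%E ->
  (forall x, 0 <= g x)%E -> measurable_fun setT g -> {ae m, forall x, f x = g x} ->
  (\int[m]_x f x = \int[m]_x g x)%E.
Proof.
move=> f0 g0 mg [N [mN N0 fgN]].
have fgE x : ~ N x -> f x = g x by move=> nN; apply: contrapT => /fgN.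
pose lo x : \bar R := if x \in N then 0%E else g x.
pose hi x : \bar R := if x \in N then +oo%E else g x.
have mlh (c : \bar R) : measurable_fun setT (fun x => if x \in N then c else g x).
  by apply: measurable_fun_if => //; [|exact: measurable_funTS];
    apply: (measurable_fun_bool true); rewrite setTI preimage_mem_true.
have e (c : \bar R) : (0 <= c)%E -> (\int[m]_x (if x \in N then c else g x) = \int[m]_x g x)%E.
  move=> c0; apply: ge0_ae_eq_integral => //.
  - by move=> x _; case: ifP.
  - exists N; split => // x /= nx; apply: contrapT => nN; apply: nx => _.
    by rewrite memNset.
apply/eqP; rewrite eq_le; apply/andP; split.
  rewrite -(e +oo%E)//; apply: ge0_integral_mono => // x.
  by case: ifPn => [_|]; [exact: leey|rewrite notin_setE => /fgE ->].
rewrite -(e 0%E)//; apply: ge0_integral_mono => x; first by case: ifP.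
by case: ifPn => [_//|]; rewrite notin_setE => /fgE ->.
Qed.

Lemma Rintegral_ae_eq (D : set X) (f g : X -> R) : measurable D -> measurable_fun D g ->
  {ae m, forall x, D x -> f x = g x} -> \int[m]_(x in D) f x = \int[m]_(x in D) g x.
Proof.
move=> mD mg fg; rewrite /Rintegral; congr fine.
rewrite integral_mkcond [RHS]integral_mkcond integralE [RHS]integralE.
have mgD : measurable_fun setT ((EFin \o g) \_ D).
  by apply/(measurable_restrictT _ _).1 => //; exact/measurable_EFinP.
have fgD : {ae m, forall x, ((EFin \o f) \_ D) x = ((EFin \o g) \_ D) x}.
  apply: (ae_impl fg) => x h; rewrite !patchE; case: ifPn => //.
  by rewrite inE => /h /= ->.
congr (_ - _)%E.
- apply: ge0_integral_ae_eq => //; first exact: measurable_funepos.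
  by apply: (ae_impl fgD) => x h; rewrite !funeposE h.
- apply: ge0_integral_ae_eq => //; first exact: measurable_funeneg.
  by apply: (ae_impl fgD) => x h; rewrite !funenegE h.
Qed.

End integrals_up_to_null_sets.

(** * The variational problem *)

Section variational_problem.
Context {R : realType} (s T : R) (hs : 0 < s < 1) (hT : 0 < T).
Local Notation mu := (@lebesgue_measure R).
Local Notation mu2 := (mu \x mu)%E.
Local Notation cell := (period_cell T).

Let s0 : 0 < s. Proof. by case/andP: hs. Qed.

Let zero : R * R -> R := fun=> 0.

Let loc_zero : loc_integrable zero.
Proof.
split; first exact: measurable_cst.
move=> K _ _; rewrite integral0_eq// => p _; by rewrite /zero normr0.
Qed.

Let weak_zero v : weak_partial v zero zero.
Proof.
split => // phi _; rewrite /Rintegral !integral0_eq ?oppr0//; by move=> p _; rewrite mul0r.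
Qed.

Definition ht0 : HT s T.
Proof.
apply: (@MkHT R s T zero zero zero (fun=> 0)) => //.
- move=> e e0; exists 1 => //; apply: aeW => y _.
  by rewrite integral0_eq ?lee_fin ?ltW// => x _; rewrite subr0 expr0n.
- rewrite /energy /L2T_sqnorm !integral0_eq ?adde0 ?ltry//.
    by move=> x _; rewrite expr0n.
  by move=> p _; rewrite expr0n addr0 mulr0.
Defined.

Variables (kap : R -> R) (M : R) (mk : measurable_fun setT kap)
  (hk : forall x, 1 <= kap x <= M) (g : R -> R) (mg : measurable_fun setT g)
  (g_lty : (L2T_sqnorm T g < +oo)%E).

Let kap0 x : 0 <= kap x <= M.
Proof. by case/andP: (hk x) => h1 ->; rewrite (le_trans _ h1). Qed.

Let one0 (x : R) : 0 <= (1 : R) <= 1. Proof. by rewrite ler01 lexx. Qed.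

Let c1 : measurable_fun setT (fun _ : R => 1 : R). Proof. exact: measurable_cst. Qed.

Lemma cell_formC (ka f h : R -> R) : cell_form T ka f h = cell_form T ka h f.
Proof. by apply: eq_Rintegral => x _; rewrite (mulrC (f x)). Qed.

Lemma cell_form_comb (ka f v w : R -> R) (C t : R) : measurable_fun setT ka ->
  (forall x, 0 <= ka x <= C) -> measurable_fun setT f -> measurable_fun setT v ->
  measurable_fun setT w -> (L2T_sqnorm T f < +oo)%E -> (L2T_sqnorm T v < +oo)%E ->
  (L2T_sqnorm T w < +oo)%E ->
  cell_form T ka f (fun x => v x + t * w x) = cell_form T ka f v + t * cell_form T ka f w.
Proof.
move=> mka hka mf mv mw hf hv hw; have mC := measurable_cell T.
have i1 := integrable_cell_form mka hka mf mv hf hv.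
have i2 := integrable_cell_form mka hka mf mw hf hw.
rewrite /cell_form -(@RintegralZl _ _ _ mu _ _ t mC i2).
rewrite -(@RintegralD _ _ _ mu _ _ _ mC i1); last exact: (@integrable_RZ _ _ _ mu _ mC).
by apply: eq_Rintegral => x _; ring.
Qed.

Lemma cell_form_diag (f : R -> R) : (L2T_sqnorm T f < +oo)%E ->
  (cell_form T (fun=> 1) f f)%:E = L2T_sqnorm T f.
Proof.
move=> hf; have ff : L2T_sqnorm T f \is a fin_num by rewrite ge0_fin_numE// L2T_sqnorm_ge0.
rewrite -(fineK ff); congr EFin; rewrite /cell_form /Rintegral /L2T_sqnorm; congr fine.
by apply: eq_integral => x _; rewrite mul1r expr2.
Qed.

Lemma cell_form_le (ka kb f : R -> R) (C : R) : measurable_fun setT ka -> measurable_fun setT kb ->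
  (forall x, 0 <= ka x <= kb x) -> (forall x, kb x <= C) -> measurable_fun setT f ->
  (L2T_sqnorm T f < +oo)%E -> cell_form T ka f f <= cell_form T kb f f.
Proof.
move=> ma mb hab hb mf hf.
have ha0 x : 0 <= ka x <= C by case/andP: (hab x) => -> /le_trans; apply.
have hb0 x : 0 <= kb x <= C by rewrite hb andbT; case/andP: (hab x); exact: le_trans.
have ia := integrable_cell_form ma ha0 mf mf hf hf.
have ib := integrable_cell_form mb hb0 mf mf hf hf.
apply: (@le_Rintegral _ _ _ mu cell _ _ (measurable_cell T) ia ib) => x _.
by apply: ler_wpM2r; [rewrite -expr2 sqr_ge0|case/andP: (hab x)].
Qed.

Definition bform (U V : HT s T) : R :=
  ds s * energy_form U V + cell_form T kap (ht_trace U) (ht_trace V).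

Definition lform (V : HT s T) : R := cell_form T (fun=> 1) g (ht_trace V).

Lemma bformC U V : bform U V = bform V U.
Proof. by rewrite /bform energy_formC cell_formC. Qed.

Lemma bform_comb U V W t : bform U (comb V t W) = bform U V + t * bform U W.
Proof.
rewrite /bform energy_form_combr /=.
have -> := cell_form_comb t mk kap0 (measurable_trace U) (measurable_trace V)
  (measurable_trace W) (trace_lty U) (trace_lty V) (trace_lty W).
by ring.
Qed.

Lemma lform_comb V W t : lform (comb V t W) = lform V + t * lform W.
Proof.
exact: (cell_form_comb t c1 one0 mg (measurable_trace V)
  (measurable_trace W) g_lty (trace_lty V) (trace_lty W)).
Qed.

Let e (U : HT s T) := energy_form U U.
Let q (U : HT s T) := cell_form T (fun=> 1) (ht_trace U) (ht_trace U).

Let e0 U : 0 <= e U.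
Proof. by rewrite -lee_fin /e energy_form_diag energy_ge0. Qed.

Let q0 U : 0 <= q U.
Proof. by rewrite -lee_fin /q cell_form_diag ?L2T_sqnorm_ge0// trace_lty. Qed.

Let d0 : 0 < ds s. Proof. exact: ds_gt0. Qed.

Lemma ht_sqnormE U : ht_sqnorm U = (e U + q U)%:E.
Proof. by rewrite EFinD /e /q energy_form_diag cell_form_diag// trace_lty. Qed.

(** With [bform_upper], this makes the form equivalent to the squared norm of H_T; the
    lower bound uses k + mu >= 1. *)
Lemma bform_lower U : ds s * e U + q U <= bform U U.
Proof.
rewrite /bform lerD2l; apply: (cell_form_le c1 mk _ _ (measurable_trace U) (trace_lty U)).
- by move=> x; rewrite ler01; case/andP: (hk x).
- by move=> x; case/andP: (hk x) => _; exact.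
Qed.

Lemma bform_upper U : bform U U <= (ds s + M) * (e U + q U).
Proof.
have M1 : 1 <= M by case/andP: (hk 0); exact: le_trans.
have h : cell_form T kap (ht_trace U) (ht_trace U) <= M * q U.
  have -> : M * q U = cell_form T (fun=> M) (ht_trace U) (ht_trace U).
    rewrite /q /cell_form.
    have i1 := integrable_cell_form c1 one0 (measurable_trace U) (measurable_trace U) (trace_lty U) (trace_lty U).
    rewrite -(@RintegralZl _ _ _ mu _ _ M (measurable_cell T) i1).
    by apply: eq_Rintegral => x _; rewrite mul1r.
  exact: (cell_form_le mk (measurable_cst M) kap0 (fun=> lexx M) (measurable_trace U) (trace_lty U)).
have eu := e0 U; have qu := q0 U; have dd := d0; rewrite /bform -/(e U).
rewrite mulrDl !mulrDr.
have h1 : 0 <= ds s * q U by rewrite mulr_ge0// ltW.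
have h2 : 0 <= M * e U by rewrite mulr_ge0// (le_trans _ M1).
move: h h1 h2; move: (ds s * e U) (ds s * q U) (M * e U) (M * q U) => a b c d.
lra.
Qed.

(** From 2 g u <= u^2 + g^2; it bounds J from below and yields the a priori
    estimate. *)
Lemma lform_le U : 2 * lform U <= q U + cell_form T (fun=> 1) g g.
Proof.
have mC := measurable_cell T.
have i1 := integrable_cell_form c1 one0 mg (measurable_trace U) g_lty (trace_lty U).
have i2 := integrable_cell_form c1 one0 (measurable_trace U) (measurable_trace U) (trace_lty U) (trace_lty U).
have i3 := integrable_cell_form c1 one0 mg mg g_lty g_lty.
rewrite /lform /q /cell_form -(@RintegralZl _ _ _ mu _ _ 2 mC i1).
rewrite -(@RintegralD _ _ _ mu _ _ _ mC i2 i3).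
apply: (@le_Rintegral _ _ _ mu cell _ _ mC) => //.
- exact: (@integrable_RZ _ _ _ mu _ mC).
- exact: (@integrable_RD _ _ _ mu _ mC).
move=> x _; rewrite !mul1r -subr_ge0 (_ : _ - _ = (g x - ht_trace U x) ^+ 2) ?sqr_ge0//.
by ring.
Qed.

Lemma bform_ge0 U : 0 <= bform U U.
Proof.
by apply: le_trans (bform_lower U); rewrite addr_ge0// mulr_ge0// ltW.
Qed.

Lemma bform_complete (Un : nat -> HT s T) (K : R) :
  (forall n m, (n <= m)%N ->
    bform (comb (Un m) (-1) (Un n)) (comb (Un m) (-1) (Un n)) <= K * 8 ^- n) ->
  exists (U : HT s T) (K' : R), forall n,
    bform (comb U (-1) (Un n)) (comb U (-1) (Un n)) <= K' * 8 ^- n.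
Proof.
move=> hK; set c := (ds s)^-1 + 1.
have dV : 0 < (ds s)^-1 by rewrite invr_gt0.
have nb V : e V + q V <= c * bform V V.
  have hb := bform_lower V.
  apply: (@le_trans _ _ (c * (ds s * e V + q V))); last first.
    by rewrite ler_wpM2l// addr_ge0// ltW.
  rewrite /c mulrDl mul1r mulrDr mulKf ?gt_eqF//.
  have h1 : 0 <= (ds s)^-1 * q V by rewrite mulr_ge0// ltW.
  have h2 : 0 <= ds s * e V by rewrite mulr_ge0// ltW.
  by move: (_^-1 * _) (ds s * _) h1 h2 => a b; lra.
have cd : 0 <= ds s + M.
  by rewrite addr_ge0// ?(ltW d0)//; case/andP: (kap0 0); exact: le_trans.
have [|U hU] := @ht_complete R s T hs hT Un (c * K).
  move=> n m nm; rewrite ht_sqnormE lee_fin -mulrA.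
  apply: le_trans (nb _) _; rewrite ler_wpM2l ?hK//.
  by rewrite addr_ge0// ltW.
exists U, ((ds s + M) * (3 * (c * K))) => n.
apply: le_trans (bform_upper _) _; rewrite -mulrA ler_wpM2l//.
by have := hU n; rewrite ht_sqnormE lee_fin.
Qed.

Lemma bform_solvable : exists U, forall V, bform U V = lform V.
Proof.
apply: (@quadratic_solution R _ (@comb R s T) bform lform (cell_form T (fun=> 1) g g)
  bformC bform_comb lform_comb bform_ge0 _ bform_complete ht0) => U.
apply: le_trans (lform_le U) _; rewrite lerD2r.
by apply: le_trans (bform_lower U); rewrite lerDr mulr_ge0// ltW.
Qed.

(** The translates of a period by the multiples of T cover the line, and countably
    many null sets are excluded. *)
Lemma ae_periodic_line (P : R -> Prop) : (forall x, P (x + T) <-> P x) ->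
  {ae mu, forall x, cell x -> P x} -> {ae mu, forall x, P x}.
Proof.
move=> perP [N [mN N0 hN]].
have sh (c : R) : {ae mu, forall x, cell (x + c) -> P (x + c)}.
  exists ((fun x => x + c) @^-1` N); split.
  - rewrite -[X in measurable X]setTI.
    have ma : measurable_fun setT (fun x : R => x + c) by exact: measurable_funD.
    exact: ma.
  - by rewrite -[RHS]N0; exact: lebesgue_measure_translate.
  - by move=> x nx; apply: hN.
have perN (n : nat) x : P (x + n%:R * T) <-> P x.
  elim: n => [|n IH]; first by rewrite mul0r addr0.
  by rewrite -natr1 mulrDl mul1r addrA perP.
have perZ (n : int) x : P (x + n%:~R * T) <-> P x.
  case: n => n; first exact: perN.
  have e1 : x + (Negz n)%:~R * T + n.+1%:R * T = x by rewrite NegzE mulrNz mulNr subrK.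
  have := perN n.+1 (x + (Negz n)%:~R * T); rewrite e1 => -[h1 h2].
  by split.
apply: (ae_impl (ae_forall_count (fun n : int => sh (n%:~R * T)))) => x hx.
pose n := Num.floor ((x + T / 2) / T).
have [n1 n2] : n%:~R <= (x + T / 2) / T /\ (x + T / 2) / T < n%:~R + 1.
  by have /andP[] := floor_itv ((x + T / 2) / T); rewrite intrD.
rewrite ler_pdivlMr// in n1; rewrite ltr_pdivrMr// mulrDl mul1r in n2.
apply/(perZ (- n)); apply: hx.
rewrite /period_cell /= in_itv /= mulrNz mulNr.
have tt : T = T / 2 + T / 2 by rewrite -splitr.
by move: (n%:~R * T) n1 n2 => a; lra.
Qed.

(** The difference D of two solutions satisfies B D D = 0, whence its trace vanishes
    by [bform_lower]. *)
Lemma bform_unique (U V : HT s T) : (forall W, bform U W = lform W) ->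
  (forall W, bform V W = lform W) -> {ae mu, forall x, ht_trace V x = ht_trace U x}.
Proof.
move=> hU hV; set D := comb V (-1) U.
have D0 : bform D D = 0.
  by rewrite {2}/D bform_comb (bformC D V) (bformC D U) hU hV mulN1r subrr.
have qD : q D = 0.
  apply/eqP; rewrite eq_le q0 andbT -D0; apply: le_trans (bform_lower D).
  by rewrite lerDr mulr_ge0// ltW.
have mD := measurable_trace D.
have hcell : {ae mu, forall x, cell x -> ht_trace V x = ht_trace U x}.
  have i0 : (\int[mu]_(x in cell) (ht_trace D x ^+ 2)%:E <= 0)%E.
    by rewrite -[leLHS](cell_form_diag (trace_lty D)) lee_fin -/(q D) qD.
  have h := @ae0_of_integral_sq _ _ _ mu cell _ (measurable_cell T) (measurable_funTS mD) i0.
  by apply: (ae_impl h) => x hx /hx /eqP; rewrite /= mulN1r subr_eq0 => /eqP.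
by apply: ae_periodic_line hcell => x; rewrite !ht_trace_per.
Qed.

(** Testing with U itself, d_s E + int u^2 <= B U U = int g u, and 2 int g u is at most
    int u^2 + int g^2; hence 2 d_s E <= int g^2 and int u^2 <= int g^2, and the seminorm
    is at most 24 E / s^2 by [gagliardo_le]. *)
Lemma solution_estimate (U : HT s T) : (forall W, bform U W = lform W) ->
  (HsT_sqnorm s T (ht_trace U) <= (12 / (s ^+ 2 * ds s) + 1)%:E * L2T_sqnorm T g)%E.
Proof.
move=> hU; have hl := lform_le U; rewrite -(hU U) in hl.
have hb := bform_lower U; have eu := e0 U; have qu := q0 U.
rewrite -(cell_form_diag g_lty); set G := cell_form _ _ g g in hl *.
have de : 0 <= ds s * e U by rewrite mulr_ge0// ltW.
have b1 : 2 * (ds s * e U) <= G by lra.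
have b2 : q U <= G by lra.
rewrite /HsT_sqnorm -(cell_form_diag (trace_lty U)).
rewrite (_ : (12 / (s ^+ 2 * ds s) + 1)%:E * G%:E = (12 / (s ^+ 2 * ds s) * G)%:E + G%:E)%E; last first.
  by rewrite -EFinM mulrDl mul1r.
apply: leeD; last by rewrite lee_fin.
apply: le_trans (gagliardo_le hs hT U) _.
rewrite -energy_form_diag -EFinM lee_fin -/(e U).
rewrite (_ : 24 / s ^+ 2 * e U = 12 / (s ^+ 2 * ds s) * (2 * (ds s * e U))); last first.
  by field; rewrite !gt_eqF.
by rewrite ler_wpM2l// divr_ge0// mulr_ge0// ?exprn_ge0// ltW.
Qed.

End variational_problem.

Theorem theorem2p1 (R : realType) (s T : R) (k : R -> R)
    (hs : 0 < s < 1) (hT : 0 < T)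
    (k_meas : leb_measurable k)
    (k_bounded : exists M : R, forall x, `|k x| <= M)
    (k_periodic : periodic k T) :
  exists2 gamma : R, 0 <= gamma &
    forall mu : R, gamma <= mu ->
    exists C : R, forall g : R -> R, L2T T g ->
    exists u : R -> R,
      [/\ HsT s T u,
          weak_solution s T k mu g u,
          forall v : R -> R, weak_solution s T k mu g v ->
            {ae @lebesgue_measure R, forall x, v x = u x} &
          HsT_norm s T u <= C * L2T_norm T g].
Proof.
have [k0 mk0 kk0] := k_meas; have [M hM] := k_bounded.
have M0 : 0 <= M by apply: le_trans (hM 0).
have s0 : 0 < s by case/andP: hs.
have d0 := ds_gt0 hs.
exists (M + 1); first by rewrite addr_ge0.
move=> mu hmu.
(* A Borel representative of k, truncated to satisfy the bound of k at every point. *)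
pose k1 x := Num.max (- M) (Num.min M (k0 x)).
have mk1 : measurable_fun setT k1.
  by apply: measurable_maxr => //; apply: measurable_minr.
have k1b x : - M <= k1 x <= M.
  by rewrite /k1 le_max lexx /= ge_max ge_min lexx /= andbT; lra.
have kk1 : {ae @lebesgue_measure R, forall x, k x = k1 x}.
  apply: (ae_impl kk0) => x kx; rewrite /k1 -kx.
  have := hM x; rewrite ler_norml => /andP[h1 h2].
  by rewrite min_r// max_r.
pose kap x := k1 x + mu.
have mkap : measurable_fun setT kap by exact: measurable_funD.
have hkap x : 1 <= kap x <= M + mu.
  by have /andP[h1 h2] := k1b x; rewrite /kap; apply/andP; split; lra.
pose C := Num.sqrt (12 / (s ^+ 2 * ds s) + 1).
exists C => g [mg pg g_lty].
have equiv (U V : HT s T) :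
    (ds s * energy_form U V + \int[@lebesgue_measure R]_(x in period_cell T)
        ((k x + mu) * ht_trace U x * ht_trace V x) =
     \int[@lebesgue_measure R]_(x in period_cell T) (g x * ht_trace V x)) <->
    bform kap U V = lform g V.
  have -> : \int[@lebesgue_measure R]_(x in period_cell T) ((k x + mu) * ht_trace U x * ht_trace V x)
      = cell_form T kap (ht_trace U) (ht_trace V).
    apply: Rintegral_ae_eq; first exact: measurable_cell.
      apply: measurable_funTS; apply: measurable_funM => //.
      by apply: measurable_funM; exact: measurable_trace.
    by apply: (ae_impl kk1) => x kx _; rewrite /kap kx mulrA.
  have -> : \int[@lebesgue_measure R]_(x in period_cell T) (g x * ht_trace V x) = lform g V.
    by apply: eq_Rintegral => x _; rewrite mul1r.
  by [].
have [U hU] := bform_solvable hs hT mkap hkap mg g_lty.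
have est := solution_estimate hs hT mkap hkap mg g_lty hU.
have gf : L2T_sqnorm T g \is a fin_num by rewrite ge0_fin_numE// L2T_sqnorm_ge0.
have C0 : 0 <= 12 / (s ^+ 2 * ds s) + 1.
  by rewrite addr_ge0// divr_ge0// mulr_ge0 ?exprn_ge0// ltW.
have Hlt : (HsT_sqnorm s T (ht_trace U) < +oo)%E.
  by apply: le_lt_trans est _; rewrite -(fineK gf) -EFinM ltry.
exists (ht_trace U); split.
- by split; [exact: measurable_trace|exact: ht_trace_per|].
- split; first exact: ht_trace_per.
  exists U; split; first exact: aeW.
  by move=> V; apply/equiv.
- move=> v [_ [V [vV hV]]].
  have hV' W : bform kap V W = lform g W by apply/equiv.
  have h := bform_unique hs hT mkap hkap hU hV'.
  by apply: (ae_impl (ae_conj vV h)) => x [-> ->].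
have H0 : (0 <= HsT_sqnorm s T (ht_trace U))%E.
  apply: adde_ge0; last exact: L2T_sqnorm_ge0.
  by apply: integral_ge0 => x _; apply: integral_ge0 => z _; nneg.
rewrite /HsT_norm /L2T_norm /C -sqrtrM//; apply: ler_wsqrtr.
have Hf : HsT_sqnorm s T (ht_trace U) \is a fin_num by rewrite ge0_fin_numE.
by move: est; rewrite -{1}(fineK Hf) -{1}(fineK gf) -EFinM lee_fin.
Qed.
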